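(* Let $p$ be a prime number, $k$ a field of characteristic zero, and let $\mathscr{U}$ be a downwards closed subcategory of finite $p$-groups (i.e. if $G\in\mathscr{U}$ and $G\twoheadrightarrow H$ is a surjective homomorphism, then $H\in\mathscr{U}$). Then the map $$\mathfrak{p}_{-}\colon\pi_0\mathscr{U}\to\mathrm{Spc}(\mathsf{D}(\mathscr{U})^c),\qquad G\mapsto\mathfrak{p}_G=\{X\in\mathsf{D}(\mathscr{U})^c\mid X(G)\simeq 0\},$$ from the discrete space $\pi_0\mathscr{U}$ of isomorphism classes of groups in $\mathscr{U}$ is an open embedding.
   Context: $\mathscr{U}$ is regarded as a full subcategory (closed under isomorphism) of the category $\mathscr{G}$ of finite groups with morphisms the conjugacy classes of surjective group homomorphisms. $\mathsf{D}(\mathscr{U})$ is the derived category of $\mathrm{Fun}(\mathscr{U}^{\mathrm{op}},\mathrm{Mod}_k)$, with the pointwise tensor product over $k$, and $\mathsf{D}(\mathscr{U})^c$ is its full subcategory of compact objects, an essentially small tensor-triangulated category here. The Balmer spectrum $\mathrm{Spc}(\mathscr{K})$ of an essentially small tensor-triangulated category is the set of prime thick ideals (thick = triangulated and closed under retracts; ideal = closed under tensoring with any object; prime = proper and $X\otimes Y\in\mathfrak{p}$ implies $X\in\mathfrak{p}$ or $Y\in\mathfrak{p}$), with the sets $\mathrm{supp}(X)=\{\mathfrak{p}\mid X\notin\mathfrak{p}\}$ as a basis of closed sets. *)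

(* Defs.v *)
From HB Require Import structures.
From mathcomp Require Import all_boot all_order all_algebra all_fingroup.
From mathcomp Require Import boolp.

Set Implicit Arguments.
Unset Strict Implicit.
Unset Printing Implicit Defensive.

Import GRing.Theory.

Local Notation repr := generic_quotient.repr.

Local Open Scope ring_scope.
Local Open Scope quotient_scope.

(** The library's [topologicalType] is confined to a universe below that of
    [finGroupType] and [lmodType], in which the Balmer spectrum does not live. *)
Record is_topology (T : Type) (opn : (T -> Prop) -> Prop) : Prop := {
  topT : opn (fun _ => True);
  topI : forall A B, opn A -> opn B -> opn (fun x => A x /\ B x);
  topU : forall F : (T -> Prop) -> Prop, (forall A, F A -> opn A) ->
    opn (fun x => exists2 A, F A & A x) }.

Record space := Space {
  pt :> Type;
  opens : (pt -> Prop) -> Prop;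
  opens_topology : is_topology opens }.

Lemma discrete_topology (T : Type) : is_topology (fun _ : T -> Prop => True).
Proof. by []. Qed.

Definition discrete (T : Type) : space := Space (discrete_topology T).

Definition generated_opens (T : Type) (B : (T -> Prop) -> Prop) (A : T -> Prop) :=
  forall opn, is_topology opn -> (forall A', B A' -> opn A') -> opn A.

Lemma generated_topology (T : Type) (B : (T -> Prop) -> Prop) :
  is_topology (generated_opens B).
Proof.
split=> [opn top _|A A' hA hA' opn top hB|F hF opn top hB].
- exact: topT.
- by apply: (topI top); [exact: hA|exact: hA'].
- by apply: (topU top) => A /hF; apply.
Qed.

Definition generated (T : Type) (B : (T -> Prop) -> Prop) : space :=
  Space (generated_topology B).

Definition open_embedding (S T : space) (f : S -> T) : Prop :=
  [/\ injective f,
      forall B, opens B -> opens (fun x => B (f x)) &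
      forall A, opens A -> opens (fun y => exists2 x, A x & f x = y)].

Section MkLinear.
Variables (k : fieldType) (V W : lmodType k).

Definition lin_fun (f : V -> W) of linear f := f.

HB.instance Definition _ f (hf : linear f) :=
  GRing.isLinear.Build k V W _ (@lin_fun f hf) hf.

Definition mklin (f : V -> W) (hf : linear f) : {linear V -> W} :=
  @lin_fun f hf.

End MkLinear.

(** [pres A] is the module with generators [gen e], [e : E], that is universal
    among the modules [M] with a map [E -> M] satisfying [A]: formal linear
    combinations of elements of [E], two of them being identified as soon as
    every [phi : E -> M] with [A M phi] gives them the same value. *)
Section Presentation.
Variables (k : fieldType) (E : choiceType).
Variable A : forall M : lmodType k, (E -> M) -> Prop.

Definition fsum (M : lmodType k) (phi : E -> M) (s : seq (k * E)) : M :=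
  \sum_(c <- s) c.1 *: phi c.2.

Definition pres_rel (s t : seq (k * E)) : bool :=
  `[< forall (M : lmodType k) (phi : E -> M), A phi -> fsum phi s = fsum phi t >].

Lemma pres_rel_refl : reflexive pres_rel.
Proof. by move=> s; apply/asboolP. Qed.

Lemma pres_rel_sym : symmetric pres_rel.
Proof.
by move=> s t; apply/asboolP/asboolP => h M phi hphi; rewrite h.
Qed.

Lemma pres_rel_trans : transitive pres_rel.
Proof.
move=> t s u /asboolP h1 /asboolP h2; apply/asboolP => M phi hphi.
by rewrite h1 // h2.
Qed.

Canonical pres_equiv := EquivRel pres_rel pres_rel_refl pres_rel_sym pres_rel_trans.

Definition pres := {eq_quot pres_equiv}.

HB.instance Definition _ := Choice.on pres.

Definition peval (M : lmodType k) (phi : E -> M) (x : pres) : M :=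
  fsum phi (repr x).

Lemma peval_pi (M : lmodType k) (phi : E -> M) (s : seq (k * E)) :
  A phi -> peval phi (\pi_pres s) = fsum phi s.
Proof.
move=> hphi; have /eqP : \pi_pres (repr (\pi_pres s)) = \pi_pres s by rewrite reprK.
by rewrite eqmodE => /asboolP; apply.
Qed.

Lemma pres_ext (x y : pres) :
  (forall (M : lmodType k) (phi : E -> M), A phi -> peval phi x = peval phi y) ->
  x = y.
Proof.
move=> h; rewrite -[x]reprK -[y]reprK; apply/eqP; rewrite eqmodE.
by apply/asboolP => M phi; apply: h.
Qed.

Lemma fsum_cat (M : lmodType k) (phi : E -> M) s t :
  fsum phi (s ++ t) = fsum phi s + fsum phi t.
Proof. exact: big_cat. Qed.

Definition sscale (a : k) (s : seq (k * E)) := [seq (a * c.1, c.2) | c <- s].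

Lemma fsum_scale (M : lmodType k) (phi : E -> M) a s :
  fsum phi (sscale a s) = a *: fsum phi s.
Proof.
rewrite /fsum /sscale big_map scaler_sumr.
by apply: eq_bigr => c _; rewrite scalerA.
Qed.

Definition pzero : pres := \pi_pres [::].
Definition padd (x y : pres) : pres := \pi_pres (repr x ++ repr y).
Definition pscale (a : k) (x : pres) : pres := \pi_pres (sscale a (repr x)).
Definition popp (x : pres) : pres := pscale (-1) x.

Lemma peval0 (M : lmodType k) (phi : E -> M) : A phi -> peval phi pzero = 0.
Proof. by move=> h; rewrite peval_pi // /fsum big_nil. Qed.

Lemma pevalD (M : lmodType k) (phi : E -> M) x y :
  A phi -> peval phi (padd x y) = peval phi x + peval phi y.
Proof. by move=> h; rewrite peval_pi // fsum_cat. Qed.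

Lemma pevalZ (M : lmodType k) (phi : E -> M) a x :
  A phi -> peval phi (pscale a x) = a *: peval phi x.
Proof. by move=> h; rewrite peval_pi // fsum_scale. Qed.

Lemma paddA : associative padd.
Proof. by move=> x y z; apply: pres_ext => M phi h; rewrite !pevalD // addrA. Qed.

Lemma paddC : commutative padd.
Proof. by move=> x y; apply: pres_ext => M phi h; rewrite !pevalD // addrC. Qed.

Lemma padd0 : left_id pzero padd.
Proof. by move=> x; apply: pres_ext => M phi h; rewrite pevalD // peval0 // add0r. Qed.

Lemma paddN : left_inverse pzero popp padd.
Proof.
move=> x; apply: pres_ext => M phi h.
by rewrite pevalD // pevalZ // peval0 // scaleN1r addNr.
Qed.

HB.instance Definition _ := GRing.isZmodule.Build pres paddA paddC padd0 paddN.

Lemma pscaleA a b x : pscale a (pscale b x) = pscale (a * b) x.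
Proof. by apply: pres_ext => M phi h; rewrite !pevalZ // scalerA. Qed.

Lemma pscale1 : left_id 1 pscale.
Proof. by move=> x; apply: pres_ext => M phi h; rewrite pevalZ // scale1r. Qed.

Lemma pscaleDr : right_distributive pscale +%R.
Proof.
move=> a x y; apply: pres_ext => M phi h.
by rewrite pevalZ // !pevalD // !pevalZ // scalerDr.
Qed.

Lemma pscaleDl x : {morph pscale^~ x : a b / a + b}.
Proof.
move=> a b; apply: pres_ext => M phi h.
by rewrite pevalD // !pevalZ // scalerDl.
Qed.

HB.instance Definition _ :=
  GRing.Zmodule_isLmodule.Build k pres pscaleA pscale1 pscaleDr pscaleDl.

Definition gen (e : E) : pres := \pi_pres [:: (1, e)].

Lemma peval_gen (M : lmodType k) (phi : E -> M) e : A phi -> peval phi (gen e) = phi e.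
Proof. by move=> h; rewrite peval_pi // /fsum big_seq1 scale1r. Qed.

Lemma peval_linear (M : lmodType k) (phi : E -> M) : A phi -> linear (peval phi).
Proof.
move=> h a x y; rewrite [LHS](pevalD _ _ h); congr (_ + _).
exact: (pevalZ a x h).
Qed.

Definition plift (M : lmodType k) (phi : E -> M) (h : A phi) : {linear pres -> M} :=
  mklin (peval_linear h).

Lemma plift_gen (M : lmodType k) (phi : E -> M) (h : A phi) e :
  plift h (gen e) = phi e.
Proof. exact: peval_gen. Qed.

Lemma pres_gen (x : pres) : x = \sum_(c <- repr x) c.1 *: gen c.2.
Proof.
apply: pres_ext => M phi h; rewrite -[LHS]/(plift h _) -[RHS]/(plift h _) linear_sum.
rewrite /peval /fsum; apply: eq_bigr => c _.
by rewrite linearZ plift_gen.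
Qed.

Lemma plin_ext (M : lmodType k) (f g : {linear pres -> M}) :
  (forall e, f (gen e) = g (gen e)) -> f =1 g.
Proof.
move=> h x; rewrite (pres_gen x) !linear_sum.
by apply: eq_bigr => c _; rewrite !linearZ h.
Qed.

End Presentation.

Definition surjective (S T : Type) (f : S -> T) := forall y, exists x, f x = y.

Definition downward_closed (U : finGroupType -> Prop) :=
  forall (G H : finGroupType) (f : {multiplicative G -> H}),
    U G -> surjective f -> U H.

Definition Uob (U : finGroupType -> Prop) := {G : finGroupType | U G}.

Definition Ugrp (U : finGroupType -> Prop) (G : Uob U) : finGroupType := sval G.
Coercion Ugrp : Uob >-> FinGroup.type.

Definition Uiso (U : finGroupType -> Prop) (G H : Uob U) : Prop :=
  [set: Ugrp G]%SET \isog [set: Ugrp H]%SET.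

Section Derived.
Variables (k : fieldType) (U : finGroupType -> Prop).
Implicit Types (G H K : Uob U) (n : int).

(** Morphisms of U are conjugacy classes of surjections: [res] is defined on
    surjections and [res_conj] makes it a function of the conjugacy class. *)
Record rep := Rep {
  rob :> Uob U -> lmodType k;
  res : forall G H (f : {multiplicative G -> H}), surjective f ->
    {linear rob H -> rob G};
  res_conj : forall G H (f g : {multiplicative G -> H})
    (hf : surjective f) (hg : surjective g),
    (exists h : H, forall x, g x = (f x ^ h)%g) -> res hf =1 res hg;
  res_id : forall G (f : {multiplicative G -> G}) (hf : surjective f),
    f =1 id -> res hf =1 id;
  res_comp : forall G H K (f : {multiplicative G -> H})
    (g : {multiplicative H -> K}) (h : {multiplicative G -> K})
    (hf : surjective f) (hg : surjective g) (hh : surjective h),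
    h =1 g \o f -> res hh =1 res hf \o res hg }.

Record rhom (V W : rep) := RHom {
  rmap :> forall G, {linear V G -> W G};
  rnat : forall G H (f : {multiplicative G -> H}) (hf : surjective f) x,
    rmap G (res V hf x) = res W hf (rmap H x) }.

Record cplx := Cplx {
  cob :> int -> rep;
  cd : forall n, rhom (cob n) (cob (n + 1));
  cdd : forall n G x, cd (n + 1) G (cd n G x) = 0 }.

Record chmap (X Y : cplx) := ChMap {
  cmap :> forall n, rhom (X n) (Y n);
  ccomm : forall n G x, cmap (n + 1) G (cd X n G x) = cd Y n G (cmap n G x) }.

Definition rid (V : rep) : rhom V V := @RHom V V (fun G => idfun) (fun _ _ _ _ _ => erefl).

Definition cid (X : cplx) : chmap X X := @ChMap X X (fun n => rid (X n)) (fun _ _ _ => erefl).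

Lemma rcomp_nat (V W Z : rep) (g : rhom W Z) (f : rhom V W) G H
    (u : {multiplicative G -> H}) (hu : surjective u) x :
  g G (f G (res V hu x)) = res Z hu (g H (f H x)).
Proof. by rewrite !rnat. Qed.

Definition rcomp (V W Z : rep) (g : rhom W Z) (f : rhom V W) : rhom V Z :=
  @RHom V Z (fun G => g G \o f G) (rcomp_nat g f).

Lemma ccomp_comm (X Y Z : cplx) (g : chmap Y Z) (f : chmap X Y) n G x :
  g (n + 1) G (f (n + 1) G (cd X n G x)) = cd Z n G (g n G (f n G x)).
Proof. by rewrite !ccomm. Qed.

Definition ccomp (X Y Z : cplx) (g : chmap Y Z) (f : chmap X Y) : chmap X Z :=
  @ChMap X Z (fun n => rcomp (g n) (f n)) (ccomp_comm g f).

Lemma radd_nat (V W : rep) (f g : rhom V W) G H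
    (u : {multiplicative G -> H}) (hu : surjective u) x :
  f G (res V hu x) + g G (res V hu x) = res W hu (f H x + g H x).
Proof. by rewrite !rnat linearD. Qed.

Definition radd (V W : rep) (f g : rhom V W) : rhom V W :=
  @RHom V W (fun G => f G \+ g G) (radd_nat f g).

Lemma cadd_comm (X Y : cplx) (f g : chmap X Y) n G x :
  f (n + 1) G (cd X n G x) + g (n + 1) G (cd X n G x)
  = cd Y n G (f n G x + g n G x).
Proof. by rewrite !ccomm linearD. Qed.

Definition cadd (X Y : cplx) (f g : chmap X Y) : chmap X Y :=
  @ChMap X Y (fun n => radd (f n) (g n)) (cadd_comm f g).

Lemma rzero_nat (V W : rep) G H
    (u : {multiplicative G -> H}) (hu : surjective u) (x : V H) :
  0 = res W hu 0.
Proof. by rewrite linear0. Qed.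

Definition rzero (V W : rep) : rhom V W :=
  @RHom V W (fun G => \0) (@rzero_nat V W).

Lemma czero_comm (X Y : cplx) n G (x : X n G) : 0 = cd Y n G 0.
Proof. by rewrite linear0. Qed.

Definition czero (X Y : cplx) : chmap X Y :=
  @ChMap X Y (fun n => rzero (X n) (Y n)) (@czero_comm X Y).

Definition bdry (X : cplx) n G (z : X (n + 1) G) : Prop :=
  exists w : X n G, cd X n G w = z.

(** Cohomology is taken in degree [n + 1], for all [n : int]. *)
Definition qiso (X Y : cplx) (f : chmap X Y) : Prop := forall n G,
  (forall z : X (n + 1) G, cd X (n + 1) G z = 0 ->
     bdry (f (n + 1) G z) -> bdry z) /\
  (forall y : Y (n + 1) G, cd Y (n + 1) G y = 0 ->
     exists2 x : X (n + 1) G, cd X (n + 1) G x = 0 & bdry (y - f (n + 1) G x)).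

(** The complex of [k]-modules X(G) is zero in D(k). *)
Definition acyclic_at G (X : cplx) : Prop :=
  forall n (z : X (n + 1) G), cd X (n + 1) G z = 0 -> bdry z.

Lemma rneg_nat (V W : rep) (f : rhom V W) G H
    (u : {multiplicative G -> H}) (hu : surjective u) x :
  - f G (res V hu x) = res W hu (- f H x).
Proof. by rewrite rnat linearN. Qed.

Definition rneg (V W : rep) (f : rhom V W) : rhom V W :=
  @RHom V W (fun G => \- f G) (rneg_nat f).

Lemma shift_dd (X : cplx) n G x :
  rneg (cd X (n + 1 + 1)) G (rneg (cd X (n + 1)) G x) = 0.
Proof. by rewrite /= linearN opprK cdd. Qed.

Definition shift (X : cplx) : cplx :=
  @Cplx (fun n => X (n + 1)) (fun n => rneg (cd X (n + 1))) (@shift_dd X).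

Section DirectSum.
Variables V W : rep.

Lemma rsum_linear G H (f : {multiplicative G -> H}) (hf : surjective f) :
  linear (fun x : V H * W H => (res V hf x.1, res W hf x.2) : V G * W G).
Proof. by move=> a x y; rewrite /= !linearP. Qed.

Lemma rsum_conj G H (f g : {multiplicative G -> H})
    (hf : surjective f) (hg : surjective g) :
  (exists h : H, forall x, g x = (f x ^ h)%g) ->
  mklin (rsum_linear hf) =1 mklin (rsum_linear hg).
Proof.
by move=> e x; congr pair; [exact: (res_conj hf hg e)|exact: (res_conj hf hg e)].
Qed.

Lemma rsum_id G (f : {multiplicative G -> G}) (hf : surjective f) :
  f =1 id -> mklin (rsum_linear hf) =1 id.
Proof.
by move=> e [x y]; congr pair; [exact: (res_id hf e)|exact: (res_id hf e)].
Qed.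

Lemma rsum_comp G H K (f : {multiplicative G -> H})
    (g : {multiplicative H -> K}) (h : {multiplicative G -> K})
    (hf : surjective f) (hg : surjective g) (hh : surjective h) :
  h =1 g \o f ->
  mklin (rsum_linear hh) =1 mklin (rsum_linear hf) \o mklin (rsum_linear hg).
Proof.
by move=> e x; congr pair; [exact: (res_comp hf hg hh e)|exact: (res_comp hf hg hh e)].
Qed.

Definition rsum : rep :=
  @Rep (fun G => (V G * W G)%type : lmodType k) (fun G H f hf => mklin (rsum_linear hf))
    rsum_conj rsum_id rsum_comp.

End DirectSum.

Section Cone.
Variables (X Y : cplx) (f : chmap X Y).

Let C (n : int) := rsum (X (n + 1)) (Y n).

Lemma cone_d_linear n G :
  linear (fun z : X (n + 1) G * Y n G =>
    (- cd X (n + 1) G z.1, f (n + 1) G z.1 + cd Y n G z.2)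
      : X (n + 1 + 1) G * Y (n + 1) G).
Proof.
move=> a z t; rewrite /= !linearP; congr pair.
by rewrite /= scalerDr addrACA.
Qed.

Lemma cone_d_nat n G H (u : {multiplicative G -> H}) (hu : surjective u) x :
  mklin (@cone_d_linear n G) (res (C n) hu x)
  = res (C (n + 1)) hu (mklin (@cone_d_linear n H) x).
Proof. by congr pair; rewrite /= ?linearN ?linearD !rnat. Qed.

Definition cone_d n : rhom (C n) (C (n + 1)) :=
  @RHom (C n) (C (n + 1)) (fun G => mklin (@cone_d_linear n G)) (@cone_d_nat n).

Lemma cone_dd n G x : cone_d (n + 1) G (cone_d n G x) = 0.
Proof.
congr pair; rewrite /= linearN; first by rewrite cdd !oppr0.
by rewrite linearD cdd addr0 ccomm addNr.
Qed.

Definition cone : cplx := @Cplx C cone_d cone_dd.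

End Cone.

(** (X ⊗ Y)^n(G) is the direct sum of the X^i(G) ⊗_k Y^j(G) with i + j = n,
    presented by generators x ⊗ y and bilinearity. *)
Section Tensor.
Variables X Y : cplx.

Definition tidx (n : int) := {ij : int * int | ij.1 + ij.2 == n}.

Definition tgen n G : choiceType :=
  {ij : tidx n & (X (sval ij).1 G * Y (sval ij).2 G)%type}.

Definition ttag n G (ij : tidx n) (x : X (sval ij).1 G) (y : Y (sval ij).2 G) :
  tgen n G := existT _ ij (x, y).

Definition bilin n G (M : lmodType k) (phi : tgen n G -> M) : Prop :=
  forall ij : tidx n,
    (forall y, linear (fun x => phi (@ttag n G ij x y))) /\
    (forall x, linear (fun y => phi (@ttag n G ij x y))).

Definition tmod n G : lmodType k := pres (@bilin n G).

Definition pure n G (ij : tidx n) x y : tmod n G := gen (@bilin n G) (@ttag n G ij x y).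

Lemma pure_linl n G ij y : linear (fun x => @pure n G ij x y).
Proof.
move=> a x x'; apply: pres_ext => M phi h.
rewrite -[LHS]/(plift h _) -[RHS]/(plift h _) linearP !plift_gen.
by have [hl _] := h ij; apply: (hl y).
Qed.

Lemma pure_linr n G ij x : linear (fun y => @pure n G ij x y).
Proof.
move=> a y y'; apply: pres_ext => M phi h.
rewrite -[LHS]/(plift h _) -[RHS]/(plift h _) linearP !plift_gen.
by have [_ hr] := h ij; apply: (hr x).
Qed.

Definition tres_gen n G H (f : {multiplicative G -> H}) (hf : surjective f)
    (e : tgen n H) : tmod n G :=
  @pure n G (projT1 e) (res (X _) hf (projT2 e).1) (res (Y _) hf (projT2 e).2).

Lemma tres_bilin n G H (f : {multiplicative G -> H}) (hf : surjective f) :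
  bilin (@tres_gen n G H f hf).
Proof.
move=> ij; split=> [y|x] a u v; rewrite /tres_gen /= linearP.
  exact: pure_linl.
exact: pure_linr.
Qed.

Definition tres n G H (f : {multiplicative G -> H}) (hf : surjective f) :
  {linear tmod n H -> tmod n G} := plift (@tres_bilin n G H f hf).

Lemma tres_pure n G H (f : {multiplicative G -> H}) (hf : surjective f) ij x y :
  tres n hf (@pure n H ij x y) = @pure n G ij (res (X _) hf x) (res (Y _) hf y).
Proof. exact: plift_gen. Qed.

Lemma tres_conj n G H (f g : {multiplicative G -> H})
    (hf : surjective f) (hg : surjective g) :
  (exists h : H, forall x, g x = (f x ^ h)%g) -> tres n hf =1 tres n hg.
Proof.
move=> e; apply: plin_ext => -[ij [x y]].
by rewrite [LHS]tres_pure [RHS]tres_pure !(res_conj hf hg e).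
Qed.

Lemma tres_id n G (f : {multiplicative G -> G}) (hf : surjective f) :
  f =1 id -> tres n hf =1 id.
Proof.
move=> e; apply: (plin_ext (g := idfun)) => -[ij [x y]].
by rewrite [LHS]tres_pure !(res_id hf e).
Qed.

Lemma tres_comp n G H K (f : {multiplicative G -> H})
    (g : {multiplicative H -> K}) (h : {multiplicative G -> K})
    (hf : surjective f) (hg : surjective g) (hh : surjective h) :
  h =1 g \o f -> tres n hh =1 tres n hf \o tres n hg.
Proof.
move=> e; apply: (plin_ext (g := tres n hf \o tres n hg)) => -[ij [x y]].
rewrite [LHS]tres_pure /= [in RHS](tres_pure hg x y) tres_pure.
by rewrite !(res_comp hf hg hh e).
Qed.

Definition trep n : rep := @Rep (tmod n) (tres n) (@tres_conj n) (@tres_id n) (@tres_comp n).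

Lemma tidx_l_subproof n (ij : tidx n) : (sval ij).1 + 1 + (sval ij).2 == n + 1.
Proof. by case: ij => -[i j] /= /eqP <-; rewrite addrAC. Qed.

Lemma tidx_r_subproof n (ij : tidx n) : (sval ij).1 + ((sval ij).2 + 1) == n + 1.
Proof. by case: ij => -[i j] /= /eqP <-; rewrite addrA. Qed.

Definition tidx_l n (ij : tidx n) : tidx (n + 1) :=
  exist _ ((sval ij).1 + 1, (sval ij).2) (tidx_l_subproof ij).

Definition tidx_r n (ij : tidx n) : tidx (n + 1) :=
  exist _ ((sval ij).1, (sval ij).2 + 1) (tidx_r_subproof ij).

(** d(x ⊗ y) = dx ⊗ y + (-1)^i x ⊗ dy for x of degree i *)
Definition td_gen n G (e : tgen n G) : tmod (n + 1) G :=
  let: existT ij (x, y) := e in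
  @pure (n + 1) G (tidx_l ij) (cd X _ G x) y
  + (-1) ^ (sval ij).1 *: @pure (n + 1) G (tidx_r ij) x (cd Y _ G y).

Lemma td_bilin n G : bilin (@td_gen n G).
Proof.
move=> ij; split=> [y|x] a u v; rewrite /td_gen /= linearP.
  rewrite (@pure_linl _ _ (tidx_l ij) y) (@pure_linl _ _ (tidx_r ij) _).
  by rewrite !scalerDr !scalerA [_ * a]mulrC addrACA.
rewrite (@pure_linr _ _ (tidx_l ij) _) (@pure_linr _ _ (tidx_r ij) x).
by rewrite !scalerDr !scalerA [_ * a]mulrC addrACA.
Qed.

Definition td_map n G : {linear tmod n G -> tmod (n + 1) G} := plift (@td_bilin n G).

Lemma td_pure n G (ij : tidx n) x y :
  td_map n G (@pure n G ij x y) =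
  @pure (n + 1) G (tidx_l ij) (cd X _ G x) y
  + (-1) ^ (sval ij).1 *: @pure (n + 1) G (tidx_r ij) x (cd Y _ G y).
Proof. exact: plift_gen. Qed.

Lemma td_nat n G H (u : {multiplicative G -> H}) (hu : surjective u) x :
  td_map n G (res (trep n) hu x) = res (trep (n + 1)) hu (td_map n H x).
Proof.
move: x; apply: (plin_ext (f := td_map n G \o tres n hu)
  (g := tres (n + 1) hu \o td_map n H)) => -[ij [x y]].
rewrite /= -[gen _ _]/(@pure n H ij x y) tres_pure !td_pure.
by rewrite linearD linearZ /= !tres_pure !rnat.
Qed.

Definition td n : rhom (trep n) (trep (n + 1)) := @RHom (trep n) (trep (n + 1)) (td_map n) (@td_nat n).

Lemma sign_succ (i : int) : (-1) ^ (i + 1) = - (-1) ^ i :> k.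
Proof. by rewrite expfzDr ?oppr_eq0 ?oner_eq0 // expr1z mulrN1. Qed.

Lemma pure_irr n G (i j : int) (p q : i + j == n) (x : X i G) (y : Y j G) :
  @pure n G (exist _ (i, j) p) x y = @pure n G (exist _ (i, j) q) x y.
Proof. by rewrite (bool_irrelevance p q). Qed.

Lemma tdd n G x : td (n + 1) G (td n G x) = 0.
Proof.
move: x; apply: (plin_ext (f := td_map (n + 1) G \o td_map n G) (g := \0)).
move=> -[ij [x y]].
rewrite /= -[gen _ _]/(@pure n G ij x y) td_pure linearD linearZ /= !td_pure /= !cdd.
have p0l m (q : tidx m) y' : @pure m G q 0 y' = 0.
  exact: (linear0 (mklin (@pure_linl m G q y'))).
have p0r m (q : tidx m) x' : @pure m G q x' 0 = 0.
  exact: (linear0 (mklin (@pure_linr m G q x'))).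
rewrite p0l p0r scaler0 addr0 add0r sign_succ scaleNr.
have key (V : zmodType) (a b : V) : b = a -> - a + b = 0.
  by move=> ->; rewrite addNr.
by apply: key; congr (_ *: _); exact: pure_irr.
Qed.

Definition tensor : cplx := @Cplx trep td tdd.

End Tensor.

(** D(U) is the localisation of the category of complexes at the
    quasi-isomorphisms: morphisms are the formal composites and sums of chain
    maps and inverses of quasi-isomorphisms, up to the congruence [deq] that
    makes them a preadditive category, [dmap] an additive functor, and [dinv s]
    an inverse of [dmap s].  (As quasi-isomorphisms are stable under finite
    direct sums, the localisation is additive even when only composites are
    adjoined; having sums as a constructor gives the addition of morphisms
    without the calculus of fractions and does not change the category.) *)
Inductive dmor : cplx -> cplx -> Type :=
| dmap X Y : chmap X Y -> dmor X Y
| dinv X Y (s : chmap X Y) : qiso s -> dmor Y X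
| dcomp X Y Z : dmor Y Z -> dmor X Y -> dmor X Z
| dadd X Y : dmor X Y -> dmor X Y -> dmor X Y.

Definition did (X : cplx) : dmor X X := dmap (cid X).
Definition dzero (X Y : cplx) : dmor X Y := dmap (czero X Y).

Inductive deq : forall X Y, dmor X Y -> dmor X Y -> Prop :=
| deq_refl X Y (f : dmor X Y) : deq f f
| deq_sym X Y (f g : dmor X Y) : deq f g -> deq g f
| deq_trans X Y (f g h : dmor X Y) : deq f g -> deq g h -> deq f h
| deq_comp X Y Z (g g' : dmor Y Z) (f f' : dmor X Y) :
    deq g g' -> deq f f' -> deq (dcomp g f) (dcomp g' f')
| deq_add X Y (f f' g g' : dmor X Y) :
    deq f f' -> deq g g' -> deq (dadd f g) (dadd f' g')
| deq_compA X Y Z W (h : dmor Z W) (g : dmor Y Z) (f : dmor X Y) :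
    deq (dcomp h (dcomp g f)) (dcomp (dcomp h g) f)
| deq_id_comp X Y (f : dmor X Y) : deq (dcomp (did Y) f) f
| deq_comp_id X Y (f : dmor X Y) : deq (dcomp f (did X)) f
| deq_addA X Y (f g h : dmor X Y) : deq (dadd f (dadd g h)) (dadd (dadd f g) h)
| deq_addC X Y (f g : dmor X Y) : deq (dadd f g) (dadd g f)
| deq_add0 X Y (f : dmor X Y) : deq (dadd (dzero X Y) f) f
| deq_compDl X Y Z (g g' : dmor Y Z) (f : dmor X Y) :
    deq (dcomp (dadd g g') f) (dadd (dcomp g f) (dcomp g' f))
| deq_compDr X Y Z (g : dmor Y Z) (f f' : dmor X Y) :
    deq (dcomp g (dadd f f')) (dadd (dcomp g f) (dcomp g f'))
| deq_map X Y (f g : chmap X Y) :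
    (forall n G x, f n G x = g n G x) -> deq (dmap f) (dmap g)
| deq_map_comp X Y Z (g : chmap Y Z) (f : chmap X Y) :
    deq (dmap (ccomp g f)) (dcomp (dmap g) (dmap f))
| deq_map_add X Y (f g : chmap X Y) :
    deq (dmap (cadd f g)) (dadd (dmap f) (dmap g))
| deq_inv_map X Y (s : chmap X Y) (hs : qiso s) :
    deq (dcomp (dinv hs) (dmap s)) (did X)
| deq_map_inv X Y (s : chmap X Y) (hs : qiso s) :
    deq (dcomp (dmap s) (dinv hs)) (did Y).

Definition diso (X Y : cplx) : Prop :=
  exists (f : dmor X Y) (g : dmor Y X),
    deq (dcomp g f) (did X) /\ deq (dcomp f g) (did Y).

Definition retract (X Y : cplx) : Prop :=
  exists (i : dmor X Y) (r : dmor Y X), deq (dcomp r i) (did X).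

(** X, Y, Z are the vertices of a distinguished triangle X -> Y -> Z -> X[1],
    i.e. of a triangle isomorphic in D(U) to a mapping cone triangle. *)
Definition triangle (X Y Z : cplx) : Prop :=
  exists (X' Y' : cplx) (f : chmap X' Y'),
    [/\ diso X X', diso Y Y' & diso Z (cone f)].

Definition is_coprod (I : Type) (Y : I -> cplx) (S : cplx)
    (iota : forall i, dmor (Y i) S) : Prop :=
  forall (Z : cplx) (g : forall i, dmor (Y i) Z),
    exists h : dmor S Z,
      (forall i, deq (dcomp h (iota i)) (g i)) /\
      (forall h' : dmor S Z,
        (forall i, deq (dcomp h' (iota i)) (g i)) -> deq h' h).

Definition dsum (I : Type) (Y : I -> cplx) (S : cplx)
    (iota : forall i, dmor (Y i) S) (X : cplx)
    (J : seq I) (f : forall i, dmor X (Y i)) : dmor X S :=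
  foldr (fun i u => dadd (dcomp (iota i) (f i)) u) (dzero X S) J.

(** The canonical map from the direct sum of the Hom(X, Y_i) to
    Hom(X, coprod Y_i) is bijective, for every coproduct in D(U); an element of
    the direct sum is given by a finite list [J] of distinct indices and a
    component at each of them. *)
Definition compact (X : cplx) : Prop :=
  forall (I : eqType) (Y : I -> cplx) (S : cplx) (iota : forall i, dmor (Y i) S),
    is_coprod iota ->
    (forall h : dmor X S, exists (J : seq I) (f : forall i, dmor X (Y i)),
        uniq J /\ deq h (dsum iota J f)) /\
    (forall (J : seq I) (f : forall i, dmor X (Y i)),
        uniq J -> deq (dsum iota J f) (dzero X S) ->
        forall i, i \in J -> deq (f i) (dzero X (Y i))).

(** A full subcategory of D(U)^c is given by its set of objects.  A distinguished
    triangle may be rotated, so two-out-of-three is stated in all positions. *)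
Record thick (P : cplx -> Prop) : Prop := {
  thick_compact : forall X, P X -> compact X;
  thick_nonempty : exists X, P X;
  thick_shift : forall X, P X <-> P (shift X);
  thick_cone : forall X Y Z, triangle X Y Z -> P X -> P Y -> P Z;
  thick_fiber : forall X Y Z, triangle X Y Z -> P Y -> P Z -> P X;
  thick_mid : forall X Y Z, triangle X Y Z -> P X -> P Z -> P Y;
  thick_retract : forall X Y, retract X Y -> P Y -> P X }.

Record prime_ideal (P : cplx -> Prop) : Prop := {
  prime_thick : thick P;
  prime_tensor : forall X Y, P X -> compact Y -> P (tensor X Y);
  prime_proper : exists2 X, compact X & ~ P X;
  prime_prime : forall X Y, compact X -> compact Y ->
    P (tensor X Y) -> P X \/ P Y }.

Definition tt_prime := {P : cplx -> Prop | prime_ideal P}.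

Definition supp (X : cplx) (P : tt_prime) : Prop := ~ sval P X.

(** The supports of compact objects are stable under finite unions, so they are
    a basis of closed sets of the topology generated by their complements. *)
Definition Spc : space :=
  generated (fun A : tt_prime -> Prop =>
    exists2 X, compact X & A = (fun P => ~ supp X P)).

Definition pi0 := {c : Uob U -> Prop | exists G, c = Uiso G}.

Definition iso_class (G : Uob U) : pi0 := exist _ (Uiso G) (ex_intro _ G erefl).

Definition prime_at (G : Uob U) : cplx -> Prop :=
  fun X => compact X /\ acyclic_at G X.

End Derived.

(* Main.v *)
(* Let e_G be the complex represented by G, f_G its quotient (a retract, by averaging)
   by Out(G), and 1 the unit, represented by the trivial group.  Put
   X_G = cone(f_G -> 1) (+) E, where E is the sum of the e_H for |H| = p|G|; it is
   compact and X_G(G) = 0, so X_G lies in p_G.  Then p_G is the only prime containing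
   X_G: the complement of supp(X_G) is {p_G}, which is therefore open.

   Let P be a prime containing X_G.  If X is compact with X(G) = 0, then Z = f_G (x) X
   vanishes at all groups of order at most |G|, while E -> 1 is onto at the larger
   ones; hence Z -> cone(E -> 1) (x) Z is zero on cohomology.  Iterating, some power
   of this map vanishes as Z is compact, so Z is built from objects E (x) W and lies in
   P, and so does X because cone(f_G -> 1) (x) X does.  Conversely, let Y lie in P with
   Y(G) nonzero, and let c be the constant complex at Y(G).  There is a map
   e_G (x) c -> e_G (x) Y that is invertible at G, so e_G (x) c lies in P, hence so does
   e_G or c.  Both have consequences that are absurd: f_G is a retract of e_G, and a
   shift of 1 is a retract of c, so 1 would lie in P. *)

(* Morphisms of D(U) are formal words, so nothing shows at once that two of them differ. Words out
   of a K-projective complex are therefore made to act on homotopy classes of chain maps; this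
   computes Hom and underlies every exactness and compactness argument.

   Compactness is a condition on coproducts and says nothing about tensor products. It is identified
   with being perfect, that is, built from finitely many representables by cones, fibres and
   retracts; perfection passes to X (x) Y and to the constant complex at X(G). Both facts, like the
   splitting of f_G off e_G, divide by orders of finite groups: here characteristic zero enters.

   The cone uses f_G because e_G(G) is spanned by Out(G), while f_G(G) is a line, as 1(G) is. The
   order p|G| is chosen because a p-group larger than G has a quotient of exactly that order, while
   no group of order at most |G| maps onto one.

   The complex c replaces Y, of which little is known away from G, by an object that splits off a
   shift of 1; a prime ideal contains no such shift. *)
From HB Require Import structures.
Require Import Defs.
From mathcomp Require Import all_boot all_order all_algebra all_fingroup.
From mathcomp Require Import all_solvable.
From mathcomp Require Import boolp.
From mathcomp Require classical_sets.
From Corelib Require Import Setoid Morphisms.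
Import Defs.

Set Implicit Arguments.
Unset Strict Implicit.
Unset Printing Implicit Defensive.

Import GRing.Theory.

Local Open Scope ring_scope.

(* Equalities of additive groups by reflection: the carrier is only a [zmodType],
   where [ring] does not apply.  [zfrom h] solves a goal that follows from the
   equation [h] by adding the same terms to both sides. *)
Inductive zexp := ZVar of nat | ZZero | ZAdd of zexp & zexp | ZOpp of zexp.

Fixpoint zeval (V : zmodType) (l : seq V) (e : zexp) : V :=
  match e with
  | ZVar n => l`_n
  | ZZero => 0
  | ZAdd a b => zeval l a + zeval l b
  | ZOpp a => - zeval l a
  end.

Fixpoint zcoef (e : zexp) (i : nat) : int :=
  match e with
  | ZVar n => if i == n then 1 else 0
  | ZZero => 0
  | ZAdd a b => zcoef a i + zcoef b i
  | ZOpp a => - zcoef a i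
  end.

Fixpoint zbound (e : zexp) : nat :=
  match e with
  | ZVar n => n.+1
  | ZZero => 0
  | ZAdd a b => maxn (zbound a) (zbound b)
  | ZOpp a => zbound a
  end.

Lemma zevalE (V : zmodType) (l : seq V) (e : zexp) (n : nat) : (zbound e <= n)%N ->
  zeval l e = \sum_(i < n) l`_i *~ zcoef e i.
Proof.
elim: e => [m|_|a IHa b IHb|a IHa] /=.
- move=> lt_mn; rewrite (bigD1 (Ordinal lt_mn)) //= eqxx big1 ?addr0 // => i ne_i.
  by rewrite ifN //; apply: contraNneq ne_i => e; apply/eqP/val_inj.
- by rewrite big1 // => i _; rewrite mulr0z.
- rewrite geq_max => /andP[/IHa -> /IHb ->]; rewrite -big_split /=.
  by apply: eq_bigr => i _; rewrite mulrzDr.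
- by move/IHa->; rewrite -sumrN; apply: eq_bigr => i _; rewrite mulrNz.
Qed.

Definition zcheck (a b : zexp) : bool :=
  all (fun i => zcoef a i == zcoef b i) (iota 0 (maxn (zbound a) (zbound b))).

Lemma zcheckP (V : zmodType) (l : seq V) (a b : zexp) : zcheck a b -> zeval l a = zeval l b.
Proof.
move=> /allP h; rewrite (zevalE l (leq_maxl _ (zbound b))).
rewrite (zevalE l (leq_maxr (zbound a) _)); apply: eq_bigr => i _; congr (_ *~ _).
by apply/eqP/h; rewrite mem_iota add0n ltn_ord.
Qed.

(** Atoms are compared by unification, as convertible terms often occur in different forms. *)
Ltac zmember x l :=
  lazymatch l with
  | nil => constr:(false)
  | ?y :: ?r => match constr:(tt) with
     | _ => let _ := match goal with _ => unify x y end in constr:(true)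
     | _ => zmember x r end
  end.
Ltac zindex x l :=
  lazymatch l with
  | ?y :: ?r => match constr:(tt) with
     | _ => let _ := match goal with _ => unify x y end in constr:(0%N)
     | _ => let n := zindex x r in constr:(S n) end
  end.
Ltac zatoms t l :=
  lazymatch t with
  | (?a + ?b)%R => let l1 := zatoms a l in zatoms b l1
  | (- ?a)%R => zatoms a l
  | 0%R => l
  | _ => let b := zmember t l in
     lazymatch b with true => l | false => constr:(t :: l) end
  end.
Ltac zreify t l :=
  lazymatch t with
  | (?a + ?b)%R => let a1 := zreify a l in let b1 := zreify b l in constr:(ZAdd a1 b1)
  | (- ?a)%R => let a1 := zreify a l in constr:(ZOpp a1)
  | 0%R => constr:(ZZero)
  | _ => let n := zindex t l in constr:(ZVar n)
  end.
Ltac zmod :=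
  lazymatch goal with
  | |- @eq ?T ?a ?b =>
    let l0 := zatoms a (@nil T) in let l := zatoms b l0 in
    let ea := zreify a l in let eb := zreify b l in
    refine (@zcheckP _ l ea eb _); vm_compute; reflexivity
  end.
Lemma zmod_from (V : zmodType) (a b c d : V) : c = d -> a - b = c - d -> a = b.
Proof. by move=> ->; rewrite subrr => /subr0_eq. Qed.

Ltac zfrom h :=
  first [apply: (zmod_from h); zmod | apply: (zmod_from (esym h)); zmod].

Lemma dep_choice (T : Type) (A : T -> Type) (R : forall t, A t -> Prop) :
  (forall t, exists a, R t a) -> exists f : forall t, A t, forall t, R t (f t).
Proof.
move=> h; exists (fun t => projT1 (boolp.cid (h t))) => t.
exact: projT2 (boolp.cid (h t)).
Qed.

(** * Complexes, homotopies and cones *)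

(** Cohomology and homotopies are indexed by degrees of the form [n + 1]; with this a statement in
    an arbitrary degree takes that form without any transport. *)
Lemma int_succ_ind (P : int -> Prop) : (forall n, P (n + 1)) -> forall n, P n.
Proof. by move=> h n; rewrite -[n](subrK 1). Qed.

Section Complexes.
Variables (k : fieldType) (U : finGroupType -> Prop).
Implicit Types (X Y Z W : cplx k U) (G H K : Uob U) (V : rep k U).

(** Degrees such as [n - 1 + 1] and [n] are equal but not convertible, so elements are transported
    between them; the lemmas below collapse transports and commute them with differentials and chain
    maps. *)
Definition rcast (F : int -> rep k U) (a b : int) (e : a = b) : rhom (F a) (F b) :=
  match e in _ = c return rhom (F a) (F c) with erefl => rid (F a) end.

Definition ccast X (a b : int) (e : a = b) : rhom (X a) (X b) := rcast X e.

Lemma rcast_id (F : int -> rep k U) a (e : a = a) G x : rcast F e G x = x.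
Proof. by rewrite (eq_axiomK e). Qed.

Lemma rcast_trans (F : int -> rep k U) a b c (e : a = b) (e' : b = c) (e'' : a = c) G x :
  rcast F e' G (rcast F e G x) = rcast F e'' G x.
Proof. by destruct e, e'; rewrite !rcast_id. Qed.

Lemma rcastK (F : int -> rep k U) a b (e : a = b) (e' : b = a) G x :
  rcast F e' G (rcast F e G x) = x.
Proof. by rewrite (rcast_trans _ _ erefl). Qed.

Lemma ccast_trans X a b c (e : a = b) (e' : b = c) (e'' : a = c) G x :
  ccast X e' G (ccast X e G x) = ccast X e'' G x.
Proof. exact: rcast_trans. Qed.

Lemma ccastK X a b (e : a = b) (e' : b = a) G x : ccast X e' G (ccast X e G x) = x.
Proof. exact: rcastK. Qed.

Lemma ccast_id X a (e : a = a) G x : ccast X e G x = x.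
Proof. exact: rcast_id. Qed.

Lemma ccast_d X a b (e : a = b) (e' : a + 1 = b + 1) G x :
  cd X b G (ccast X e G x) = ccast X e' G (cd X a G x).
Proof. by destruct e; rewrite /ccast !rcast_id. Qed.

Lemma ccast_map X Y (f : chmap X Y) a b (e : a = b) G x :
  f b G (ccast X e G x) = ccast Y e G (f a G x).
Proof. by destruct e. Qed.

Lemma rhom0 (V W : rep k U) (f : rhom V W) G : f G 0 = 0. Proof. exact: linear0. Qed.

Lemma cneg_comm X Y (f : chmap X Y) n G x :
  - f (n + 1) G (cd X n G x) = cd Y n G (- f n G x).
Proof. by rewrite ccomm linearN. Qed.

Definition cneg X Y (f : chmap X Y) : chmap X Y :=
  @ChMap k U X Y (fun n => rneg (f n)) (cneg_comm f).

Definition csub X Y (f g : chmap X Y) := cadd f (cneg g).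

Definition ceq X Y (f g : chmap X Y) := forall n G x, f n G x = g n G x.

Definition nullvia X Y (f : chmap X Y) (h : forall n, rhom (X (n + 1)) (Y n)) :=
  forall n G x, f (n + 1) G x = cd Y n G (h n G x) + h (n + 1) G (cd X (n + 1) G x).

Definition nullh X Y (f : chmap X Y) := exists h, nullvia f h.

Definition htp X Y (f g : chmap X Y) := nullh (csub f g).

Lemma nullh_ext X Y (f g : chmap X Y) : ceq f g -> nullh f -> nullh g.
Proof. by move=> e [h hh]; exists h => n G x; rewrite -e hh. Qed.

Lemma nullh_zero X Y (f : chmap X Y) : (forall n G x, f n G x = 0) -> nullh f.
Proof. by move=> h; exists (fun n => rzero _ _) => n G x; rewrite h /= linear0 addr0. Qed.

Lemma nullh_add X Y (f g : chmap X Y) : nullh f -> nullh g -> nullh (cadd f g).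
Proof.
move=> [h hh] [h' hh']; exists (fun n => radd (h n) (h' n)) => n G x /=.
by rewrite hh hh' linearD addrACA.
Qed.

Lemma nullh_neg X Y (f : chmap X Y) : nullh f -> nullh (cneg f).
Proof.
move=> [h hh]; exists (fun n => rneg (h n)) => n G x /=.
by rewrite hh linearN opprD.
Qed.

Lemma nullh_compl X Y Z (g : chmap Y Z) (f : chmap X Y) : nullh f -> nullh (ccomp g f).
Proof.
move=> [h hh]; exists (fun n => rcomp (g n) (h n)) => n G x /=.
by rewrite hh linearD ccomm.
Qed.

Lemma htp_ceq X Y (f g : chmap X Y) : ceq f g -> htp f g.
Proof. by move=> e; apply: nullh_zero => n G x /=; rewrite e subrr. Qed.

Lemma htp_refl X Y (f : chmap X Y) : htp f f. Proof. exact: htp_ceq. Qed.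

Lemma htp_sym X Y (f g : chmap X Y) : htp f g -> htp g f.
Proof.
move=> /nullh_neg; apply: nullh_ext => n G x /=; zmod.
Qed.

Lemma htp_trans X Y (f g h : chmap X Y) : htp f g -> htp g h -> htp f h.
Proof.
move=> a b; apply: nullh_ext (nullh_add a b) => n G x /=; zmod.
Qed.

Lemma htp_add X Y (f g f' g' : chmap X Y) :
  htp f f' -> htp g g' -> htp (cadd f g) (cadd f' g').
Proof.
move=> a b; apply: nullh_ext (nullh_add a b) => n G x /=; zmod.
Qed.

Lemma htp_compl X Y Z (g : chmap Y Z) (f f' : chmap X Y) :
  htp f f' -> htp (ccomp g f) (ccomp g f').
Proof.
move=> /(nullh_compl g); apply: nullh_ext => n G x /=.
by rewrite linearD linearN.
Qed.

Lemma htp_zero X Y (f : chmap X Y) : htp f (czero X Y) <-> nullh f.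
Proof.
split; apply: nullh_ext => n G x /=; first by rewrite subr0.
by rewrite subr0.
Qed.

Definition acyclic X := forall G, acyclic_at G X.

Definition mkrhom V V' (f : forall G, V G -> V' G) (lin : forall G, linear (f G))
    (nat : forall G H (u : {multiplicative G -> H}) (hu : surjective u) x,
      f G (res V hu x) = res V' hu (f H x)) : rhom V V' :=
  @RHom k U V V' (fun G => mklin (lin G)) nat.

Section ConeMaps.
Variables (X Y : cplx k U) (f : chmap X Y).

Lemma cinj_lin n G : linear (fun y : Y n G => (0, y) : cone f n G).
Proof. by move=> a x y; congr pair; rewrite /= ?scaler0 ?addr0. Qed.

Lemma cinj_nat n G H (u : {multiplicative G -> H}) (hu : surjective u) x :
  (0, res (Y n) hu x) = res (cone f n) hu (0, x).
Proof. by congr pair; rewrite /= ?linear0. Qed.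

Lemma cinj_comm n G (y : Y n G) : (0, cd Y n G y) = cd (cone f) n G (0, y).
Proof. by congr pair; rewrite /= ?linear0 ?oppr0 ?add0r. Qed.

Definition cinj : chmap Y (cone f) :=
  @ChMap k U Y (cone f) (fun n => mkrhom (@cinj_lin n) (@cinj_nat n)) cinj_comm.

Lemma cproj_lin n G : linear (fun y : cone f n G => y.1 : shift X n G).
Proof. by []. Qed.

Definition cproj : chmap (cone f) (shift X) :=
  @ChMap k U (cone f) (shift X)
    (fun n => @mkrhom (cone f n) (shift X n) _ (@cproj_lin n) (fun _ _ _ _ _ => erefl)) (fun _ _ _ => erefl).

End ConeMaps.

Lemma cone_dE X Y (f : chmap X Y) n G (x : X (n + 1) G) (y : Y n G) :
  cd (cone f) n G (x, y) = (- cd X (n + 1) G x, f (n + 1) G x + cd Y n G y).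
Proof. by []. Qed.

Lemma cone_cocycle X Y (f : chmap X Y) n G (x : X (n + 1) G) (y : Y n G) :
  cd (cone f) n G (x, y) = 0 -> cd X (n + 1) G x = 0 /\ f (n + 1) G x + cd Y n G y = 0.
Proof.
rewrite cone_dE => e; have e1 := congr1 fst e; have e2 := congr1 snd e; split; last exact: e2.
by rewrite -[LHS]opprK [X in - X]e1 oppr0.
Qed.

Section ConeExt.
Variables (X Y W : cplx k U) (f : chmap X Y) (u : chmap Y W).
Variables (h : forall n, rhom (X (n + 1)) (W n)).
Hypothesis hh : nullvia (ccomp u f) h.
Let fn n G (z : X (n + 1) G * Y n G) : W n G := h n G z.1 + u n G z.2.
Lemma cone_ext_lin n G : linear (@fn n G).
Proof. by move=> a x y; rewrite /fn /= !linearP scalerDr; zmod. Qed.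
Lemma cone_ext_nat n G H (v : {multiplicative G -> H}) (hv : surjective v) (x : cone f n H) :
  mklin (@cone_ext_lin n G) (res (cone f n) hv x) = res (W n) hv (mklin (@cone_ext_lin n H) x).
Proof. by rewrite /= /lin_fun /fn /= linearD !rnat. Qed.
Lemma cone_ext_comm n G (x : cone f n G) :
  mklin (@cone_ext_lin (n + 1) G) (cd (cone f) n G x) = cd W n G (mklin (@cone_ext_lin n G) x).
Proof.
rewrite /= /lin_fun /fn /= linearD linearN linearD -!ccomm.
have := hh x.1 => /= ->; zmod.
Qed.
Definition cone_ext : chmap (cone f) W :=
  @ChMap k U (cone f) W (fun n => @RHom k U (cone f n) (W n) (fun G => mklin (@cone_ext_lin n G)) (@cone_ext_nat n))
    cone_ext_comm.
Lemma cone_extE n G x y : cone_ext n G (x, y) = h n G x + u n G y. Proof. by []. Qed.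
End ConeExt.

Lemma cone_acyclic_qiso X Y (f : chmap X Y) : acyclic (cone f) -> qiso f.
Proof.
move=> ac; suff key n G : (forall z : X (n + 1) G, cd X (n + 1) G z = 0 ->
     bdry (f (n + 1) G z) -> bdry z) /\
  (forall y : Y (n + 1) G, cd Y (n + 1) G y = 0 ->
     exists2 x : X (n + 1) G, cd X (n + 1) G x = 0 & bdry (y - f (n + 1) G x)) by [].
split=> [z hz [w hw]|y hy].
  move: n z hz w hw; apply: int_succ_ind => n z hz w hw.
  have [|[p q] e] := ac G n ((z, - w) : cone f (n + 1) G).
    by rewrite cone_dE hz linearN hw oppr0 subrr.
  by exists (- p); rewrite linearN; case: e.
have [|[p q] e] := ac G n ((0, y) : cone f (n + 1) G).
  by rewrite cone_dE !linear0 hy addr0.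
rewrite cone_dE in e; case: e => e1 e2.
exists p; first by rewrite -[LHS]opprK e1 oppr0.
by exists q; rewrite -e2; zmod.
Qed.

(** Stated for one group and one degree, since some cones below are needed acyclic at a single
    group, the map being no quasi-isomorphism elsewhere. *)
Lemma cone_acyclic_at X Y (f : chmap X Y) G n :
  (forall z : X (n + 1 + 1) G, cd X (n + 1 + 1) G z = 0 ->
     bdry (f (n + 1 + 1) G z) -> bdry z) ->
  (forall y : Y (n + 1) G, cd Y (n + 1) G y = 0 ->
     exists2 x : X (n + 1) G, cd X (n + 1) G x = 0 & bdry (y - f (n + 1) G x)) ->
  forall z : cone f (n + 1) G, cd (cone f) (n + 1) G z = 0 -> bdry z.
Proof.
move=> inj srj [x y]; rewrite cone_dE => -[e1 e2].
have hx : cd X (n + 1 + 1) G x = 0 by rewrite -[LHS]opprK e1 oppr0.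
have [|w hw] := inj x hx; first by exists (- y); rewrite linearN; zfrom e2.
have [|x0 hx0 [v hv]] := srj (f (n + 1) G w + y).
  by rewrite linearD -ccomm hw.
exists (x0 - w, v); rewrite cone_dE -[RHS]/(x, y); congr pair.
  by rewrite linearB hx0 hw; zmod.
by rewrite hv linearB; zmod.
Qed.

Lemma qiso_cone_acyclic X Y (f : chmap X Y) : qiso f -> acyclic (cone f).
Proof.
move=> qf G n; apply: cone_acyclic_at; first by have [] := qf (n + 1) G.
by have [] := qf n G.
Qed.

Lemma bij_qiso X Y (f : chmap X Y) :
  (forall n G x, f n G x = 0 -> x = 0) -> (forall n G y, exists x, f n G x = y) -> qiso f.
Proof.
move=> inj srj n G; split=> [z hz [w hw]|y hy].
  have [x hx] := srj n G w; exists x; apply/subr0_eq/inj.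
  by rewrite linearB ccomm hx hw subrr.
have [x hx] := srj _ G y; exists x; last by exists 0; rewrite linear0 hx subrr.
by apply: inj; rewrite ccomm hx hy.
Qed.

Lemma can_qiso X Y (f : chmap X Y) (g : chmap Y X) :
  (forall n G x, g n G (f n G x) = x) -> (forall n G x, f n G (g n G x) = x) -> qiso f.
Proof.
move=> gf fg; apply: bij_qiso => [n G x e|n G y]; last by exists (g n G y).
by rewrite -(gf n G x) e linear0.
Qed.

Lemma qiso_comp X Y Z (g : chmap Y Z) (f : chmap X Y) : qiso f -> qiso g -> qiso (ccomp g f).
Proof.
move=> qf qg n G; have [fi fs] := qf n G; have [gi gs] := qg n G.
split=> [z hz /gi|y /gs[x hx [w hw]]].
  by rewrite -ccomm hz linear0 => /(_ erefl) /fi; apply.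
have [x' hx' [w' hw']] := fs x hx; exists x' => //.
exists (w + g n G w'); rewrite linearD hw -ccomm hw' /= linearB; zmod.
Qed.

Lemma qiso_ceq X Y (f g : chmap X Y) : ceq f g -> qiso f -> qiso g.
Proof.
move=> e qf n G; have [fi fs] := qf n G; split=> [z hz|y /fs[x hx]].
  by rewrite -e; apply: fi.
by rewrite e => b; exists x.
Qed.

Lemma acyclic_qiso X Y (f : chmap X Y) : acyclic X -> acyclic Y -> qiso f.
Proof.
move=> aX aY n G; split=> [z hz _|y hy]; first exact: aX.
exists 0; first exact: linear0.
by rewrite rhom0 subr0; exact: aY.
Qed.

Lemma cone_id_acyclic X : acyclic (cone (cid X)).
Proof.
apply: qiso_cone_acyclic; apply: (can_qiso (g := cid X)) => //.
Qed.

(** Rotation of the triangle of [f]: forgetting both copies of [Y] identifies the cone of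
    [Y -> cone f] with the shift of [X]. *)
Definition cconep X Y (f : chmap X Y) : chmap (cone (cinj f)) (shift X) :=
  @cone_ext Y (cone f) (shift X) (cinj f) (cproj f) (fun n => rzero (Y (n + 1)) (shift X n))
    (fun n G x => esym (etrans (addr0 _) (linear0 (cd (shift X) n G)))).

Lemma cconep_qiso X Y (f : chmap X Y) : qiso (cconep f).
Proof.
move=> n G; split=> [[y [x y']]|x hx].
  rewrite cone_dE cone_dE => -[e1 e2 e3] [w hw].
  have {e1} e1 : cd Y (n + 1 + 1) G y = 0 by rewrite -[LHS]opprK e1 oppr0.
  have {}hw : - cd X (n + 1) G w = x by rewrite [LHS]hw [LHS]add0r.
  exists (y' - f (n + 1) G w, (w, 0)); rewrite !cone_dE /= linear0 addr0.
  rewrite -[RHS]/(_, (_, _)); congr (_, (_, _)).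
    by move: e3; rewrite -hw linearN linearB -ccomm => e3; zfrom e3.
    by rewrite [LHS]add0r.
  by rewrite /= /lin_fun /=; zmod.
have {}hx : cd X (n + 1 + 1) G x = 0 by rewrite -[LHS]opprK [X in - X]hx oppr0.
exists (- f (n + 1 + 1) G x, (x, 0)).
  rewrite !cone_dE linear0 addr0; congr (_, (_, _)) => /=.
  - by rewrite linearN opprK -ccomm hx linear0.
  - by rewrite hx oppr0 [LHS]addr0.
  - by rewrite addNr.
by exists 0; rewrite linear0 /= /lin_fun /= add0r subrr.
Qed.

End Complexes.

(** * The inverse shift and its adjunction *)

Section Shifts.
Variables (k : fieldType) (U : finGroupType -> Prop).
Implicit Types (X Y Z : cplx k U) (G H K : Uob U).

Lemma predK n : n - 1 + 1 = n + 1 - 1 :> int. Proof. by rewrite addrAC. Qed.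

Definition unshift_d X n : rhom (X (n - 1)) (X (n + 1 - 1)) :=
  rneg (rcomp (ccast X (predK n)) (cd X (n - 1))).

Lemma unshift_dd X n G x : unshift_d X (n + 1) G (unshift_d X n G x) = 0.
Proof.
rewrite /= !linearN opprK.
have e' : n - 1 + 1 + 1 = n + 1 - 1 + 1 by rewrite predK.
by rewrite (ccast_d (predK n) e') cdd !rhom0.
Qed.

Definition unshift X : cplx k U := @Cplx k U (fun n => X (n - 1)) (@unshift_d X) (@unshift_dd X).

Definition shiftm X Y (f : chmap X Y) : chmap (shift X) (shift Y).
Proof.
by exists (fun n => f (n + 1)) => n G x; rewrite /= -ccomm linearN.
Defined.

Definition unshiftm X Y (f : chmap X Y) : chmap (unshift X) (unshift Y).
Proof.
by exists (fun n => f (n - 1)) => n G x; rewrite /= -ccomm linearN ccast_map.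
Defined.

Lemma ccast_shift X a b (e : a = b) (e' : a + 1 = b + 1) G x :
  ccast (shift X) e G x = ccast X e' G x.
Proof. by destruct e; rewrite /ccast !rcast_id. Qed.

Lemma predS n : n = n - 1 + 1 :> int. Proof. by rewrite subrK. Qed.
Lemma Spred n : n + 1 - 1 = n :> int. Proof. by rewrite addrK. Qed.

Section Adjoint.
Variables (X A : cplx k U) (w : chmap (shift X) A).

Definition adj_map n : rhom (X n) (A (n - 1)) := rcomp (w (n - 1)) (ccast X (predS n)).

Lemma adj_comm n G x : adj_map (n + 1) G (cd X n G x) = cd (unshift A) n G (adj_map n G x).
Proof.
rewrite /= -(ccomm w) /= !linearN opprK -(ccast_map w).
have e' : n - 1 + 1 + 1 = n + 1 - 1 + 1 by rewrite predK.
rewrite (ccast_shift _ e') (ccast_d (predS n) (congr1 (+%R^~ 1) (predS n))).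
by rewrite (ccast_trans _ _ (predS (n + 1))).
Qed.

Definition adj : chmap X (unshift A) := @ChMap k U X (unshift A) adj_map adj_comm.

(** Homotopies transpose back through the adjunction, with a sign because the shift negates
    differentials; this makes shifts of K-projective complexes K-projective. *)
Lemma nullh_adj : nullh adj -> nullh w.
Proof.
move=> [h hh]; exists (fun n => rneg (rcomp (ccast A (Spred n)) (h (n + 1)))) => n G x.
have := hh (n + 1) G x => /=.
have -> : ccast X (predS (n + 1 + 1)) G x = ccast (shift X) (esym (Spred (n + 1))) G x.
  by rewrite (ccast_shift _ (predS (n + 1 + 1))).
rewrite (ccast_map w) => /(congr1 (ccast A (Spred (n + 1)) G)).
rewrite ccastK => ->.
rewrite !linearD !linearN /= opprK; congr (- _ + _).
rewrite (ccast_trans _ _ (congr1 (+%R^~ 1) (Spred n))).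
by rewrite -(ccast_d (Spred n)).
Qed.
End Adjoint.

Lemma unshift_acyclic A : acyclic A -> acyclic (unshift A).
Proof.
move=> aA G; apply: int_succ_ind => n z hz.
have e : n + 1 + 1 - 1 = n + 1 by rewrite addrK.
have e0 : n + 1 = n + 1 - 1 + 1 by rewrite subrK.
have [|w hw] := aA G n (ccast A e G z).
  rewrite (ccast_d e (congr1 (+%R^~ 1) e)).
  have : cd (unshift A) _ G z = 0 by [].
  move=> /(congr1 -%R) /=; rewrite opprK oppr0 => /(congr1 (ccast A (esym (predK _)) G)).
  by rewrite ccastK => ->; rewrite !rhom0.
exists (ccast A (esym (Spred n)) G (- w)) => /=.
rewrite (ccast_d (esym (Spred n)) (congr1 (+%R^~ 1) (esym (Spred n)))) !linearN opprK.
rewrite hw. 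
rewrite (ccast_trans _ _ (esym e)).
rewrite (ccast_trans _ _ erefl).
by rewrite ccast_id.
Qed.

End Shifts.

(** * Surjections of groups up to conjugation *)

Definition mkmult (G H : finGroupType) (f : G -> H) (hf : {morph f : x y / (x * y)%g}) :
    {multiplicative G -> H} :=
  @Multiplicative.Pack G H f (Multiplicative.Class (isMultiplicative.Axioms_ H f hf)).

Lemma surjective_comp (A B C : Type) (f : A -> B) (g : B -> C) :
  surjective f -> surjective g -> surjective (g \o f).
Proof. by move=> hf hg z; have [y <-] := hg z; have [x <-] := hf y; exists x. Qed.

Lemma fin_gmulfJ (G H : finGroupType) (f : {multiplicative G -> H}) (x y : G) :
  f (x ^ y)%g = (f x ^ f y)%g.
Proof.
have f1 : f 1%g = 1%g by apply: (mulgI (f 1%g)); rewrite -gmulfM !mulg1.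
have fV : f y^-1%g = (f y)^-1%g by apply: (mulgI (f y)); rewrite -gmulfM !mulgV.
by rewrite /conjg !gmulfM fV.
Qed.

Section Surjections.
Variable U : finGroupType -> Prop.
Implicit Types G H K : Uob U.

Record surj K G := Surj { sfun :> {multiplicative K -> G}; surjP : surjective sfun }.

Lemma surj_id_subproof G : surjective (idfun : G -> G).
Proof. by move=> y; exists y. Qed.

Definition sid G : surj G G := @Surj G G idfun (@surj_id_subproof G).

Definition scomp K H G (f : surj H G) (u : surj K H) : surj K G :=
  @Surj K G (sfun f \o sfun u) (surjective_comp (surjP u) (surjP f)).

Lemma surj_eq K G (f g : surj K G) : f =1 g -> f = g.
Proof.
case: f g => [[f [[cf]]] hf] [[g [[cg]]] hg] /= /funext e.
by destruct e; rewrite (Prop_irrelevance cf cg) (Prop_irrelevance hf hg).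
Qed.

Variable k : fieldType.
Implicit Type V : rep k U.

Definition sres V K G (f : surj K G) : {linear V G -> V K} := res V (surjP f).

Lemma sres_comp V K H G (f : surj H G) (u : surj K H) x :
  sres V (scomp f u) x = sres V u (sres V f x).
Proof. exact: res_comp. Qed.

Lemma sres_id V G x : sres V (sid G) x = x.
Proof. exact: res_id. Qed.

Lemma sres_nat V W (a : rhom V W) K G (f : surj K G) x :
  a K (sres V f x) = sres W f (a G x).
Proof. exact: rnat. Qed.

(* [f] and [g] differ by an inner automorphism, or by any automorphism if [s] *)
Definition stwist (s : bool) K G (f g : surj K G) : Prop :=
  (exists h : G, forall x, g x = (f x ^ h)%g) \/
  (s /\ exists a : {multiplicative G -> G}, forall x, g x = a (f x)).

Lemma stwist_comp s K H G (f g : surj H G) (u : surj K H) :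
  stwist s f g -> stwist s (scomp f u) (scomp g u).
Proof.
move=> [[h e]|[hs [a e]]]; first by left; exists h => x; exact: e.
by right; split=> //; exists a => x; exact: e.
Qed.

Lemma stwist_compr s K H G (f : surj H G) (u v : surj K H) :
  (exists h : H, forall x, v x = (u x ^ h)%g) -> stwist s (scomp f u) (scomp f v).
Proof. by move=> [h e]; left; exists (f h) => x; rewrite /= e fin_gmulfJ. Qed.

Lemma sres_inner V K G (f g : surj K G) x : stwist false f g -> sres V f x = sres V g x.
Proof. by move=> [e|[]//]; apply: res_conj. Qed.

End Surjections.

(** * Free complexes: sums of shifted representables *)

Section Free.
Variables (k : fieldType) (U : finGroupType -> Prop).
Implicit Types (X Y : cplx k U) (G H K : Uob U) (V W : rep k U).
Variables (I : Type) (deg : I -> int) (grp : I -> Uob U) (sym : I -> bool).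

(** Generators of the sum of the representables of the groups [grp i], each placed in degree
    [deg i]. The relations [fcompat] pass to conjugacy classes of surjections, or to orbits under
    all automorphisms where [sym i] holds. The degree is an equation, so that one family serves all
    [n]. *)
Record fgen_ n K := FGen { fidx : I; fdeg : deg fidx = n; fsurj : surj K (grp fidx) }.
Definition fgen n K := {classic fgen_ n K}.

Definition fcompat n K (M : lmodType k) (phi : fgen n K -> M) : Prop :=
  forall i (e : deg i = n) (f g : surj K (grp i)), stwist (sym i) f g ->
    phi (FGen e f) = phi (FGen e g).

Definition fmod n K : lmodType k := pres (@fcompat n K).

Definition fg n K i (e : deg i = n) (f : surj K (grp i)) : fmod n K := gen (@fcompat n K) (FGen e f).

Lemma fg_twist n K i (e : deg i = n) (f g : surj K (grp i)) :
  stwist (sym i) f g -> fg e f = fg e g.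
Proof.
move=> h; apply: pres_ext => M phi hphi; rewrite /fg !peval_gen //; exact: hphi.
Qed.

Definition fres_gen n K H (u : surj K H) (a : fgen n H) : fmod n K :=
  fg (fdeg a) (scomp (fsurj a) u).

Lemma fres_compat n K H (u : surj K H) : fcompat (@fres_gen n K H u).
Proof. by move=> i e f g h; apply: fg_twist; apply: stwist_comp. Qed.

Definition fres n K H (u : surj K H) : {linear fmod n H -> fmod n K} := plift (@fres_compat n K H u).

Lemma fres_fg n K H (u : surj K H) i (e : deg i = n) f : fres n u (fg e f) = fg e (scomp f u).
Proof. exact: plift_gen. Qed.

Lemma fres_conj n K H (f g : {multiplicative K -> H}) (hf : surjective f) (hg : surjective g) :
  (exists h : H, forall x, g x = (f x ^ h)%g) -> fres n (Surj hf) =1 fres n (Surj hg).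
Proof.
move=> e; apply: plin_ext => -[i d s]; rewrite [LHS]fres_fg [RHS]fres_fg.
by apply: fg_twist; apply: stwist_compr.
Qed.

Lemma fres_id n K (f : {multiplicative K -> K}) (hf : surjective f) :
  f =1 id -> fres n (Surj hf) =1 id.
Proof.
move=> e; apply: (plin_ext (g := idfun)) => -[i d s]; rewrite [LHS]fres_fg.
by congr (fg d _); apply: surj_eq => x /=; rewrite e.
Qed.

Lemma fres_comp n G H K (f : {multiplicative G -> H})
    (g : {multiplicative H -> K}) (h : {multiplicative G -> K})
    (hf : surjective f) (hg : surjective g) (hh : surjective h) :
  h =1 g \o f -> fres n (Surj hh) =1 fres n (Surj hf) \o fres n (Surj hg).
Proof.
move=> e; apply: (plin_ext (g := fres n (Surj hf) \o fres n (Surj hg))) => -[i d s].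
rewrite [LHS]fres_fg /= [fres n (Surj hg) _]fres_fg fres_fg.
by congr (fg d _); apply: surj_eq => x /=; rewrite e.
Qed.

Definition frep n : rep k U :=
  @Rep k U (fmod n) (fun K H f hf => fres n (Surj hf)) (@fres_conj n) (@fres_id n) (@fres_comp n).

Lemma frep_sres n K H (u : surj K H) i (e : deg i = n) f :
  sres (frep n) u (fg e f) = fg e (scomp f u).
Proof. by case: u => u hu; exact: fres_fg. Qed.

Lemma fg_sres n K i (e : deg i = n) (f : surj K (grp i)) :
  fg e f = sres (frep n) f (fg e (sid (grp i))).
Proof. by rewrite frep_sres; congr (fg e _); apply: surj_eq. Qed.

(** Yoneda: every generator is a restriction of the universal one at its own group ([fg_sres]), and
    natural maps commute with restriction. *)
Lemma frep_ext n V (a b : rhom (frep n) V) :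
  (forall i (e : deg i = n), a (grp i) (fg e (sid (grp i))) = b (grp i) (fg e (sid (grp i)))) ->
  forall K x, a K x = b K x.
Proof.
move=> h K; apply: plin_ext => -[i e f].
by rewrite -[gen _ _]/(fg e f) fg_sres !sres_nat h.
Qed.

Section Lift.
Variables (n : int) (V : rep k U) (w : forall i, deg i = n -> V (grp i)).
Hypothesis inv : forall i (e : deg i = n) K (f g : surj K (grp i)),
  stwist (sym i) f g -> sres V f (w e) = sres V g (w e).

Definition flift_gen K (a : fgen n K) : V K := sres V (fsurj a) (w (fdeg a)).

Lemma flift_compat K : fcompat (@flift_gen K).
Proof. by move=> i e f g; apply: inv. Qed.

Lemma flift_nat K H (u : {multiplicative K -> H}) (hu : surjective u) x :
  plift (@flift_compat K) (res (frep n) hu x) = res V hu (plift (@flift_compat H) x).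
Proof.
move: x; apply: (plin_ext (f := plift (@flift_compat K) \o res (frep n) hu)
  (g := res V hu \o plift (@flift_compat H))) => -[i e f] /=.
rewrite -[gen _ _]/(fg e f) [fres _ _ _]fres_fg [LHS]plift_gen [in RHS]plift_gen.
exact: sres_comp.
Qed.

Definition flift : rhom (frep n) V := @RHom k U (frep n) V (fun K => plift (@flift_compat K)) flift_nat.

Lemma fliftE K i (e : deg i = n) (f : surj K (grp i)) : flift K (fg e f) = sres V f (w e).
Proof. exact: plift_gen. Qed.
End Lift.

Definition ffree : cplx k U := @Cplx k U frep (fun n => rzero (frep n) (frep (n + 1))) (fun _ _ _ => erefl).

Section Chain.
Variables (Y : cplx k U) (z : forall i, Y (deg i) (grp i)).
Hypothesis inv : forall i K (f g : surj K (grp i)),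
  stwist (sym i) f g -> sres (Y _) f (z i) = sres (Y _) g (z i).
Hypothesis cocycle : forall i, cd Y _ _ (z i) = 0.

Definition fchain_val n i (e : deg i = n) : Y n (grp i) := ccast Y e _ (z i).

Lemma fchain_inv n i (e : deg i = n) K (f g : surj K (grp i)) :
  stwist (sym i) f g -> sres (Y n) f (fchain_val e) = sres (Y n) g (fchain_val e).
Proof. by move=> /inv h; destruct e. Qed.

Definition fchain_map n : rhom (frep n) (Y n) := flift (@fchain_inv n).

Lemma fchain_comm n K x : fchain_map (n + 1) K (cd ffree n K x) = cd Y n K (fchain_map n K x).
Proof.
rewrite [LHS]linear0; symmetry.
apply: (frep_ext (a := rcomp (cd Y n) (fchain_map n)) (b := rzero _ _)) => i e.
by rewrite /= [flift _ _ _]fliftE sres_id; destruct e; exact: cocycle.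
Qed.

Definition fchain : chmap ffree Y := @ChMap k U ffree Y fchain_map fchain_comm.

Lemma fchainE n K i (e : deg i = n) (f : surj K (grp i)) :
  fchain n K (fg e f) = sres (Y n) f (ccast Y e _ (z i)).
Proof. exact: fliftE. Qed.
End Chain.

Hypothesis nosym : forall i, sym i = false.

Lemma nosym_inv V i (w : V (grp i)) K (f g : surj K (grp i)) :
  stwist (sym i) f g -> sres V f w = sres V g w.
Proof. by rewrite nosym => /sres_inner. Qed.

End Free.

(** * K-projective complexes *)

Section Kproj.
Variables (k : fieldType) (U : finGroupType -> Prop).
Implicit Types (X Y P : cplx k U) (G H K : Uob U).

(** K-projectivity in the sense of homotopy categories; as complexes are unbounded, projectivity in
    each degree would be too weak. *)
Definition kproj P := forall X (f : chmap P X), acyclic X -> nullh f.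

Lemma kproj_shift X : kproj X -> kproj (shift X).
Proof. by move=> pX A w /unshift_acyclic aA; apply/nullh_adj/pX. Qed.

Lemma kproj_cone X Y (f : chmap X Y) : kproj X -> kproj Y -> kproj (cone f).
Proof.
move=> pX pY A u aA.
have [h hh] := pY A (ccomp u (cinj f)) aA.
(* after subtracting the homotopy [h], the map factors through [shift X], i.e. has degree one on X *)
have lin n G : linear (fun x : X (n + 1) G => u n G (x, 0) : A n G).
  by move=> a x y; rewrite -linearP; congr (u n G _); congr pair; rewrite /= ?scaler0 ?addr0.
have nat n G H (v : {multiplicative G -> H}) (hv : surjective v) x :
    u n G (res (X (n + 1)) hv x, 0) = res (A n) hv (u n H (x, 0)).
  by rewrite -rnat; congr (u n G _); congr pair; rewrite /= ?linear0.
pose g n : rhom (X (n + 1)) (A n) := mkrhom (@lin n) (@nat n).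
have gdef n G x : u n G (x, 0) = g n G x by [].
clearbody g; clear lin nat.
have gE n G x y : u n G (x, y) = g n G x + u n G (0, y).
  by rewrite -gdef -linearD; congr (u n G _); congr pair; rewrite /= ?addr0 ?add0r.
have hg n G (x : X (n + 1) G) : cd A n G (g n G x) =
   - g (n + 1) G (cd X (n + 1) G x) + u (n + 1) G (0, f (n + 1) G x).
  by rewrite -gdef -(ccomm u) cone_dE linear0 addr0 gE linearN.
have {}hh n G (y : Y (n + 1) G) : u (n + 1) G (0, y) = cd A n G (h n G y) + h (n + 1) G (cd Y (n + 1) G y).
  exact: hh.
pose v n : rhom (shift X n) (A n) := radd (g n) (rneg (rcomp (h n) (f (n + 1)))).
have hv n G (x : shift X n G) : v (n + 1) G (cd (shift X) n G x) = cd A n G (v n G x).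
  rewrite /v /= !linearN linearD !linearN hg hh -(ccomm f) opprK; zmod.
have [l hl] : nullh (@ChMap k U (shift X) A v hv) by apply: kproj_shift.
pose m n : rhom (cone f (n + 1)) (A n) := 
  radd (rcomp (l n) (cproj f (n + 1))) (@RHom k U (cone f (n + 1)) (A n) (fun G => h n G \o snd) (fun G H w hw x => rnat (h n) hw x.2)).
exists m => n G [x y].
have := hl n G x; rewrite /= => e.
rewrite /m /= /lin_fun /= gE hh !linearD !linearN.
have : g (n + 1) G x = cd A n G (l n G x) - l (n + 1) G (cd X (n + 1 + 1) G x) + h (n + 1) G (f (n + 1 + 1) G x).
  by rewrite -linearN; zfrom e.
by move=> ->; zmod.
Qed.

(** The differential of a free complex is zero, so by Yoneda a null-homotopy is an arbitrary choice
    of one primitive per generator. It serves for acyclic targets and for ghost maps alike. *)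
Lemma free_null (I : Type) (deg : I -> int) (grp : I -> Uob U) Y
    (f : chmap (ffree k deg grp (fun=> false)) Y) :
  (forall i n (e : deg i = n + 1), bdry (f (n + 1) _ (fg k (fun=> false) e (sid _)))) -> nullh f.
Proof.
move=> ex.
have [w hw] := dep_choice (fun t : {i : I & {n : int | deg i = n + 1}} =>
  ex (projT1 t) (sval (projT2 t)) (proj2_sig (projT2 t))).
pose v n i (e : deg i = n + 1) : Y n (grp i) := w (existT _ i (exist _ n e)).
exists (fun n => flift (fun i e K a b => @nosym_inv k U _ grp (fun=> false) (fun=> erefl) (Y n) i (v n i e) K a b)).
move=> n G x; have -> : cd (ffree k deg grp (fun=> false)) (n + 1) G x = 0 by [].
rewrite linear0 addr0.
set l := flift _.
apply: (frep_ext (a := f (n + 1)) (b := rcomp (cd Y n) l)) => i e /=.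
by rewrite [l _ _]fliftE sres_id; symmetry; exact: (hw (existT _ i (exist _ n e))).
Qed.

Lemma kproj_free (I : Type) (deg : I -> int) (grp : I -> Uob U) :
  kproj (ffree k deg grp (fun=> false)).
Proof.
move=> A f aA; apply: free_null => i n e; apply: aA.
by rewrite -ccomm linear0.
Qed.

End Kproj.

(** * Arbitrary direct sums of complexes *)

Section DirectSum.
Variables (k : fieldType) (U : finGroupType -> Prop).
Implicit Types (X Z : cplx k U) (G H K : Uob U) (V W : rep k U).
Variables (I : eqType) (Y : I -> cplx k U).

Definition dgen n G := {classic {i : I & Y i n G}}.

Definition dlin n G (M : lmodType k) (phi : dgen n G -> M) : Prop :=
  forall i, linear (fun x : Y i n G => phi (existT _ i x)).

Definition dmod n G : lmodType k := pres (@dlin n G).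

Definition dg n G i (x : Y i n G) : dmod n G := gen (@dlin n G) (existT _ i x).

Lemma dg_lin n G i : linear (@dg n G i).
Proof.
move=> a x y; apply: pres_ext => M phi h.
rewrite -[LHS]/(plift h _) -[RHS]/(plift h _) linearP !plift_gen; exact: h.
Qed.

Definition dres_gen n K H (f : {multiplicative K -> H}) (hf : surjective f) (a : dgen n H) : dmod n K :=
  dg (res (Y (projT1 a) n) hf (projT2 a)).

Lemma dres_lin n K H (f : {multiplicative K -> H}) (hf : surjective f) : dlin (@dres_gen n K H f hf).
Proof. by move=> i a x y; rewrite /dres_gen /= linearP; exact: dg_lin. Qed.

Definition dres n K H (f : {multiplicative K -> H}) (hf : surjective f) :
  {linear dmod n H -> dmod n K} := plift (@dres_lin n K H f hf).

Lemma dres_dg n K H (f : {multiplicative K -> H}) (hf : surjective f) i x :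
  dres n hf (@dg n H i x) = dg (res (Y i n) hf x).
Proof. exact: plift_gen. Qed.

Lemma dres_conj n K H (f g : {multiplicative K -> H}) (hf : surjective f) (hg : surjective g) :
  (exists h : H, forall x, g x = (f x ^ h)%g) -> dres n hf =1 dres n hg.
Proof.
move=> e; apply: plin_ext => -[i x]; rewrite [LHS]dres_dg [RHS]dres_dg.
by congr dg; exact: res_conj.
Qed.

Lemma dres_id n K (f : {multiplicative K -> K}) (hf : surjective f) :
  f =1 id -> dres n hf =1 id.
Proof.
move=> e; apply: (plin_ext (g := idfun)) => -[i x]; rewrite [LHS]dres_dg.
by rewrite res_id.
Qed.

Lemma dres_comp n G H K (f : {multiplicative G -> H})
    (g : {multiplicative H -> K}) (h : {multiplicative G -> K})
    (hf : surjective f) (hg : surjective g) (hh : surjective h) :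
  h =1 g \o f -> dres n hh =1 dres n hf \o dres n hg.
Proof.
move=> e; apply: (plin_ext (g := dres n hf \o dres n hg)) => -[i x].
rewrite [LHS]dres_dg /= [dres n hg _]dres_dg dres_dg.
by rewrite (res_comp hf hg hh e).
Qed.

Definition drep n : rep k U :=
  @Rep k U (dmod n) (@dres n) (@dres_conj n) (@dres_id n) (@dres_comp n).

Lemma din_nat n i K H (f : {multiplicative K -> H}) (hf : surjective f) x :
  dg (res (Y i n) hf x) = res (drep n) hf (dg x).
Proof. by rewrite [RHS]dres_dg. Qed.

Definition din i n : rhom (Y i n) (drep n) :=
  @mkrhom k U (Y i n) (drep n) _ (fun G => @dg_lin n G i) (@din_nat n i).

Lemma drep_ext n V (a b : rhom (drep n) V) :
  (forall i G x, a G (din i n G x) = b G (din i n G x)) -> forall G x, a G x = b G x.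
Proof. by move=> h G; apply: plin_ext => -[i x]; exact: h. Qed.

Section Lift.
Variables (n : int) (V : rep k U) (t : forall i, rhom (Y i n) V).

Definition dlift_gen G (a : dgen n G) : V G := t (projT1 a) G (projT2 a).

Lemma dlift_lin G : dlin (@dlift_gen G).
Proof. by move=> i a x y; rewrite /dlift_gen linearP. Qed.

Lemma dlift_nat K H (u : {multiplicative K -> H}) (hu : surjective u) x :
  plift (@dlift_lin K) (res (drep n) hu x) = res V hu (plift (@dlift_lin H) x).
Proof.
move: x; apply: (plin_ext (f := plift (@dlift_lin K) \o res (drep n) hu)
  (g := res V hu \o plift (@dlift_lin H))) => -[i x] /=.
by rewrite -[gen _ _]/(dg x) [dres _ _ _]dres_dg [LHS]plift_gen [in RHS]plift_gen; exact: rnat.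
Qed.

Definition dlift : rhom (drep n) V := @RHom k U (drep n) V (fun K => plift (@dlift_lin K)) dlift_nat.

Lemma dliftE i G (x : Y i n G) : dlift G (din i n G x) = t i G x.
Proof. exact: plift_gen. Qed.
End Lift.

Definition dd n : rhom (drep n) (drep (n + 1)) := dlift (fun i => rcomp (din i (n + 1)) (cd (Y i) n)).

Lemma ddE n i G x : dd n G (din i n G x) = din i (n + 1) G (cd (Y i) n G x).
Proof. exact: dliftE. Qed.

Lemma ddd n G x : dd (n + 1) G (dd n G x) = 0.
Proof.
apply: (drep_ext (a := rcomp (dd (n + 1)) (dd n)) (b := rzero _ _)) => i K y.
by rewrite /= -!/(rmap _ _ _) !ddE cdd linear0.
Qed.

Definition dsumc : cplx k U := @Cplx k U drep dd ddd.

Definition dinc i : chmap (Y i) dsumc :=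
  @ChMap k U (Y i) dsumc (din i) (fun n G x => esym (ddE x)).

Section LiftC.
Variables (Z : cplx k U) (t : forall i, chmap (Y i) Z).
Lemma dliftc_comm n G x :
  dlift (fun i => t i (n + 1)) G (cd dsumc n G x) = cd Z n G (dlift (fun i => t i n) G x).
Proof.
apply: (drep_ext (a := rcomp (dlift (fun i => t i (n + 1))) (dd n))
  (b := rcomp (cd Z n) (dlift (fun i => t i n)))) => i K y.
rewrite -[LHS]/(dlift _ K (dd n K _)) -[RHS]/(cd Z n K (dlift _ K _)).
by rewrite ddE !dliftE ccomm.
Qed.
Definition dliftc : chmap dsumc Z := @ChMap k U dsumc Z (fun n => dlift (fun i => t i n)) dliftc_comm.
Lemma dliftcE i n G x : dliftc n G (dinc i n G x) = t i n G x. Proof. exact: dliftE. Qed.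
End LiftC.

Lemma dsumc_ext Z (a b : chmap dsumc Z) :
  (forall i, ceq (ccomp a (dinc i)) (ccomp b (dinc i))) -> ceq a b.
Proof. by move=> h n; apply: drep_ext => i G x; exact: h. Qed.

Definition dproj i : chmap dsumc (Y i) :=
  dliftc (fun j => match @eqP _ j i with
    | ReflectT e => match e in _ = l return chmap (Y j) (Y l) with erefl => Defs.cid (Y j) end
    | ReflectF _ => czero (Y j) (Y i) end).

Lemma dproj_eq i n G x : dproj i n G (dinc i n G x) = x.
Proof.
rewrite /dproj dliftcE; case: eqP => [e|/(_ erefl)//].
by rewrite (eq_axiomK e).
Qed.

Lemma dproj_ne i j n G x : j != i -> dproj i n G (dinc j n G x) = 0.
Proof. by move=> ne; rewrite /dproj dliftcE; case: eqP ne => // ->; rewrite eqxx. Qed.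

(** Finite support is expressed by cutting: an element lives on the summands in [J] when [dcut J]
    kills it. Being an endomorphism, the cut needs no partial sum and no change of index type. *)
Definition dcut (J : seq I) : chmap dsumc dsumc :=
  dliftc (fun i => if i \in J then czero (Y i) dsumc else dinc i).

Lemma dcutE J i n G x : dcut J n G (dinc i n G x) = if i \in J then 0 else dinc i n G x.
Proof. by rewrite /dcut dliftcE; case: ifP. Qed.

Lemma dcut_sub J J' : {subset J <= J'} -> ceq (ccomp (dcut J') (dcut J)) (dcut J').
Proof.
move=> s; apply: dsumc_ext => i n G x; rewrite /ccomp /rcomp.
rewrite -[LHS]/(dcut J' n G (dcut J n G (dinc i n G x))) -[RHS]/(dcut J' n G (dinc i n G x)).
by rewrite [in LHS]dcutE; case: ifP => // /s h; rewrite linear0 dcutE h.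
Qed.

Lemma dcut_nil : ceq (dcut [::]) (Defs.cid dsumc).
Proof. by apply: dsumc_ext => i n G x; exact: dcutE. Qed.

Lemma dcut_cons J i : i \notin J -> forall n G x,
  dcut J n G x = dinc i n G (dproj i n G x) + dcut (i :: J) n G x.
Proof.
move=> iJ; apply: (dsumc_ext (a := dcut J) (b := cadd (ccomp (dinc i) (dproj i)) (dcut (i :: J)))) => j n G x.
rewrite -[LHS]/(dcut J n G (dinc j n G x)).
rewrite -[RHS]/(dinc i n G (dproj i n G (dinc j n G x)) + dcut (i :: J) n G (dinc j n G x)).
rewrite !dcutE inE; have [e|ne] := eqVneq j i; first by destruct e; rewrite (negPf iJ) dproj_eq addr0.
by rewrite dproj_ne // linear0 add0r.
Qed.

Lemma dcut_sum J n G x : uniq J ->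
  x = \sum_(i <- J) dinc i n G (dproj i n G x) + dcut J n G x.
Proof.
elim: J => [_|i J IH /= /andP[iJ uJ]]; first by rewrite big_nil add0r; symmetry; exact: dcut_nil.
by rewrite {1}(IH uJ) big_cons (dcut_cons iJ) addrCA addrA.
Qed.

Lemma dcut_finite n G (x : dsumc n G) : exists J, uniq J /\ dcut J n G x = 0.
Proof.
(* The labels occurring in a representing formal sum contain the support. *)
exists (undup [seq projT1 c.2 | c <- generic_quotient.repr x]); rewrite undup_uniq; split=> //.
rewrite {2}(pres_gen x) linear_sum big_seq big1 // => -[a [i y]] h /=.
have hi : i \in [seq projT1 c.2 | c <- generic_quotient.repr x].
  exact: (map_f (fun c : k * dgen n G => projT1 c.2) h).
by rewrite linearZ /= [dcut _ _ _ _]dcutE mem_undup hi scaler0.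
Qed.

Lemma dcut_finite_fun (T : finType) (n : T -> int) (G : T -> Uob U) (x : forall t, dsumc (n t) (G t)) :
  exists J, forall t, dcut J (n t) (G t) (x t) = 0.
Proof.
pose j t := projT1 (boolp.cid (dcut_finite (x t))).
have hj t : dcut (j t) (n t) (G t) (x t) = 0 by have [] := projT2 (boolp.cid (dcut_finite (x t))).
exists (flatten [seq j t | t <- enum T]) => t.
have s : {subset j t <= flatten [seq j t | t <- enum T]}.
  by move=> i hi; apply/flatten_mapP; exists t; rewrite ?mem_enum.
by rewrite -(dcut_sub s) /= hj linear0.
Qed.

Lemma dsumc_decomp n G (x : dsumc n G) :
  exists J, uniq J /\ x = \sum_(i <- J) dinc i n G (dproj i n G x).
Proof.
by have [J [uJ hJ]] := dcut_finite x; exists J; split=> //; rewrite {1}(dcut_sum x uJ) hJ addr0.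
Qed.

Lemma kproj_dsumc : (forall i, kproj (Y i)) -> kproj dsumc.
Proof.
move=> p A f aA; pose h i := projT1 (boolp.cid (p i A (ccomp f (dinc i)) aA)).
have hh i : nullvia (ccomp f (dinc i)) (h i) by exact: projT2 (boolp.cid (p i A (ccomp f (dinc i)) aA)).
exists (fun n => dlift (fun i => h i n)) => n G x.
apply: (drep_ext (a := f (n + 1)) (b := radd (rcomp (cd A n) (dlift (fun i => h i n)))
   (rcomp (dlift (fun i => h i (n + 1))) (dd (n + 1))))) => i K y.
rewrite -[RHS]/(cd A n K (dlift _ K _) + dlift _ K (dd _ _ _)) ddE !dliftE; exact: hh.
Qed.

End DirectSum.

Section DirectSumMap.
Variables (k : fieldType) (U : finGroupType -> Prop) (I : eqType).
Variables (X Y : I -> cplx k U) (f : forall i, chmap (X i) (Y i)).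

Definition dmapc : chmap (dsumc X) (dsumc Y) := dliftc (fun i => ccomp (dinc Y i) (f i)).

Lemma dmapcE i n G x : dmapc n G (dinc X i n G x) = dinc Y i n G (f i n G x).
Proof. exact: dliftcE. Qed.

Lemma dproj_dmapc i n G x : dproj Y i n G (dmapc n G x) = f i n G (dproj X i n G x).
Proof.
apply: (dsumc_ext (a := ccomp (dproj Y i) dmapc) (b := ccomp (f i) (dproj X i))) => j {}n {}G {}x.
rewrite -[LHS]/(dproj Y i n G (dmapc n G (dinc X j n G x))) -[RHS]/(f i n G (dproj X i n G (dinc X j n G x))).
rewrite dmapcE; have [e|ne] := eqVneq j i; first by destruct e; rewrite !dproj_eq.
by rewrite !dproj_ne // linear0.
Qed.

(** Elements have finite support, so primitives and preimages can be chosen summand by summand and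
    added up. *)
Lemma dmapc_qiso : (forall i, qiso (f i)) -> qiso dmapc.
Proof.
move=> q n G; split=> [z hz [w hw]|y hy].
  have [J [_ e]] := dsumc_decomp z.
  have ex i : exists v, cd (X i) n G v = dproj X i (n + 1) G z.
    have [qi _] := q i n G; apply: qi; first by rewrite -ccomm hz linear0.
    by exists (dproj Y i n G w); rewrite -ccomm hw dproj_dmapc.
  exists (\sum_(i <- J) dinc X i n G (projT1 (boolp.cid (ex i)))).
  rewrite linear_sum [RHS]e; apply: eq_bigr => i _; rewrite -ccomm.
  by rewrite (projT2 (boolp.cid (ex i))).
have [J [_ e]] := dsumc_decomp y.
have ex i : exists x : X i (n + 1) G, cd (X i) (n + 1) G x = 0 /\ bdry (dproj Y i (n + 1) G y - f i (n + 1) G x).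
  have [_ qi] := q i n G; have [|x hx b] := qi (dproj Y i (n + 1) G y); last by exists x.
  by rewrite -ccomm hy linear0.
pose x i := projT1 (boolp.cid (ex i)).
have [hx hb] : (forall i, cd (X i) (n + 1) G (x i) = 0) /\
    (forall i, bdry (dproj Y i (n + 1) G y - f i (n + 1) G (x i))).
  by split=> i; have [] := projT2 (boolp.cid (ex i)).
exists (\sum_(i <- J) dinc X i (n + 1) G (x i)).
  by rewrite linear_sum big1 // => i _; rewrite -ccomm hx linear0.
have [v hv] := dep_choice hb.
exists (\sum_(i <- J) dinc Y i n G (v i)).
rewrite linear_sum [in RHS]e (linear_sum (dmapc (n + 1) G)) -sumrB; apply: eq_bigr => i _.
by rewrite -ccomm hv linearB dmapcE.
Qed.

End DirectSumMap.

(** * Resolutions *)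

Section Skeleton.
Variables (k : fieldType) (U : finGroupType -> Prop).
Implicit Types (X : cplx k U) (G H K : Uob U).

Definition giso G H := exists (a : surj G H) (b : surj H G), cancel a b /\ cancel b a.

Lemma sresK (V : rep k U) G H (a : surj G H) (b : surj H G) x :
  cancel a b -> sres V a (sres V b x) = x.
Proof.
move=> ab; rewrite -sres_comp -[RHS](sres_id x); congr (sres V _ x).
by apply: surj_eq => y /=; rewrite ab.
Qed.

Lemma bdry_iso X n G H (a : surj G H) (b : surj H G) (z : X (n + 1) G) :
  cancel a b -> bdry (sres (X _) b z) -> bdry z.
Proof.
by move=> ab [w hw]; exists (sres (X n) a w); rewrite sres_nat hw (sresK _ ab).
Qed.

(* [Uob U] is too large to index complexes, but multiplication tables are not:
   [skel] is a small set of representatives of the isomorphism classes in [U]. *)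
Definition code := {m : nat & {ffun 'I_m * 'I_m -> 'I_m}}.

Definition codes (c : code) (G : finGroupType) :=
  exists2 f : G -> 'I_(projT1 c), bijective f &
    forall x y, f (x * y)%g = projT2 c (f x, f y).

Lemma code_exists (G : finGroupType) : exists2 c : code, codes c G & projT1 c = #|G|.
Proof.
exists (existT _ #|G| [ffun t => enum_rank (enum_val t.1 * enum_val t.2)%g]) => //.
exists enum_rank => [|x y /=]; first by exists enum_val; [exact: enum_rankK|exact: enum_valK].
by rewrite ffunE /= !enum_rankK.
Qed.

Lemma codes_giso c G H : codes c G -> codes c H -> giso G H.
Proof.
move=> [f [f' ff' f'f] fM] [g [g' gg' g'g] gM].
have aM : {morph g' \o f : x y / (x * y)%g}.
  by move=> x y; apply: (can_inj gg'); rewrite /= g'g gM !g'g fM.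
have bM : {morph f' \o g : x y / (x * y)%g}.
  by move=> x y; apply: (can_inj ff'); rewrite /= f'f fM !f'f gM.
have aS : surjective (g' \o f) by move=> y; exists (f' (g y)); rewrite /= f'f gg'.
have bS : surjective (f' \o g) by move=> y; exists (g' (f y)); rewrite /= g'g ff'.
exists (@Surj U G H (mkmult aM) aS), (@Surj U H G (mkmult bM) bS).
by split=> x /=; rewrite ?g'g ?ff' ?f'f ?gg'.
Qed.

Definition skel := {c : code | exists G : Uob U, codes c G}.
Definition skob (s : skel) : Uob U := projT1 (boolp.cid (projT2 s)).

Lemma skobP (s : skel) : codes (projT1 s) (skob s).
Proof. exact: projT2 (boolp.cid (projT2 s)). Qed.

Lemma skob_giso G : exists2 s : skel, giso G (skob s) & projT1 (projT1 s) = #|G|.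
Proof.
have [c hc e] := code_exists G; pose s : skel := exist _ c (ex_intro _ G hc).
by exists s => //; apply: codes_giso hc (skobP s).
Qed.

End Skeleton.

(** * Mapping telescopes and ghost maps *)

Section Telescope.
Variables (k : fieldType) (U : finGroupType -> Prop).
Variables (Z : nat -> cplx k U) (s : forall i, chmap (Z i) (Z i.+1)).

Definition tsh : chmap (dsumc Z) (dsumc Z) := dliftc (fun i => ccomp (dinc Z i.+1) (s i)).
(** The cone of [tsig] is the homotopy colimit of the sequence. *)
Definition tsig : chmap (dsumc Z) (dsumc Z) := csub (Defs.cid _) tsh.

Lemma tsh_inc i n G x : tsh n G (dinc Z i n G x) = dinc Z i.+1 n G (s i n G x).
Proof. exact: dliftcE. Qed.

Lemma tsigE n G x : tsig n G x = x - tsh n G x. Proof. by []. Qed.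

Lemma tsig_inc i n G x : dinc Z i n G x = dinc Z i.+1 n G (s i n G x) + tsig n G (dinc Z i n G x).
Proof. by rewrite tsigE tsh_inc; zmod. Qed.

Lemma dproj_tsh0 n G x : dproj Z 0%N n G (tsh n G x) = 0.
Proof.
apply: (dsumc_ext (a := ccomp (dproj Z 0%N) tsh) (b := czero _ _)) => j {}n {}G {}x.
rewrite -[LHS]/(dproj Z 0%N n G (tsh n G (dinc Z j n G x))).
by rewrite tsh_inc dproj_ne.
Qed.

Lemma dproj_tshS i n G x : dproj Z i.+1 n G (tsh n G x) = s i n G (dproj Z i n G x).
Proof.
apply: (dsumc_ext (a := ccomp (dproj Z i.+1) tsh) (b := ccomp (s i) (dproj Z i))) => j {}n {}G {}x.
rewrite -[LHS]/(dproj Z i.+1 n G (tsh n G (dinc Z j n G x))).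
rewrite -[RHS]/(s i n G (dproj Z i n G (dinc Z j n G x))) tsh_inc.
have [e|ne] := eqVneq j i; first by destruct e; rewrite !dproj_eq.
by rewrite !dproj_ne // linear0.
Qed.

Lemma bdry_dsumc n G (z : dsumc Z (n + 1) G) :
  (forall i, bdry (dproj Z i (n + 1) G z)) -> bdry z.
Proof.
move=> /dep_choice[w hw]; have [J [_ e]] := dsumc_decomp z.
exists (\sum_(i <- J) dinc Z i n G (w i)); rewrite linear_sum [RHS]e.
by apply: eq_bigr => i _; rewrite -ccomm hw.
Qed.

(** Injectivity of [tsig] on cohomology, from the bottom up: component 0 receives nothing from the
    shift, and each later component is cohomologous to the image of its predecessor. *)
Lemma bdry_tsig n G (x : dsumc Z (n + 1) G) v : tsig _ G x + cd _ n G v = 0 -> bdry x.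
Proof.
move=> e; apply: bdry_dsumc => i.
have E j : dproj Z j _ G x - dproj Z j _ G (tsh _ G x) + cd _ n G (dproj Z j n G v) = 0.
  by have := congr1 (dproj Z j _ G) e; rewrite linearD tsigE linearB linear0 ccomm.
elim: i => [|i [w hw]].
  have := E 0%N; rewrite dproj_tsh0 => h.
  by exists (- dproj Z 0%N n G v); rewrite linearN; zfrom h.
have := E i.+1; rewrite dproj_tshS -hw => h.
by exists (s i n G w - dproj Z i.+1 n G v); rewrite linearB -ccomm; zfrom h.
Qed.

Definition ghost (X Y : cplx k U) (f : chmap X Y) :=
  forall n G (z : X (n + 1) G), cd X (n + 1) G z = 0 -> bdry (f (n + 1) G z).

(** The shift map [tsh] is then zero on cohomology, so [tsig] induces the identity there. *)
Lemma tsig_qiso : (forall i, ghost (s i)) -> qiso tsig.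
Proof.
move=> gs; have gsh : ghost tsh.
  move=> n G z hz; apply: bdry_dsumc => -[|i].
    by rewrite dproj_tsh0; exists 0; rewrite linear0.
  by rewrite dproj_tshS; apply: gs; rewrite -ccomm hz linear0.
move=> n G; split=> [z hz [w hw]|y hy].
  have [v hv] := gsh n G z hz; exists (w + v); rewrite linearD hw hv tsigE; zmod.
have [v hv] := gsh n G y hy.
exists y => //; exists v; rewrite hv tsigE; zmod.
Qed.

(** Modulo the image of [tsig] a class may be replaced by its image one stage later; the correction
    [t] stays a cocycle. *)
Lemma telescope_lift N i n G (y : Z i n G) : (i <= N)%N -> cd _ _ _ y = 0 ->
  exists (y' : Z N n G) t, [/\ cd _ _ _ y' = 0, cd _ _ _ t = 0 & dinc Z i n G y = dinc Z N n G y' + tsig n G t].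
Proof.
elim: N => [|N IH].
  rewrite leqn0 => /eqP e; destruct e => hy.
  by exists y, 0; rewrite hy !linear0 addr0.
rewrite leq_eqVlt => /orP[/eqP e|]; last rewrite ltnS => /IH h /h [y' [t [h1 h2 ->]]].
  by destruct e => hy; exists y, 0; rewrite hy !linear0 addr0.
exists (s N n G y'), (dinc Z N n G y' + t); rewrite -ccomm h1 linear0; split=> //.
  by rewrite linearD -ccomm h1 h2 linear0 addr0.
by rewrite [in LHS]tsig_inc !linearD; zmod.
Qed.

Lemma tcollect n G (x : dsumc Z n G) : cd _ _ _ x = 0 ->
  exists N (y : Z N n G) t, [/\ cd _ _ _ y = 0, cd _ _ _ t = 0 & x = dinc Z N n G y + tsig n G t].
Proof.
move=> hx; have [J [_ e0]] := dsumc_decomp x.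
suff [N [y [t [h1 h2 e]]]] : exists N (y : Z N n G) t, [/\ cd _ _ _ y = 0, cd _ _ _ t = 0 &
    \sum_(i <- J) dinc Z i n G (dproj Z i n G x) = dinc Z N n G y + tsig n G t].
  by exists N, y, t; rewrite -e.
elim: J {e0} => [|i J [N [y [t [h1 h2 e]]]]].
  by exists 0%N, 0, 0; rewrite !linear0 big_nil addr0.
rewrite big_cons e.
have h0 : cd (Z i) n G (dproj Z i n G x) = 0 by rewrite -ccomm hx linear0.
have [y1 [t1 [k1 k2 ->]]] := telescope_lift (leq_maxl i N) h0.
have [y2 [t2 [l1 l2 ->]]] := telescope_lift (leq_maxr i N) h1.
exists (maxn i N), (y1 + y2), (t1 + t2 + t).
by rewrite !linearD k1 k2 l1 l2 h2 !addr0; split=> //; zmod.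
Qed.

End Telescope.

Section Resolution.
Variables (k : fieldType) (U : finGroupType -> Prop) (X : cplx k U).

(* Each stage kills the cohomology of the cone of [sQ -> X]; the telescope of
   the stages is a resolution of [X]. *)
Record stage := Stage { sQ : cplx k U; sg : chmap sQ X }.

Section Step.
Variable S : stage.
Notation Q := (sQ S).
Notation g := (sg S).

(** One cell per cocycle of the cone of [sg S], at representative groups only. A cocycle [(q, x)] in
    degree [n + 1] is a cocycle [q] of [Q] in degree [n + 2] together with a primitive [- x] of its
    image in [X]: the cell kills [q], and the extension of [sg S] over the cell takes the value
    [- x]. *)
Definition sidx := {s : skel U & {n : int & {z : cone g (n + 1) (skob s) | cd (cone g) (n + 1) (skob s) z = 0}}}.
Definition sobj (i : sidx) := skob (projT1 i).
Definition sdeg (i : sidx) : int := projT1 (projT2 i) + 1 + 1.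
Definition scyc (i : sidx) : cone g (projT1 (projT2 i) + 1) (sobj i) := sval (projT2 (projT2 i)).

Lemma scycP i : cd (cone g) _ _ (scyc i) = 0. Proof. exact: (svalP (projT2 (projT2 i))). Qed.

Definition sA := ffree k sdeg sobj (fun=> false).
Definition sq (i : sidx) : Q (sdeg i) (sobj i) := (scyc i).1.
Definition sx (i : sidx) : X (projT1 (projT2 i) + 1) (sobj i) := (scyc i).2.

Lemma sq_cocycle i : cd Q _ _ (sq i) = 0.
Proof. by have := congr1 fst (scycP i) => /= /(congr1 -%R); rewrite opprK oppr0. Qed.

Lemma sx_d i : g _ _ (sq i) = - cd X _ _ (sx i).
Proof. have /= := congr1 snd (scycP i); rewrite -/(sq i) -/(sx i) => e; zfrom e. Qed.

Definition sattach : chmap sA Q :=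
  @fchain k U sidx sdeg sobj (fun=> false) Q sq
    (fun i K u v => @nosym_inv k U sidx sobj (fun=> false) (fun=> erefl) (Q (sdeg i)) i (sq i) K u v) sq_cocycle.

Definition shtpy_val n i (e : sdeg i = n + 1) : X n (sobj i) :=
  - ccast X (addIr 1 e) _ (sx i).

Definition shtpy n : rhom (sA (n + 1)) (X n) :=
  flift (fun i e K u v => @nosym_inv k U sidx sobj (fun=> false) (fun=> erefl) (X n) i (@shtpy_val n i e) K u v).

Lemma shtpyP : nullvia (ccomp g sattach) shtpy.
Proof.
move=> n G x; have -> : cd sA (n + 1) G x = 0 by [].
rewrite linear0 addr0.
apply: (frep_ext (a := rcomp (g (n + 1)) (sattach (n + 1))) (b := rcomp (cd X n) (shtpy n))) => i e.
rewrite /= [sattach _ _ _]fchainE [shtpy _ _ _]fliftE !sres_id (ccast_map g) sx_d.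
rewrite /shtpy_val !linearN; congr (- _).
by rewrite (ccast_d (addIr 1 e) e).
Qed.

Definition snext : stage := @Stage (cone sattach) (cone_ext shtpyP).

Definition sinc : chmap Q (sQ snext) := cinj sattach.

Lemma sinc_g n G x : sg snext n G (sinc n G x) = g n G x.
Proof. by rewrite -[LHS]/(shtpy n G 0 + g n G x) linear0 add0r. Qed.

(** Moved to a representative group, the cocycle is the label of one of the attached cells; the
    primitive that this cell provides is restricted back along the isomorphism. *)
Lemma sinc_kill n G q x : cd (cone g) (n + 1) G (q, x) = 0 ->
  exists (q' : sQ snext (n + 1) G) x',
    - cd (sQ snext) _ _ q' = sinc _ G q /\ sg snext _ _ q' + cd X n G x' = x.
Proof.
move=> hz; have [s [a [b [ab ba]]] _] := skob_giso G.
pose z := sres (cone g (n + 1)) b ((q, x) : cone g (n + 1) G).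
have hz' : cd (cone g) (n + 1) _ z = 0 by rewrite /z sres_nat hz linear0.
pose i : sidx := existT _ s (existT _ n (exist _ z hz')).
pose w : sA (n + 1 + 1) (skob s) := fg k (fun=> false) (erefl (sdeg i)) (sid (sobj i)).
have w1 : sattach _ _ w = sres (Q _) b q by rewrite fchainE sres_id ccast_id.
have w2 : shtpy _ _ w = - sres (X _) b x by rewrite fliftE sres_id /shtpy_val ccast_id.
exists (- sres (sQ snext (n + 1)) a ((w, 0) : sQ snext (n + 1) (skob s))), 0.
rewrite !linearN !sres_nat linear0 addr0 opprK cone_dE cone_extE w1 w2; split.
  have -> : cd sA (n + 1 + 1) (skob s) w = 0 by [].
  rewrite oppr0 linear0 addr0 -[RHS](sresK _ ab); congr (sres _ a _).
  exact: (sres_nat (sinc (n + 1 + 1)) b q).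
by rewrite linear0 addr0 linearN opprK sresK.
Qed.
End Step.

(** The sequence starts at the zero complex, where the cone of the map to [X] is [X] itself; the
    first step thus has a cell for every cocycle of [X], which gives surjectivity on cohomology. *)
Fixpoint stages (i : nat) : stage :=
  if i is i'.+1 then snext (stages i') else @Stage (ffree k (fun v : void => of_void int v) (fun v => of_void (Uob U) v) (fun=> false)) (czero _ X).

Definition stQ i := sQ (stages i).
Definition stinc i : chmap (stQ i) (stQ i.+1) := sinc (stages i).

Lemma stQ_kproj i : kproj (stQ i).
Proof.
elim: i => [|i IH]; first exact: kproj_free.
by apply: kproj_cone => //; exact: kproj_free.
Qed.

Definition stg : chmap (dsumc stQ) X := dliftc (fun i => sg (stages i)).

Lemma stg_sig n G x : stg n G (tsig stinc n G x) = 0.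
Proof.
apply: (dsumc_ext (a := ccomp stg (tsig stinc)) (b := czero _ _)) => i {}n {}G {}x.
rewrite -[LHS]/(stg n G (tsig stinc n G (dinc stQ i n G x))) tsigE tsh_inc linearB.
by rewrite [stg n G _]dliftcE [stg n G (dinc _ _ _ _ _)]dliftcE sinc_g subrr.
Qed.

Definition resol := cone (tsig stinc).

Lemma resol_null : nullvia (ccomp stg (tsig stinc)) (fun n => rzero (dsumc stQ (n + 1)) (X n)).
Proof. by move=> n G x; rewrite /= linear0 addr0; exact: stg_sig. Qed.

Definition resolm : chmap resol X := cone_ext resol_null.

Lemma resolmE n G s v : resolm n G (s, v) = stg n G v. Proof. exact: add0r. Qed.

Lemma resol_kproj : kproj resol.
Proof. by apply: kproj_cone; apply: kproj_dsumc => i; exact: stQ_kproj. Qed.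

Lemma resolm_qiso : qiso resolm.
Proof.
move=> n G; split; last first.
  move=> x hx; have [|q' [x' [e1 e2]]] := @sinc_kill (stages 0) n G 0 x.
    by rewrite cone_dE !linear0 hx addr0.
  have {}e1 : cd (stQ 1) _ _ q' = 0 by rewrite -[LHS]opprK e1 linear0.
  exists (0, dinc stQ 1%N _ _ q').
    by rewrite cone_dE !linear0 add0r -ccomm e1 linear0.
  by exists x'; rewrite resolmE [stg _ _ _]dliftcE -e2; zmod.
move: n; apply: int_succ_ind => n [s v] /cone_cocycle[e1 e2].
rewrite resolmE => -[x' hx'].
(* Injectivity: [s] is a boundary and can be removed; the remaining cocycle [v1] of the sum is
   collected at a single stage [N] and dies at stage [N.+1]. *)
have [w hw] := bdry_tsig e2.
pose v1 := v + tsig stinc _ _ w.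
have hv1 : cd _ _ _ v1 = 0 by rewrite linearD -ccomm hw -[RHS]e2; exact: addrC.
have [N [y [t [y0 t0 ey]]]] := tcollect stinc hv1.
have [|q' [x'' [f1 f2]]] := @sinc_kill (stages N) n G y (- x').
  rewrite cone_dE y0 oppr0 linearN hx'; congr pair.
  have <- : stg _ G v1 = stg _ G v by rewrite /v1 linearD [stg _ _ (tsig _ _ _ _)]stg_sig addr0.
  by rewrite ey linearD [stg _ _ (tsig _ _ _ _)]stg_sig addr0 [stg _ _ _]dliftcE subrr.
exists (t + dinc stQ N _ _ y - w, - dinc stQ N.+1 _ _ q').
rewrite cone_dE; congr pair.
  by rewrite [cd _ _ _ _]linearB [cd _ _ _ (_ + _)]linearD t0 -ccomm y0 linear0 hw; zmod.
rewrite [cd _ _ _ _]linearN -ccomm -linearN f1 linearB linearD.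
have := tsig_inc stinc y; have -> : v = v1 - tsig stinc _ _ w by rewrite /v1; zmod.
by rewrite ey => e; zfrom e.
Qed.

End Resolution.

Lemma kproj_resolution (k : fieldType) (U : finGroupType -> Prop) (X : cplx k U) :
  exists (Q : cplx k U) (q : chmap Q X), kproj Q /\ qiso q.
Proof.
by exists (resol X), (resolm X); split; [exact: resol_kproj|exact: resolm_qiso].
Qed.

(** * Morphisms of the derived category *)

Section Lifting.
Variables (k : fieldType) (U : finGroupType -> Prop).
Implicit Types (W X Y Z P : cplx k U) (G H K : Uob U).

(** A homotopy starts in degrees [n + 1], and so do the components read off from it; this extends
    them to a chain map in all degrees. *)
Lemma chmap_of_succ W X (g : forall n, rhom (W (n + 1)) (X (n + 1))) :
  (forall n G w, g (n + 1) G (cd W (n + 1) G w) = cd X (n + 1) G (g n G w)) ->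
  exists u : chmap W X, forall n G w, u (n + 1) G w = g n G w.
Proof.
move=> hg; pose u m : rhom (W m) (X m) :=
  rcomp (ccast X (esym (predS m))) (rcomp (g (m - 1)) (ccast W (predS m))).
have gc a b (e : a = b) (e' : a + 1 = b + 1) G w :
    g b G (ccast W e' G w) = ccast X e' G (g a G w).
  by destruct e; rewrite !ccast_id.
have uE n G w : u (n + 1) G w = g n G w.
  by rewrite /u /= (gc _ _ (esym (Spred n))) (ccast_trans _ _ erefl) ccast_id.
have uc n G x : u (n + 1) G (cd W n G x) = cd X n G (u n G x).
  move: n G x; apply: int_succ_ind => n G x; rewrite !uE; exact: hg.
by exists (ChMap uc).
Qed.

Lemma nullh_of_succ W X (w : chmap W X) (l : forall n, rhom (W (n + 1 + 1)) (X (n + 1))) :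
  (forall n G x, w (n + 1 + 1) G x = cd X (n + 1) G (l n G x) + l (n + 1) G (cd W (n + 1 + 1) G x)) ->
  nullh w.
Proof.
move=> hl; pose h m : rhom (W (m + 1)) (X m) :=
  rcomp (ccast X (esym (predS m))) (rcomp (l (m - 1)) (ccast W (congr1 (+%R^~ 1) (predS m)))).
have lc a b (e : a = b) (e' : a + 1 = b + 1) (e'' : a + 1 + 1 = b + 1 + 1) G x :
    l b G (ccast W e'' G x) = ccast X e' G (l a G x).
  by destruct e; rewrite !ccast_id.
have hE n G x : h (n + 1) G x = l n G x.
  rewrite /h /= (lc _ _ (esym (Spred n)) (congr1 (+%R^~ 1) (esym (Spred n)))).
  by rewrite (ccast_trans _ _ erefl) ccast_id.
exists h; apply: int_succ_ind => n G x; rewrite !hE; exact: hl.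
Qed.

(** A null-homotopy into the cone has two components: the one in [X] is the chain map sought, the
    one in [Y] is the homotopy. *)
Lemma lift_of_null W X Y (f : chmap X Y) (a : chmap W Y) :
  nullh (ccomp (cinj f) a) -> exists u : chmap W X, htp a (ccomp f u).
Proof.
move=> [h hh].
pose h1 n : rhom (W (n + 1)) (X (n + 1)) := @RHom k U _ (X (n + 1)) (fun G => fst \o h n G)
  (fun G H v hv x => congr1 fst (rnat (h n) hv x)).
pose h2 n : rhom (W (n + 1)) (Y n) := @RHom k U _ (Y n) (fun G => snd \o h n G)
  (fun G H v hv x => congr1 snd (rnat (h n) hv x)).
have hE n G w : h n G w = (h1 n G w, h2 n G w) by rewrite /=; case: (h n G w).
have hh1 n G w : h1 (n + 1) G (cd W (n + 1) G w) = cd X (n + 1) G (h1 n G w).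
  by have := congr1 fst (hh n G w); rewrite !hE cone_dE /= => e; zfrom e.
have hh2 n G w : a (n + 1) G w = f (n + 1) G (h1 n G w) + cd Y n G (h2 n G w) + h2 (n + 1) G (cd W (n + 1) G w).
  by have := congr1 snd (hh n G w); rewrite !hE cone_dE.
have [u hu] := chmap_of_succ hh1.
exists u, h2 => n G w; rewrite /= hu hh2; zmod.
Qed.

Lemma kproj_lift P X Y (s : chmap X Y) (v : chmap P Y) : kproj P -> qiso s ->
  exists u : chmap P X, htp v (ccomp s u).
Proof. by move=> kP /qiso_cone_acyclic ac; apply: lift_of_null; apply: kP. Qed.

(** If [h] is a null-homotopy of the composite, then [(w, - h)] is a chain map from the shift of [P]
    to the acyclic cone of [s]. It is null-homotopic, and the [X]-component of a homotopy, negated,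
    is one for [w]. *)
Lemma kproj_null P X Y (s : chmap X Y) (w : chmap P X) : kproj P -> qiso s ->
  nullh (ccomp s w) -> nullh w.
Proof.
move=> kP /qiso_cone_acyclic ac [h hh].
have lin n G : linear (fun x : shift P n G => (w (n + 1) G x, - h n G x) : cone s n G).
  by move=> a x y; congr pair; rewrite /= !linearP // scalerN opprD.
have nat n G H (v : {multiplicative G -> H}) (hv : surjective v) (x : P (n + 1) H) :
    (w (n + 1) G (res (P (n + 1)) hv x), - h n G (res (P (n + 1)) hv x)) =
    res (cone s n) hv (w (n + 1) H x, - h n H x).
  by congr pair; rewrite /= ?linearN !rnat.
pose q n : rhom (shift P n) (cone s n) := @mkrhom k U (shift P n) (cone s n) _ (@lin n) (@nat n).
have qc n G x : q (n + 1) G (cd (shift P) n G x) = cd (cone s) n G (q n G x).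
  rewrite -[q n G x]/(w (n + 1) G x, - h n G x) cone_dE.
  rewrite -[LHS]/(w (n + 1 + 1) G (- cd P (n + 1) G x), - h (n + 1) G (- cd P (n + 1) G x)).
  congr pair; rewrite !linearN -?ccomm // opprK.
  by have /= -> := hh n G x; zmod.
have [l hl] : nullh (@ChMap k U (shift P) (cone s) q qc) by apply: kproj_shift.
pose l1 n : rhom (P (n + 1 + 1)) (X (n + 1)) := rneg (@RHom k U (P (n + 1 + 1)) (X (n + 1)) (fun G => fst \o l n G)
  (fun G H v hv x => congr1 fst (rnat (l n) hv x))).
apply: (nullh_of_succ (l := l1)) => n G x.
have := congr1 fst (hl n G x); rewrite -[LHS]/(w (n + 1 + 1) G x) => ->.
rewrite -[LHS]/(- cd X (n + 1) G (l n G x).1 + (l (n + 1) G (- cd P (n + 1 + 1) G x)).1).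
by rewrite (linearN (l (n + 1) G)) /= linearN.
Qed.

End Lifting.

Section Derived.
Variables (k : fieldType) (U : finGroupType -> Prop).
Implicit Types (W X Y Z P : cplx k U) (G H K : Uob U).

#[local] Hint Resolve deq_refl : core.

#[local] Instance deq_equiv X Y : Equivalence (@deq k U X Y).
Proof. split; [exact: deq_refl|exact: deq_sym|exact: deq_trans]. Qed.

#[local] Instance dcomp_proper X Y Z :
  Proper (@deq k U Y Z ==> @deq k U X Y ==> @deq k U X Z) (@dcomp k U X Y Z).
Proof. by move=> g g' eg f f' ef; exact: deq_comp. Qed.

#[local] Instance dadd_proper X Y :
  Proper (@deq k U X Y ==> @deq k U X Y ==> @deq k U X Y) (@dadd k U X Y).
Proof. by move=> g g' eg f f' ef; exact: deq_add. Qed.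

Lemma dmap_ceq X Y (f g : chmap X Y) : ceq f g -> deq (dmap f) (dmap g).
Proof. exact: deq_map. Qed.

(** Induction on the word; at a formal inverse, the zero morphism is rewritten as a composite with
    the map that is inverted. *)
Lemma dzero_l X Y Z (f : dmor X Y) : deq (dcomp (dzero Y Z) f) (dzero X Z).
Proof.
elim: f Z => [{}X {}Y f|{}X {}Y s hs|{}X {}Y W g IHg f IHf|{}X {}Y f IHf g IHg] Z.
- by rewrite /dzero -deq_map_comp; apply: dmap_ceq => n G x.
- have e : deq (dzero X Z) (dcomp (dzero Y Z) (dmap s)).
    by rewrite /dzero -deq_map_comp; apply: dmap_ceq => n G x.
  by rewrite e -deq_compA deq_map_inv deq_comp_id.
- by rewrite deq_compA IHg IHf.
- by rewrite deq_compDr IHf IHg deq_add0.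
Qed.

Lemma dzero_r X Y Z (f : dmor Y Z) : deq (dcomp f (dzero X Y)) (dzero X Z).
Proof.
elim: f X => [{}Y {}Z f|{}Y {}Z s hs|{}Y {}Z W g IHg f IHf|{}Y {}Z f IHf g IHg] X.
- by rewrite /dzero -deq_map_comp; apply: dmap_ceq => n G x /=; rewrite linear0.
- have e : deq (dzero X Z) (dcomp (dmap s) (dzero X Y)).
    by rewrite /dzero -deq_map_comp; apply: dmap_ceq => n G x /=; rewrite linear0.
  by rewrite e deq_compA deq_inv_map deq_id_comp.
- by rewrite -deq_compA IHf IHg.
- by rewrite deq_compDl IHf IHg deq_add0.
Qed.

Definition dneg X Y (f : dmor X Y) : dmor X Y := dcomp (dmap (cneg (Defs.cid Y))) f.

Lemma deq_addN X Y (f : dmor X Y) : deq (dadd f (dneg f)) (dzero X Y).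
Proof.
rewrite /dneg -{1}(deq_id_comp f) -deq_compDl /did -deq_map_add.
have -> : deq (dmap (cadd (Defs.cid Y) (cneg (Defs.cid Y)))) (dzero Y Y).
  by apply: dmap_ceq => n G x; exact: subrr.
exact: dzero_l.
Qed.

Lemma deq_add0r X Y (f : dmor X Y) : deq (dadd f (dzero X Y)) f.
Proof. by rewrite deq_addC deq_add0. Qed.

Lemma deq_sub0 X Y (f g : dmor X Y) : deq (dadd f (dneg g)) (dzero X Y) -> deq f g.
Proof.
move=> h; rewrite -(deq_add0r f) -(deq_addN g) (deq_addC g) deq_addA h; exact: deq_add0.
Qed.

Lemma deq_subK X Y (f g h : dmor X Y) : deq (dadd f (dneg g)) h -> deq f (dadd g h).
Proof. by move=> <-; rewrite (deq_addC f) deq_addA deq_addN deq_add0. Qed.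

#[local] Instance dneg_proper X Y : Proper (@deq k U X Y ==> @deq k U X Y) (@dneg X Y).
Proof. by move=> f g e; rewrite /dneg e. Qed.

(** The zero endomorphism of an acyclic complex is a quasi-isomorphism, hence invertible. *)
Lemma acyclic_id0 X : acyclic X -> deq (did X) (dzero X X).
Proof.
move=> aX; have q : qiso (czero X X) by exact: acyclic_qiso.
by rewrite -(deq_inv_map q) -/(dzero _ _) dzero_r.
Qed.

(** A null-homotopic map factors through the cone of an identity, which is acyclic. *)
Lemma nullh_dzero X Y (f : chmap X Y) : nullh f -> deq (dmap f) (dzero X Y).
Proof.
move=> [h hh].
have hf : nullvia (ccomp f (Defs.cid X)) h by [].
have -> : deq (dmap f) (dcomp (dmap (cone_ext hf)) (dmap (cinj (Defs.cid X)))).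
  by rewrite -deq_map_comp; apply: dmap_ceq => n G x; rewrite -[RHS]/(h n G 0 + f n G x) linear0 add0r.
rewrite -(deq_id_comp (dmap (cinj _))) (acyclic_id0 (@cone_id_acyclic k U X)).
by rewrite dzero_l dzero_r.
Qed.

Lemma htp_deq X Y (f g : chmap X Y) : htp f g -> deq (dmap f) (dmap g).
Proof.
move=> /nullh_dzero; rewrite /csub deq_map_add => h; apply: deq_sub0.
rewrite -h; apply: deq_add; first exact: deq_refl.
by rewrite /dneg -deq_map_comp; apply: dmap_ceq.
Qed.

(* the partial action of a morphism on homotopy classes of maps out of [P] *)
Fixpoint act P X Y (f : dmor X Y) : chmap P X -> chmap P Y -> Prop :=
  match f in dmor X Y return chmap P X -> chmap P Y -> Prop with
  | dmap X Y f => fun u v => htp (ccomp f u) v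
  | dinv X Y s _ => fun u v => htp (ccomp s v) u
  | dcomp X Y Z g f => fun u w => exists v, act f u v /\ act g v w
  | dadd X Y f g => fun u v => exists v1 v2, [/\ act f u v1, act g u v2 & htp (cadd v1 v2) v]
  end.

Lemma act_htp P X Y (f : dmor X Y) (u u' : chmap P X) (v v' : chmap P Y) :
  htp u u' -> htp v v' -> act f u v -> act f u' v'.
Proof.
move=> hu hv; elim: f u u' hu v v' hv => [{}X {}Y f|{}X {}Y s hs|{}X {}Y W g IHg f IHf|{}X {}Y f IHf g IHg] u u' hu v v' hv /=.
- move=> h; apply: htp_trans hv; apply: htp_trans h; apply: htp_compl; exact: htp_sym.
- move=> h; apply: htp_trans hu; apply: htp_trans h; apply: htp_compl; exact: htp_sym.
- move=> [w [h1 h2]]; exists w; split; first exact: IHf _ _ hu _ _ (htp_refl w) h1.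
  exact: IHg _ _ (htp_refl w) _ _ hv h2.
- move=> [v1 [v2 [h1 h2 h3]]]; exists v1, v2; split; last exact: htp_trans hv.
    exact: IHf _ _ hu _ _ (htp_refl _) h1.
  exact: IHg _ _ hu _ _ (htp_refl _) h2.
Qed.

Lemma act_fun P X Y (f : dmor X Y) (u : chmap P X) (v v' : chmap P Y) : kproj P ->
  act f u v -> act f u v' -> htp v v'.
Proof.
move=> kP; elim: f u v v' => [{}X {}Y f|{}X {}Y s hs|{}X {}Y W g IHg f IHf|{}X {}Y f IHf g IHg] u v v' /=.
- by move=> h1 h2; apply: htp_trans h2; exact: htp_sym.
- move=> h1 h2; apply: kproj_null kP hs _.
  apply: nullh_ext (htp_trans h1 (htp_sym h2)) => n G x /=.
  by rewrite linearD linearN.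
- move=> [w [h1 h2]] [w' [h1' h2']].
  by apply: IHg h2 (act_htp (htp_sym (IHf _ _ _ h1 h1')) (htp_refl _) h2').
- move=> [v1 [v2 [h1 h2 h3]]] [v1' [v2' [h1' h2' h3']]].
  apply: htp_trans h3'; apply: htp_trans (htp_sym h3) _.
  exact: htp_add (IHf _ _ _ h1 h1') (IHg _ _ _ h2 h2').
Qed.

Lemma act_total P X Y (f : dmor X Y) (u : chmap P X) : kproj P -> exists v, act f u v.
Proof.
move=> kP; elim: f u => [{}X {}Y f|{}X {}Y s hs|{}X {}Y W g IHg f IHf|{}X {}Y f IHf g IHg] u /=.
- by exists (ccomp f u); exact: htp_refl.
- by have [v hv] := kproj_lift u kP hs; exists v; exact: htp_sym.
- by have [v hv] := IHf u; have [w hw] := IHg v; exists w, v.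
- have [v hv] := IHf u; have [w hw] := IHg u; exists (cadd v w), v, w.
  by split=> //; exact: htp_refl.
Qed.

Lemma act_add P X Y (f : dmor X Y) (u u' : chmap P X) (v v' : chmap P Y) :
  act f u v -> act f u' v' -> act f (cadd u u') (cadd v v').
Proof.
elim: f u u' v v' => [{}X {}Y f|{}X {}Y s hs|{}X {}Y W g IHg f IHf|{}X {}Y f IHf g IHg] u u' v v' /=.
- move=> h h'; apply: htp_trans (htp_add h h'); apply: htp_ceq => n G x; exact: linearD.
- move=> h h'; apply: htp_trans (htp_add h h'); apply: htp_ceq => n G x; exact: linearD.
- move=> [w [h1 h2]] [w' [h1' h2']]; exists (cadd w w').
  by split; [exact: IHf|exact: IHg].
- move=> [a [b [h1 h2 h3]]] [a' [b' [h1' h2' h3']]]; exists (cadd a a'), (cadd b b').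
  split; [exact: IHf|exact: IHg|].
  apply: htp_trans (htp_add h3 h3'); apply: htp_ceq => n G x; exact: addrACA.
Qed.

(** Soundness of the action: every rule generating [deq] is checked on homotopy classes. This is the
    one place where [deq] is shown not to identify too much. *)
Lemma act_deq P X Y (f g : dmor X Y) (u : chmap P X) (v : chmap P Y) : kproj P ->
  deq f g -> act f u v <-> act g u v.
Proof.
move=> kP e.
(* by totality and functionality, one implication suffices *)
suff half X' Y' (f' g' : dmor X' Y') : deq f' g' ->
    forall (u : chmap P X') v w, act f' u v -> act g' u w -> htp v w.
  split=> h.
    have [w hw] := act_total g u kP.
    by apply: (act_htp (htp_refl u) _ hw); apply: htp_sym; exact: (half _ _ _ _ e _ _ _ h hw).
  have [w hw] := act_total f u kP.
  by apply: (act_htp (htp_refl u) _ hw); exact: (half _ _ _ _ e _ _ _ hw h).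
have fn X1 Y1 := @act_fun P X1 Y1.
elim=> {X Y f g e u v X' Y' f' g'}.
- by move=> X Y f u v w h1 h2; exact: fn kP h1 h2.
- by move=> X Y f g _ IH u v w h1 h2; apply: htp_sym; exact: IH h2 h1.
- move=> X Y f g h _ IH1 _ IH2 u v w h1 h2; have [z hz] := act_total g u kP.
  exact: htp_trans (IH1 _ _ _ h1 hz) (IH2 _ _ _ hz h2).
- move=> X Y Z g g' f f' _ IHg _ IHf u v w [a [h1 h2]] [b [h3 h4]].
  apply: (IHg _ _ _ h2 (act_htp _ (htp_refl _) h4)); exact: htp_sym (IHf _ _ _ h1 h3).
- move=> X Y f f' g g' _ IHf _ IHg u v w [a [b [h1 h2 h3]]] [a' [b' [h1' h2' h3']]].
  apply: htp_trans h3'; apply: htp_trans (htp_sym h3) _.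
  exact: htp_add (IHf _ _ _ h1 h1') (IHg _ _ _ h2 h2').
- move=> X Y Z W h g f u v w [a [[b [h1 h2]] h3]] /= h4.
  apply: (fn _ _ _ _ _ _ kP (_ : act (dcomp (dcomp h g) f) u v) h4); exists b; split=> //; exists a; split=> //.
- move=> X Y f u v w [a [h1 h2]] h3; apply: htp_trans (htp_sym h2) _.
  exact: htp_trans (htp_ceq _) (fn _ _ _ _ _ _ kP h1 h3).
- move=> X Y f u v w [a [h1 h2]] h3.
  by apply: (fn _ _ _ _ _ _ kP h2 (act_htp _ (htp_refl _) h3)); apply: htp_trans h1; exact: htp_ceq.
- move=> X Y f g h u v w [a [b [h1 [c [d [h2 h3 h4]]] h5]]] [a' [b' [[c' [d' [h2' h3' h4']]] h1' h5']]].
  apply: htp_trans h5'; apply: htp_trans (htp_sym h5) _.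
  apply: htp_trans (htp_add (htp_refl a) (htp_sym h4)) _.
  apply: htp_trans _ (htp_add h4' (htp_refl b')).
  apply: htp_trans (htp_add (fn _ _ _ _ _ _ kP h1 h2') (htp_add (fn _ _ _ _ _ _ kP h2 h3') (fn _ _ _ _ _ _ kP h3 h1'))) _.
  by apply: htp_ceq => n G x; exact: addrA.
- move=> X Y f g u v w [a [b [h1 h2 h3]]] [a' [b' [h1' h2' h3']]].
  apply: htp_trans h3'; apply: htp_trans (htp_sym h3) _.
  apply: htp_trans (htp_add (fn _ _ _ _ _ _ kP h1 h2') (fn _ _ _ _ _ _ kP h2 h1')) _.
  by apply: htp_ceq => n G x; exact: addrC.
- move=> X Y f u v w [a [b [h1 h2 h3]]] h4.
  apply: htp_trans (htp_sym h3) _; apply: htp_trans (htp_add (htp_sym h1) (fn _ _ _ _ _ _ kP h2 h4)) _.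
  by apply: htp_ceq => n G x; exact: add0r.
- move=> X Y Z g g' f u v w [a [h1 [b [c [h2 h3 h4]]]]] [b' [c' [[a1 [h1' h2']] [a2 [h1'' h3']] h4']]].
  apply: htp_trans h4'; apply: htp_trans (htp_sym h4) _; apply: htp_add.
    by apply: (fn _ _ _ _ _ _ kP h2 (act_htp _ (htp_refl _) h2')); exact: fn kP h1' h1.
  by apply: (fn _ _ _ _ _ _ kP h3 (act_htp _ (htp_refl _) h3')); exact: fn kP h1'' h1.
- move=> X Y Z g f f' u v w [a [[b [c [h1 h2 h3]]] h4]] [b' [c' [[b1 [k1 k2]] [c1 [k3 k4]] k5]]].
  have [x hx] := act_total g b kP; have [y hy] := act_total g c kP.
  have h := act_htp h3 (htp_refl _) (act_add hx hy).
  apply: htp_trans k5; apply: htp_trans (fn _ _ _ _ _ _ kP h4 h) _; apply: htp_add.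
    by apply: (fn _ _ _ _ _ _ kP hx (act_htp _ (htp_refl _) k2)); exact: fn kP k1 h1.
  by apply: (fn _ _ _ _ _ _ kP hy (act_htp _ (htp_refl _) k4)); exact: fn kP k3 h2.
- move=> X Y f g e u v w h1 h2; apply: htp_trans h2; apply: htp_trans (htp_sym h1) _.
  by apply: htp_ceq => n G x; exact: e.
- move=> X Y Z g f u v w h1 [a [h2 h3]]; apply: htp_trans h3; apply: htp_trans (htp_sym h1) _.
  exact: htp_compl h2.
- move=> X Y f g u v w h1 [a [b [h2 h3 h4]]]; apply: htp_trans h4; apply: htp_trans (htp_sym h1) _.
  exact: htp_add h2 h3.
- move=> X Y s hs u v w [a [h1 h2]] h3; apply: htp_trans _ h3.
  have := htp_trans h2 (htp_sym h1) => /= h.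
  apply: kproj_null kP hs _; apply: nullh_ext h => n G x /=.
  by rewrite linearD linearN.
- move=> X Y s hs u v w [a [h1 h2]] h3; apply: htp_trans _ h3.
  exact: htp_trans (htp_sym h2) h1.
Qed.

Lemma act_dmap P X Y (f : dmor X Y) (u : chmap P X) (v : chmap P Y) :
  act f u v -> deq (dcomp f (dmap u)) (dmap v).
Proof.
elim: f u v => [{}X {}Y f|{}X {}Y s hs|{}X {}Y W g IHg f IHf|{}X {}Y f IHf g IHg] u v /=.
- by move=> /htp_deq <-; rewrite deq_map_comp.
- by move=> /htp_deq <-; rewrite deq_map_comp deq_compA deq_inv_map deq_id_comp.
- by move=> [w [h1 h2]]; rewrite -deq_compA (IHf _ _ h1) (IHg _ _ h2).
- move=> [a [b [h1 h2 h3]]]; rewrite -(htp_deq h3) deq_map_add -(IHf _ _ h1) -(IHg _ _ h2).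
  by rewrite deq_compDl.
Qed.

Lemma kproj_roof P Y (f : dmor P Y) : kproj P -> exists f', deq f (dmap f').
Proof.
move=> kP; have [v hv] := act_total f (Defs.cid P) kP; exists v.
by rewrite -(act_dmap hv) -/(did P) deq_comp_id.
Qed.

(** Both morphisms act on the identity of [P], with results [f] and [g] up to homotopy. *)
Lemma kproj_faithful P Y (f g : chmap P Y) : kproj P -> deq (dmap f) (dmap g) -> htp f g.
Proof.
move=> kP /(act_deq (Defs.cid P) g kP)[_ h].
by apply: htp_trans (h (htp_refl _)); exact: htp_ceq.
Qed.

Lemma kproj_faithful0 P Y (f : chmap P Y) : kproj P -> deq (dmap f) (dzero P Y) -> nullh f.
Proof. by move=> kP /(kproj_faithful kP) /htp_zero. Qed.

End Derived.

#[local] Hint Resolve deq_refl : core.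
#[local] Existing Instances deq_equiv dcomp_proper dadd_proper dneg_proper.

(** * Mapping cones and exactness of Hom *)

Section Triangles.
Variables (k : fieldType) (U : finGroupType -> Prop).
Implicit Types (W X Y Z P : cplx k U) (G H K : Uob U).

Lemma qiso_diso X Y (s : chmap X Y) : qiso s -> diso X Y.
Proof.
by move=> q; exists (dmap s), (dinv q); split; [exact: deq_inv_map|exact: deq_map_inv].
Qed.

Lemma diso_refl X : diso X X.
Proof. by exists (did X), (did X); split; exact: deq_id_comp. Qed.

Lemma diso_sym X Y : diso X Y -> diso Y X.
Proof. by move=> [f [g [h1 h2]]]; exists g, f. Qed.

Lemma diso_retract X Y : diso X Y -> retract X Y.
Proof. by move=> [f [g [h _]]]; exists f, g. Qed.

Lemma qiso_epi X Y Z (s : chmap X Y) (f g : dmor Y Z) : qiso s ->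
  deq (dcomp f (dmap s)) (dcomp g (dmap s)) -> deq f g.
Proof.
move=> q e; rewrite -(deq_comp_id f) -(deq_comp_id g) -(deq_map_inv q) !deq_compA.
by rewrite e.
Qed.

Lemma qiso_mono X Y Z (s : chmap X Y) (f g : dmor Z X) : qiso s ->
  deq (dcomp (dmap s) f) (dcomp (dmap s) g) -> deq f g.
Proof.
move=> q e; rewrite -(deq_id_comp f) -(deq_id_comp g) -(deq_inv_map q) -!deq_compA.
by rewrite e.
Qed.

Lemma dmap_comp0 X Y Z (f : chmap X Y) (g : chmap Y Z) :
  (forall n G x, g n G (f n G x) = 0) -> deq (dcomp (dmap g) (dmap f)) (dzero X Z).
Proof. by move=> h; rewrite -deq_map_comp; apply: dmap_ceq. Qed.

Lemma cproj_cinj X Y (f : chmap X Y) : deq (dcomp (dmap (cproj f)) (dmap (cinj f))) (dzero Y (shift X)).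
Proof. exact: dmap_comp0. Qed.

Section ConeMap.
Variables (X X' Y Y' : cplx k U) (f : chmap X Y) (f' : chmap X' Y') (a : chmap X' X) (b : chmap Y' Y).
Hypothesis sq : htp (ccomp b f') (ccomp f a).

Lemma cone_map : exists c : chmap (cone f') (cone f),
  [/\ ceq (ccomp c (cinj f')) (ccomp (cinj f) b),
      ceq (ccomp (cproj f) c) (ccomp (shiftm a) (cproj f')) &
      qiso a -> qiso b -> qiso c].
Proof.
have [h hh] := sq.
have {}hh n G x : b (n + 1) G (f' (n + 1) G x) = f (n + 1) G (a (n + 1) G x) +
    (cd Y n G (h n G x) + h (n + 1) G (cd X' (n + 1) G x)).
  by have /= <- := hh n G x; zmod.
have lin n G : linear (fun x : X' (n + 1) G => (a (n + 1) G x, h n G x) : cone f n G).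
  by move=> c x y; congr pair; rewrite /= linearP.
have nat n G H (v : {multiplicative G -> H}) (hv : surjective v) (x : X' (n + 1) H) :
    (a (n + 1) G (res (X' (n + 1)) hv x), h n G (res (X' (n + 1)) hv x)) =
    res (cone f n) hv (a (n + 1) H x, h n H x).
  by congr pair; rewrite /= rnat.
pose l n := @mkrhom k U (X' (n + 1)) (cone f n) _ (@lin n) (@nat n).
have hl : nullvia (ccomp (ccomp (cinj f) b) f') l.
  move=> n G x; rewrite -[l n G x]/(a (n + 1) G x, h n G x) cone_dE.
  rewrite -[l (n + 1) G _]/(a (n + 1 + 1) G (cd X' (n + 1) G x), h (n + 1) G (cd X' (n + 1) G x)).
  rewrite -[LHS]/(0, b (n + 1) G (f' (n + 1) G x)) hh.
  by congr pair; rewrite /= ?addrA // ccomm addNr.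
have lE n G x y : cone_ext hl n G (x, y) = (a (n + 1) G x, h n G x + b n G y).
  by rewrite cone_extE; congr pair; rewrite /= ?addr0.
exists (cone_ext hl); split.
- by move=> n G y; rewrite -[LHS]/(cone_ext hl n G (0, y)) lE !linear0 add0r.
- by move=> n G [x y]; rewrite -[LHS]/((cone_ext hl n G (x, y)).1) lE.
move: (cone_ext hl) lE => c lE {l lin nat hl} qa qb n G; split=> [[x y]|[p q]].
  move=> /cone_cocycle[hx hy] [[p q]]; rewrite lE cone_dE => e.
  have {}[e1 e2] : - cd X _ _ p = a _ _ x /\ f _ _ p + cd Y _ _ q = h _ _ x + b _ _ y.
    by split; [exact: (congr1 fst e)|exact: (congr1 snd e)].
  have [|w hw] := (qa (n + 1) G).1 x hx; first by exists (- p); rewrite linearN.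
  pose y1 := y + f' (n + 1) G w.
  have hy1 : cd Y' (n + 1) G y1 = 0 by rewrite /y1 linearD -ccomm hw -[RHS]hy; zmod.
  have [|p1 hp1 [r hr]] := (qa n G).2 (p + a (n + 1) G w).
    by rewrite linearD -ccomm hw -e1; zmod.
  have [||v hv] := (qb n G).1 (y1 - f' (n + 1) G p1).
  - by rewrite linearB hy1 -ccomm hp1 linear0 subrr.
  - exists (f n G r + q + h n G w - h n G p1).
    have E1 := hh n G w; have E2 := hh n G p1; rewrite hp1 linear0 hw in E1 E2.
    have E3 := congr1 (f _ G) hr; rewrite linearB linearD ccomm in E3.
    rewrite linearB linearD linearD E3 /y1 !linearB !linearD E1 E2.
    by zfrom e2.
  exists (p1 - w, v); rewrite cone_dE; congr pair.
    by rewrite linearB hp1 hw; zmod.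
  by rewrite hv /y1 linearB; zmod.
move=> /cone_cocycle[hp hq].
have [x hx [r hr]] := (qa (n + 1) G).2 p hp.
have E3 := congr1 (f _ G) hr; rewrite linearB ccomm in E3.
have E1 := hh (n + 1) G x; rewrite hx linear0 addr0 in E1.
have [||y0 hy0] := (qb (n + 1) G).1 (f' _ _ x); first by rewrite -ccomm hx linear0.
  by exists (h _ _ x - q - f _ _ r); rewrite !linearB E3 E1; zfrom hq.
have [|y2 hy2 [v hv]] := (qb n G).2 (q + f _ _ r - h _ _ x + b _ _ y0).
  by rewrite linearD linearB linearD -ccomm hy0 E3 E1; zfrom hq.
exists (x, y2 - y0).
  by rewrite cone_dE linearB hx hy0 hy2 oppr0; congr pair; rewrite /=; zmod.
exists (- r, v); rewrite cone_dE lE -[RHS]/(p - a _ _ x, q - (h _ _ x + b _ _ (y2 - y0))).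
congr pair; first by rewrite linearN opprK.
by rewrite linearN hv linearB; zmod.
Qed.
End ConeMap.

(** Exactness of Hom out of [W]. On a K-projective resolution of [W] the hypothesis becomes an
    honest null-homotopy, to which [lift_of_null] applies. *)
Lemma half_cov W X Y (f : chmap X Y) (u : dmor W Y) :
  deq (dcomp (dmap (cinj f)) u) (dzero W (cone f)) -> exists v, deq u (dcomp (dmap f) v).
Proof.
have [Q [q [kQ qq]]] := kproj_resolution W.
have [u' hu'] := kproj_roof (dcomp u (dmap q)) kQ.
move=> h; have : deq (dmap (ccomp (cinj f) u')) (dzero Q (cone f)).
  by rewrite deq_map_comp -hu' deq_compA h dzero_l.
move=> /(kproj_faithful0 kQ)/lift_of_null[w /htp_deq hw].
exists (dcomp (dmap w) (dinv qq)); apply: (qiso_epi qq).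
by rewrite hu' hw -!deq_compA deq_inv_map deq_comp_id deq_map_comp.
Qed.

(** Exactness of Hom into [W]. Here [f] itself is replaced by a chain map between resolutions, and
    [cone_map] compares the two cones. *)
Lemma half_con X Y W (f : chmap X Y) (u : dmor Y W) :
  deq (dcomp u (dmap f)) (dzero X W) -> exists v, deq u (dcomp v (dmap (cinj f))).
Proof.
have [QX [qX [kX hX]]] := kproj_resolution X.
have [QY [qY [kY hY]]] := kproj_resolution Y.
have [f' hf'] := kproj_lift (ccomp f qX) kX hY.
have [c [c1 _ c3]] := cone_map (htp_sym hf'); have {}c3 := c3 hX hY.
have [u' hu'] := kproj_roof (dcomp u (dmap qY)) kY.
move=> h; have : deq (dmap (ccomp u' f')) (dzero QX W).
  rewrite deq_map_comp -hu' -deq_compA -deq_map_comp -(htp_deq hf') deq_map_comp deq_compA h.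
  exact: dzero_l.
move=> /(kproj_faithful0 kX)[l hl].
exists (dcomp (dmap (cone_ext hl)) (dinv c3)); apply: (qiso_epi hY).
rewrite -!deq_compA -deq_map_comp -(dmap_ceq c1) deq_map_comp (deq_compA (dinv c3)).
rewrite deq_inv_map deq_id_comp hu' -deq_map_comp; apply: dmap_ceq => n G x.
by rewrite -[RHS]/(l n G 0 + u' n G x) linear0 add0r.
Qed.

Lemma cconep_cinj X Y (f : chmap X Y) :
  deq (dmap (cproj f)) (dcomp (dmap (cconep f)) (dmap (cinj (cinj f)))).
Proof.
rewrite -deq_map_comp; apply: dmap_ceq => n G x.
by rewrite -[RHS]/(0 + cproj f n G x) add0r.
Qed.

Lemma half_con2 X Y W (f : chmap X Y) (u : dmor (cone f) W) :
  deq (dcomp u (dmap (cinj f))) (dzero Y W) -> exists v, deq u (dcomp v (dmap (cproj f))).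
Proof.
move=> /half_con[v hv]; exists (dcomp v (dinv (cconep_qiso f))).
by rewrite cconep_cinj -deq_compA (deq_compA (dinv _)) deq_inv_map deq_id_comp.
Qed.

Lemma half_cov2 W X Y (f : chmap X Y) (u : dmor W (cone f)) :
  deq (dcomp (dmap (cproj f)) u) (dzero W (shift X)) -> exists v, deq u (dcomp (dmap (cinj f)) v).
Proof.
move=> h; apply: half_cov; apply: (qiso_mono (cconep_qiso f)).
by rewrite deq_compA -cconep_cinj h dzero_r.
Qed.

End Triangles.

(** * Functors induced on the derived category *)

Section Functors.
Variables (k : fieldType) (U : finGroupType -> Prop).
Implicit Types (W X Y Z P : cplx k U) (G H K : Uob U).

(** The conditions under which a functor on complexes acts on words and respects [deq]: [fm_qiso]
    sends formal inverses to formal inverses, the other clauses match the remaining relations. *)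
Record efun := EFun {
  fo :> cplx k U -> cplx k U;
  fm : forall X Y, chmap X Y -> chmap (fo X) (fo Y);
  fm_ceq : forall X Y (f g : chmap X Y), ceq f g -> ceq (fm f) (fm g);
  fm_id : forall X, ceq (fm (Defs.cid X)) (Defs.cid (fo X));
  fm_comp : forall X Y Z (g : chmap Y Z) (f : chmap X Y), ceq (fm (ccomp g f)) (ccomp (fm g) (fm f));
  fm_add : forall X Y (f g : chmap X Y), ceq (fm (cadd f g)) (cadd (fm f) (fm g));
  fm_qiso : forall X Y (f : chmap X Y), qiso f -> qiso (fm f) }.

Arguments fm_ceq _ [X Y f g] _ _ _ _.
Arguments fm_id _ _ _ _ _ : clear implicits.
Arguments fm_comp _ [X Y Z] _ _ _ _ _.
Arguments fm_add _ [X Y] _ _ _ _ _.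
Arguments fm_qiso _ [X Y f] _.

Variable F : efun.

(** From additivity: a zero map equals its own double. *)
Lemma fm_zero X Y (f : chmap X Y) : (forall n G x, f n G x = 0) -> forall n G x, fm F f n G x = 0.
Proof.
move=> h n G x; have e : ceq f (cadd f f) by move=> m H y /=; rewrite h addr0.
have /= := etrans (fm_ceq F e n G x) (fm_add F f f n G x).
by rewrite -[LHS]addr0 => /addrI.
Qed.

Fixpoint fD X Y (f : dmor X Y) : dmor (F X) (F Y) :=
  match f in dmor X Y return dmor (F X) (F Y) with
  | dmap X Y f => dmap (fm F f)
  | dinv X Y s hs => dinv (fm_qiso F hs)
  | dcomp X Y Z g f => dcomp (fD g) (fD f)
  | dadd X Y f g => dadd (fD f) (fD g)
  end.

Lemma fD_deq X Y (f g : dmor X Y) : deq f g -> deq (fD f) (fD g).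
Proof.
have idF Z : deq (dmap (fm F (Defs.cid Z))) (did (F Z)) by apply: dmap_ceq; exact: fm_id.
elim=> {X Y f g} /=.
- by move=> *; exact: deq_refl.
- by move=> X Y f g _ h; exact: deq_sym.
- by move=> X Y f g h _ h1 _ h2; exact: deq_trans h1 h2.
- by move=> X Y Z g g' f f' _ h1 _ h2; exact: deq_comp.
- by move=> X Y f f' g g' _ h1 _ h2; exact: deq_add.
- by move=> *; exact: deq_compA.
- by move=> X Y f; rewrite idF; exact: deq_id_comp.
- by move=> X Y f; rewrite idF; exact: deq_comp_id.
- by move=> *; exact: deq_addA.
- by move=> *; exact: deq_addC.
- move=> X Y f; have -> : deq (dmap (fm F (czero X Y))) (dzero (F X) (F Y)).
    by apply: dmap_ceq => n G x; rewrite fm_zero.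
  exact: deq_add0.
- by move=> *; exact: deq_compDl.
- by move=> *; exact: deq_compDr.
- by move=> X Y f g h; apply: dmap_ceq; apply: fm_ceq.
- by move=> X Y Z g f; rewrite -deq_map_comp; apply: dmap_ceq; apply: fm_comp.
- by move=> X Y f g; rewrite -deq_map_add; apply: dmap_ceq; apply: fm_add.
- by move=> X Y s hs; rewrite deq_inv_map -idF.
- by move=> X Y s hs; rewrite deq_map_inv -idF.
Qed.

Lemma fD_zero X Y : deq (fD (dzero X Y)) (dzero (F X) (F Y)).
Proof. by apply: dmap_ceq => n G x; exact: fm_zero. Qed.

Lemma fD_retract X Y : retract X Y -> retract (F X) (F Y).
Proof.
move=> [i [r h]]; exists (fD i), (fD r); rewrite -[dcomp _ _]/(fD (dcomp r i)) (fD_deq h).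
by apply: dmap_ceq; exact: fm_id.
Qed.

End Functors.

Arguments fm_ceq [k U] _ [X Y f g] _ _ _ _.
Arguments fm_id [k U] _ _ _ _ _.
Arguments fm_comp [k U] _ [X Y Z] _ _ _ _ _.
Arguments fm_add [k U] _ [X Y] _ _ _ _ _.
Arguments fm_qiso [k U] _ [X Y f] _.

Section Natural.
Variables (k : fieldType) (U : finGroupType -> Prop).
Implicit Types (W X Y Z P : cplx k U) (G H K : Uob U).

Lemma fD_natural (F F' : efun k U) (t : forall X, chmap (F X) (F' X)) :
  (forall X Y (f : chmap X Y), ceq (ccomp (t Y) (fm F f)) (ccomp (fm F' f) (t X))) ->
  forall X Y (f : dmor X Y), deq (dcomp (dmap (t Y)) (fD F f)) (dcomp (fD F' f) (dmap (t X))).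
Proof.
move=> h X Y; elim=> [{}X {}Y f|{}X {}Y s hs|{}X {}Y W g IHg f IHf|{}X {}Y f IHf g IHg] /=.
- by rewrite -!deq_map_comp; apply: dmap_ceq.
- apply: (qiso_mono (fm_qiso F' hs)).
  rewrite !deq_compA deq_map_inv deq_id_comp -deq_map_comp -(dmap_ceq (h _ _ s)) deq_map_comp.
  by rewrite -deq_compA deq_map_inv deq_comp_id.
- by rewrite deq_compA IHg -!deq_compA IHf.
- by rewrite deq_compDr deq_compDl IHf IHg.
Qed.

Program Definition efun_id : efun k U := @EFun k U id (fun _ _ f => f) _ _ _ _ _.
Solve Obligations with by [].

Lemma fD_efun_id X Y (f : dmor X Y) : deq (fD efun_id f) f.
Proof.
elim: f => [{}X {}Y f|{}X {}Y s hs|{}X {}Y W g IHg f IHf|{}X {}Y f IHf g IHg] /=.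
- exact: deq_refl.
- by apply: (qiso_epi hs); rewrite !deq_inv_map.
- by rewrite IHg IHf.
- by rewrite IHf IHg.
Qed.

Definition efun_comp (F' F : efun k U) : efun k U.
Proof.
exists (fun X => F' (F X)) (fun X Y f => fm F' (fm F f)).
- by move=> X Y f g e; apply/fm_ceq/fm_ceq.
- by move=> X n G x; rewrite (fm_ceq F' (fm_id F X)); exact: fm_id.
- by move=> X Y Z g f n G x; rewrite (fm_ceq F' (fm_comp F g f)); exact: fm_comp.
- by move=> X Y f g n G x; rewrite (fm_ceq F' (fm_add F f g)); exact: fm_add.
- by move=> X Y f q; apply/fm_qiso/fm_qiso.
Defined.

Lemma fD_efun_comp (F' F : efun k U) X Y (f : dmor X Y) : deq (fD (efun_comp F' F) f) (fD F' (fD F f)).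
Proof.
elim: f => [{}X {}Y f|{}X {}Y s hs|{}X {}Y W g IHg f IHf|{}X {}Y f IHf g IHg] /=.
- exact: deq_refl.
- by apply: (qiso_epi (fm_qiso F' (fm_qiso F hs))); rewrite !deq_inv_map.
- by rewrite IHg IHf.
- by rewrite IHf IHg.
Qed.

(** The natural quasi-isomorphism [t] recovers [f] from its image under [F' F]. *)
Lemma fD_faithful (F F' : efun k U) (t : forall X, chmap X (F' (F X))) :
  (forall X Y (f : chmap X Y), ceq (ccomp (t Y) f) (ccomp (fm F' (fm F f)) (t X))) ->
  (forall X, qiso (t X)) ->
  forall X Y (f : dmor X Y), deq (fD F f) (dzero _ _) -> deq f (dzero _ _).
Proof.
move=> h q X Y f e; apply: (qiso_mono (q Y)); rewrite dzero_r.
have := @fD_natural efun_id (efun_comp F' F) t h X Y f; rewrite fD_efun_id => ->.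
rewrite fD_efun_comp (fD_deq F' e) fD_zero; exact: dzero_l.
Qed.

Lemma qiso_cancel X Y Z (g : chmap Y Z) (f : chmap X Y) :
  qiso g -> qiso (ccomp g f) -> qiso f.
Proof.
move=> qg q n G; have [gi _] := qg n G; have [qi qs] := q n G; split=> [z hz [w hw]|y hy].
  by apply: qi => //; exists (g n G w); rewrite -ccomm hw.
have [|x hx [w hw]] := qs (g _ _ y); first by rewrite -ccomm hy linear0.
exists x => //; apply: gi; first by rewrite linearB hy -ccomm hx linear0 subrr.
by exists w; rewrite hw linearB.
Qed.

Lemma bdry_shift X n G (z : X (n + 1 + 1) G) : bdry (X := shift X) (n := n) z <-> bdry (X := X) (n := n + 1) z.
Proof.
by split=> -[w hw]; exists (- w); rewrite linearN -hw ?opprK //= linearN opprK.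
Qed.

Lemma shift_cocycle X n G (z : X (n + 1) G) : cd (shift X) n G z = 0 <-> cd X (n + 1) G z = 0.
Proof. by rewrite /=; split=> [/eqP|->]; rewrite ?oppr0 ?oppr_eq0 // => /eqP. Qed.

Lemma shiftm_qiso X Y (f : chmap X Y) : qiso (shiftm f) <-> qiso f.
Proof.
split=> q; last first.
  move=> n G; have [qi qs] := q (n + 1) G; split=> [z /shift_cocycle hz /bdry_shift h|y /shift_cocycle hy].
    by apply/bdry_shift/qi.
  by have [x hx b] := qs y hy; exists x; [apply/shift_cocycle|apply/bdry_shift].
apply: int_succ_ind => n G; have [qi qs] := q n G; split=> [z hz h|y hy].
  by apply/bdry_shift/qi; [apply/shift_cocycle|apply/bdry_shift].
have [|x hx b] := qs y; first by apply/shift_cocycle.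
by exists x; [apply/shift_cocycle|apply/bdry_shift].
Qed.

Definition efun_shift : efun k U.
Proof.
exists (@shift k U) (@shiftm k U) => //.
- by move=> X Y f g e n G x; exact: e.
- by move=> X Y f q; apply/shiftm_qiso.
Defined.

Definition counit_shift X : chmap (shift (unshift X)) X.
Proof.
exists (fun n => ccast X (Spred n)) => n G x.
rewrite -[cd (shift _) n G x]/(- - ccast X (predK (n + 1)) G (cd X (n + 1 - 1) G x)) opprK.
rewrite (ccast_d (Spred n) (congr1 (+%R^~ 1) (Spred n))) (ccast_trans _ _ (congr1 (+%R^~ 1) (Spred n))) //.
Defined.

Lemma counit_shift_qiso X : qiso (counit_shift X).
Proof.
apply: bij_qiso => [n G x e|n G y].
  by rewrite -(ccastK (Spred n) (esym (Spred n)) x) [ccast X (Spred n) _ _]e linear0.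
by exists (ccast X (esym (Spred n)) G y); exact: ccastK.
Qed.

Lemma counit_shift_nat X Y (f : chmap X Y) :
  ceq (ccomp (counit_shift Y) (shiftm (unshiftm f))) (ccomp f (counit_shift X)).
Proof. by move=> n G x; rewrite -[RHS]/(f n G (ccast X (Spred n) G x)) ccast_map. Qed.

Lemma unshiftm_qiso X Y (f : chmap X Y) : qiso f -> qiso (unshiftm f).
Proof.
move=> q; apply/shiftm_qiso; apply: (qiso_cancel (counit_shift_qiso Y)).
apply: (qiso_ceq (f := ccomp f (counit_shift X))) => [n G x|]; first by rewrite counit_shift_nat.
exact: qiso_comp (counit_shift_qiso X) q.
Qed.

Definition efun_unshift : efun k U.
Proof.
exists (@unshift k U) (@unshiftm k U) => //.
- by move=> X Y f g e n G x; exact: e.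
- by move=> X Y f q; exact: unshiftm_qiso.
Defined.

Definition unit_shift X : chmap X (unshift (shift X)) := adj (Defs.cid (shift X)).

Lemma unit_shift_qiso X : qiso (unit_shift X).
Proof.
apply: bij_qiso => [n G x e|n G y].
  by rewrite -(ccastK (predS n) (esym (predS n)) x) [ccast X (predS n) _ _]e linear0.
by exists (ccast X (esym (predS n)) G y); exact: (ccastK (X := X) (esym (predS n)) (predS n) y).
Qed.

Lemma unit_shift_nat X Y (f : chmap X Y) :
  ceq (ccomp (unit_shift Y) f) (ccomp (unshiftm (shiftm f)) (unit_shift X)).
Proof. by move=> n G x; rewrite -[LHS]/(ccast Y (predS n) G (f n G x)) -ccast_map. Qed.

Lemma shift_faithful X Y (f : dmor X Y) : deq (fD efun_shift f) (dzero _ _) -> deq f (dzero _ _).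
Proof. exact: (@fD_faithful efun_shift efun_unshift unit_shift unit_shift_nat unit_shift_qiso). Qed.

Lemma unshift_faithful X Y (f : dmor X Y) : deq (fD efun_unshift f) (dzero _ _) -> deq f (dzero _ _).
Proof.
move=> e; have := @fD_natural (efun_comp efun_shift efun_unshift) efun_id counit_shift counit_shift_nat X Y f.
rewrite fD_efun_id fD_efun_comp (fD_deq efun_shift e) fD_zero dzero_r => h.
by apply: (qiso_epi (counit_shift_qiso X)); rewrite -h dzero_l.
Qed.

End Natural.

(** * Coproducts and compactness *)

Section Coproducts.
Variables (k : fieldType) (U : finGroupType -> Prop).
Implicit Types (W X Y Z P : cplx k U) (G H K : Uob U).

(** The summands are replaced by K-projective resolutions, whose sum is K-projective: morphisms out
    become chain maps, and the homotopies that give uniqueness on the summands assemble to one on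
    the sum. *)
Lemma dsumc_coprod (I : eqType) (Y : I -> cplx k U) : is_coprod (fun i => dmap (dinc Y i)).
Proof.
have /dep_choice[Q /dep_choice[q hq]] := fun i => kproj_resolution (Y i).
have kQ i : kproj (Q i) by have [] := hq i.
have qq i : qiso (q i) by have [] := hq i.
have qs := dmapc_qiso qq.
have inc i : deq (dcomp (dmap (dmapc q)) (dmap (dinc Q i))) (dcomp (dmap (dinc Y i)) (dmap (q i))).
  by rewrite -!deq_map_comp; apply: dmap_ceq => n G x; exact: dmapcE.
move=> Z g; have /dep_choice[g' hg'] := fun i => kproj_roof (dcomp (g i) (dmap (q i))) (kQ i).
exists (dcomp (dmap (dliftc g')) (dinv qs)); split=> [i|h' hh'].
  apply: (qiso_epi (qq i)); rewrite -!deq_compA -inc (deq_compA (dinv qs)) deq_inv_map deq_id_comp hg'.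
  by rewrite -deq_map_comp; apply: dmap_ceq => n G x; exact: dliftcE.
have kS : kproj (dsumc Q) by exact: kproj_dsumc.
apply: (qiso_epi qs); rewrite -deq_compA deq_inv_map deq_comp_id.
have [w hw] := kproj_roof (dcomp h' (dmap (dmapc q))) kS.
rewrite hw; apply: htp_deq.
have /dep_choice[l hl] : forall i, nullh (ccomp (csub w (dliftc g')) (dinc Q i)).
  move=> i; apply: nullh_ext (kproj_faithful (f := ccomp w (dinc Q i)) (g := g' i) (kQ i) _) => [n G x /=|].
    by rewrite -[X in _ = _ - X]/(dliftc g' n G (dinc Q i n G x)) dliftcE.
  by rewrite deq_map_comp -hw -deq_compA inc deq_compA hh' hg'.
exists (fun n => dlift (l^~ n)) => n G x.
apply: (drep_ext (a := csub w (dliftc g') (n + 1)) (b := radd (rcomp (cd Z n) (dlift (l^~ n)))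
   (rcomp (dlift (l^~ (n + 1))) (dd Q (n + 1))))) => i K y.
rewrite -[RHS]/(cd Z n K (dlift _ K _) + dlift _ K (dd _ _ _ _)) ddE !dliftE; exact: hl.
Qed.

(* Compactness tested on the explicit direct sums [dsumc] only: a map into one of
   them is killed by removing finitely many summands. *)
Definition compact' X := forall (I : eqType) (Y : I -> cplx k U) (h : dmor X (dsumc Y)),
  exists J, deq (dcomp (dmap (dcut Y J)) h) (dzero X (dsumc Y)).

Lemma dsum_comp (I : eqType) (Y : I -> cplx k U) (S T X : cplx k U) (iota : forall i, dmor (Y i) S)
    (a : dmor S T) (J : seq I) (f : forall i, dmor X (Y i)) :
  deq (dcomp a (dsum iota J f)) (dsum (fun i => dcomp a (iota i)) J f).
Proof.
elim: J => [|i J IH] /=; first exact: dzero_r.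
by rewrite deq_compDr IH deq_compA.
Qed.

Lemma dsum_zero (I : eqType) (Y : I -> cplx k U) (S X : cplx k U) (iota : forall i, dmor (Y i) S)
    (J : seq I) (f : forall i, dmor X (Y i)) :
  (forall i, i \in J -> deq (dcomp (iota i) (f i)) (dzero X S)) -> deq (dsum iota J f) (dzero X S).
Proof.
elim: J => [|i J IH] //= h; rewrite h ?mem_head // IH ?deq_add0 // => j hj.
by apply: h; rewrite inE hj orbT.
Qed.

Lemma dcut_dsum (I : eqType) (Y : I -> cplx k U) X (h : dmor X (dsumc Y)) (J : seq I) : uniq J ->
  deq h (dadd (dsum (fun i => dmap (dinc Y i)) J (fun i => dcomp (dmap (dproj Y i)) h)) (dcomp (dmap (dcut Y J)) h)).
Proof.
elim: J => [|i J IH] /=.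
  by rewrite deq_add0 (dmap_ceq (@dcut_nil _ _ _ Y)) => _; rewrite deq_id_comp.
move=> /andP[iJ /IH e]; rewrite {1}e.
have -> : deq (dmap (dcut Y J)) (dadd (dcomp (dmap (dinc Y i)) (dmap (dproj Y i))) (dmap (dcut Y (i :: J)))).
  by rewrite -deq_map_comp -deq_map_add; apply: dmap_ceq => n G x; exact: dcut_cons.
rewrite deq_compDl !deq_addA -deq_compA; apply: deq_add => //.
exact: deq_addC.
Qed.

(** An arbitrary coproduct [S] is compared with the explicit sum by the two universal properties.
    For the injectivity half, [p] isolates a component: it is the identity on one summand and zero
    on the others. *)
Lemma compact_of_compact' X : compact' X -> compact X.
Proof.
move=> cX I Y S iota cop; split=> [h|J f uJ e i iJ].
  have [a [ha _]] := cop _ (fun i => dmap (dinc Y i)).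
  have [b [hb _]] := dsumc_coprod iota.
  have [J hJ] := cX I Y (dcomp a h).
  have [id1 [_ uid]] := cop S iota.
  have ba : deq (dcomp b a) (did S).
    rewrite (uid (did S)); last by move=> i; exact: deq_id_comp.
    by apply: uid => i; rewrite -deq_compA ha hb.
  exists (undup J), (fun i => dcomp (dmap (dproj Y i)) (dcomp a h)); split; first exact: undup_uniq.
  have cutJ : deq (dcomp (dmap (dcut Y (undup J))) (dcomp a h)) (dzero _ _).
    have s : {subset J <= undup J} by move=> i; rewrite mem_undup.
    by rewrite -(dmap_ceq (dcut_sub s)) deq_map_comp -deq_compA hJ dzero_r.
  rewrite -{1}(deq_id_comp h) -ba -deq_compA {1}(dcut_dsum (dcomp a h) (undup_uniq J)) cutJ deq_add0r dsum_comp.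
  elim: (undup J) => //= i L IH; by rewrite IH hb.
have [p [hp _]] := cop _ (fun j => match @eqP _ j i with
    | ReflectT e => match e in _ = l return dmor (Y j) (Y l) with erefl => did (Y j) end
    | ReflectF _ => dzero (Y j) (Y i) end).
have : deq (dcomp p (dsum iota J f)) (dzero _ _) by rewrite e dzero_r.
rewrite dsum_comp; elim: J iJ uJ {e} => //= j J IH; rewrite inE.
have [e|ne] /= := eqVneq i j.
  destruct e => _ /andP[iJ uJ]; rewrite (dsum_zero (J := J)) => [|l lJ].
    by rewrite deq_add0r hp; case: eqP => // e0; rewrite (eq_axiomK e0) deq_id_comp.
  by rewrite hp; case: eqP => [el|_]; [rewrite -el lJ in iJ|rewrite dzero_l].
move=> iJ /andP[_ uJ] h; apply: IH => //; rewrite -[X in deq _ X]h.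
rewrite hp; case: eqP => [e0|_]; first by rewrite e0 eqxx in ne.
by rewrite dzero_l deq_add0.
Qed.

Lemma compact'_of_compact X : compact X -> compact' X.
Proof.
move=> cX I Y h; have [/(_ h)[J [f [uJ e]]] _] := cX I Y _ _ (@dsumc_coprod I Y).
exists J; rewrite e dsum_comp; apply: dsum_zero => i iJ.
by rewrite dmap_comp0 ?dzero_l // => n G x; rewrite dcutE iJ.
Qed.

End Coproducts.

(** * Thick subcategories and perfect complexes *)

Section Sum.
Variables (k : fieldType) (U : finGroupType -> Prop).
Variables X Y : cplx k U.

Lemma csum_lin n G :
  linear (fun z : X n G * Y n G => (cd X n G z.1, cd Y n G z.2) : X (n + 1) G * Y (n + 1) G).
Proof. by move=> a z t; rewrite /= !linearP. Qed.

Lemma csum_nat n G H (u : {multiplicative Ugrp G -> Ugrp H}) (hu : surjective u) x :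
  mklin (@csum_lin n G) (res (rsum (X n) (Y n)) hu x)
  = res (rsum (X (n + 1)) (Y (n + 1))) hu (mklin (@csum_lin n H) x).
Proof. by congr pair; rewrite /= rnat. Qed.

Definition csum_d n : rhom (rsum (X n) (Y n)) (rsum (X (n + 1)) (Y (n + 1))) :=
  @RHom k U (rsum (X n) (Y n)) (rsum (X (n + 1)) (Y (n + 1))) (fun G => mklin (@csum_lin n G)) (@csum_nat n).

Lemma csum_dd n G x : csum_d (n + 1) G (csum_d n G x) = 0.
Proof. by congr pair; rewrite /= cdd. Qed.

Definition csum : cplx k U := @Cplx k U (fun n => rsum (X n) (Y n)) csum_d csum_dd.

Lemma csum_in1_lin n G : linear (fun x : X n G => (x, 0) : csum n G).
Proof. by move=> a x y; congr pair; rewrite /= ?scaler0 ?addr0. Qed.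
Lemma csum_in1_nat n G H (u : {multiplicative Ugrp G -> Ugrp H}) (hu : surjective u) (x : X n H) :
  (res (X n) hu x, 0) = res (csum n) hu (x, 0).
Proof. by congr pair; rewrite /= ?linear0. Qed.
Lemma csum_in1_comm n G (x : X n G) : (cd X n G x, 0) = cd csum n G (x, 0).
Proof. by congr pair; rewrite /= ?linear0. Qed.
Definition csum_in1 : chmap X csum :=
  @ChMap k U X csum (fun n => @mkrhom k U (X n) (csum n) _ (@csum_in1_lin n) (@csum_in1_nat n)) csum_in1_comm.

Lemma csum_in2_lin n G : linear (fun x : Y n G => (0, x) : csum n G).
Proof. by move=> a x y; congr pair; rewrite /= ?scaler0 ?addr0. Qed.
Lemma csum_in2_nat n G H (u : {multiplicative Ugrp G -> Ugrp H}) (hu : surjective u) (x : Y n H) :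
  (0, res (Y n) hu x) = res (csum n) hu (0, x).
Proof. by congr pair; rewrite /= ?linear0. Qed.
Lemma csum_in2_comm n G (x : Y n G) : (0, cd Y n G x) = cd csum n G (0, x).
Proof. by congr pair; rewrite /= ?linear0. Qed.
Definition csum_in2 : chmap Y csum :=
  @ChMap k U Y csum (fun n => @mkrhom k U (Y n) (csum n) _ (@csum_in2_lin n) (@csum_in2_nat n)) csum_in2_comm.

Definition csum_pr1 : chmap csum X :=
  @ChMap k U csum X (fun n => @mkrhom k U (csum n) (X n) (fun G z => z.1)
    (fun G a x y => erefl) (fun _ _ _ _ _ => erefl)) (fun _ _ _ => erefl).
Definition csum_pr2 : chmap csum Y :=
  @ChMap k U csum Y (fun n => @mkrhom k U (csum n) (Y n) (fun G z => z.2)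
    (fun G a x y => erefl) (fun _ _ _ _ _ => erefl)) (fun _ _ _ => erefl).

Lemma csum_cone_null : nullvia (ccomp csum_pr2 csum_in1) (fun n => rzero (X (n + 1)) (Y n)).
Proof. by move=> n G x; rewrite linear0 addr0. Qed.

(** The inclusion of [X] has cone [Y]: finite sums are extensions, so closure under triangles covers
    them. *)
Lemma csum_cone_qiso : qiso (cone_ext csum_cone_null).
Proof.
move=> n G; split=> [[x [x' y]]|y hy].
  move=> /cone_cocycle[hx e] [v]; rewrite cone_extE => hv.
  have e1 := congr1 fst e; rewrite /= in e1.
  exists (x', (0, v)); rewrite cone_dE; congr (_, (_, _)); rewrite /=.
  - by zfrom e1.
  - by rewrite linear0 addr0.
  - by rewrite hv /= !add0r.
exists (0, (0, y)).
  by rewrite cone_dE !linear0 add0r; congr (_, (_, _)); rewrite /= ?linear0.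
by exists 0; rewrite linear0 cone_extE /= add0r subrr.
Qed.

End Sum.

Section Closed.
Variables (k : fieldType) (U : finGroupType -> Prop).
Implicit Types (W X Y Z P : cplx k U) (G H K : Uob U).

(** Thickness freed from compactness and stated for cones of chain maps, a form that also fits
    [compact'], [perf], [ghostnil] and acyclicity at a group. Shifts and middle terms are
    derived. *)
Record tclosed (P : cplx k U -> Prop) : Prop := {
  cl_cone : forall X Y (f : chmap X Y), P X -> P Y -> P (cone f);
  cl_fib : forall X Y (f : chmap X Y), P Y -> P (cone f) -> P X;
  cl_retract : forall X Y, retract X Y -> P Y -> P X }.

Variables (P : cplx k U -> Prop) (clP : tclosed P).

Lemma cl_diso X Y : diso X Y -> P X -> P Y.
Proof. by move=> /diso_sym/diso_retract; exact: cl_retract. Qed.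

Lemma cl_qiso X Y (f : chmap X Y) : qiso f -> P X <-> P Y.
Proof. by move=> /qiso_diso d; split; apply: cl_diso => //; exact: diso_sym. Qed.

Lemma acyclic_diso X Y : acyclic X -> acyclic Y -> diso X Y.
Proof. by move=> aX aY; apply: (@qiso_diso k U X Y (czero X Y)); exact: acyclic_qiso. Qed.

Lemma cl_acyclic X Z : P X -> acyclic Z -> P Z.
Proof.
move=> PX aZ; apply: cl_diso (acyclic_diso (@cone_id_acyclic k U X) aZ) _.
exact: cl_cone.
Qed.

Lemma cproj_qiso X Y (f : chmap X Y) : acyclic Y -> qiso (cproj f).
Proof.
move=> aY n G; split=> [[x y]|x /shift_cocycle hx].
  move=> /cone_cocycle[hx e] [w hw]; rewrite /= /lin_fun /= in hw.
  have hw' : cd X (n + 1) G w = - x by rewrite -hw opprK.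
  have [|v hv] := aY G n (y - f _ _ w).
    by rewrite linearB -ccomm hw' linearN; zfrom e.
  exists (w, v); rewrite cone_dE hw' hv opprK; congr pair; rewrite /=; zmod.
have [|v hv] := aY G (n + 1) (f _ _ x); first by rewrite -ccomm hx linear0.
exists (x, - v); last by exists 0; rewrite linear0 /= /lin_fun subrr.
by rewrite cone_dE hx linearN hv oppr0 subrr.
Qed.

Definition zcplx : cplx k U :=
  ffree k (fun v : void => of_void int v) (fun v => of_void (Uob U) v) (fun=> false).

Lemma zcplx_acyclic : acyclic zcplx.
Proof.
move=> G n z _; exists 0; rewrite linear0; symmetry.
by apply: (frep_ext (a := rid _) (b := rzero _ _)) => -[].
Qed.

(** The cone of a map from [X] to a zero complex is the shift of [X]: closure under cones gives one
    direction, closure under fibres the other. *)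
Lemma cl_shift X : P X <-> P (shift X).
Proof.
have q := cproj_qiso (czero X zcplx) zcplx_acyclic.
split=> h.
  by apply/(cl_qiso q)/(cl_cone clP) => //; exact: cl_acyclic h zcplx_acyclic.
by apply: (cl_fib clP (f := czero X zcplx)); [exact: cl_acyclic h zcplx_acyclic|apply/(cl_qiso q)].
Qed.

Lemma cl_mid X Y (f : chmap X Y) : P X -> P (cone f) -> P Y.
Proof.
move=> hX hc; apply: (cl_fib clP (f := cinj f)) => //.
by apply/(cl_qiso (cconep_qiso f)); rewrite -cl_shift.
Qed.

Lemma cl_unshift X : P X -> P (unshift X).
Proof. by move=> h; apply/cl_shift/(cl_qiso (counit_shift_qiso X)). Qed.

Lemma cl_csum X Y : P X -> P Y -> P (csum X Y).
Proof. by move=> hX hY; apply: cl_mid hX _; apply/(cl_qiso (@csum_cone_qiso k U X Y)). Qed.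

End Closed.

Section Thick.
Variables (k : fieldType) (U : finGroupType -> Prop).
Implicit Types (W X Y Z : cplx k U) (G H K : Uob U).

Lemma cone_triangle X Y (f : chmap X Y) : triangle X Y (cone f).
Proof. by exists X, Y, f; split; exact: diso_refl. Qed.

Lemma thick_tclosed (P : cplx k U -> Prop) : thick P -> tclosed P.
Proof.
move=> t; split=> [X Y f|X Y f|]; last exact: thick_retract.
- exact: (thick_cone t (cone_triangle f)).
- exact: (thick_fiber t (cone_triangle f)).
Qed.

Lemma tclosed_thick (P : cplx k U -> Prop) : tclosed P -> (forall X, P X -> compact X) -> (exists X, P X) -> thick P.
Proof.
move=> c hc hn; split=> //.
- by move=> X; exact: cl_shift.
- move=> X Y Z [X' [Y' [f [dX dY dZ]]]] hX hY; apply: (cl_diso c (diso_sym dZ)).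
  by apply: cl_cone => //; [exact: cl_diso dX hX|exact: cl_diso dY hY].
- move=> X Y Z [X' [Y' [f [dX dY dZ]]]] hY hZ; apply: (cl_diso c (diso_sym dX)).
  by apply: (cl_fib c (f := f)); [exact: cl_diso dY hY|exact: cl_diso dZ hZ].
- move=> X Y Z [X' [Y' [f [dX dY dZ]]]] hX hZ; apply: (cl_diso c (diso_sym dY)).
  by apply: (cl_mid c (f := f)); [exact: cl_diso dX hX|exact: cl_diso dZ hZ].
- by move=> X Y; exact: cl_retract.
Qed.

(** Perfect complexes: the thick closure of the representables, inductive so that properties closed
    under triangles need checking on free complexes only. *)
Inductive perf : cplx k U -> Prop :=
| perf_free (I : finType) (deg : I -> int) (grp : I -> Uob U) : perf (ffree k deg grp (fun=> false))
| perf_cone X Y (f : chmap X Y) : perf X -> perf Y -> perf (cone f)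
| perf_fib X Y (f : chmap X Y) : perf Y -> perf (cone f) -> perf X
| perf_retract X Y : retract X Y -> perf Y -> perf X.

Lemma perf_tclosed : tclosed perf.
Proof. by split; [exact: perf_cone|exact: perf_fib|exact: perf_retract]. Qed.

Definition sumcont (F : efun k U) := forall (I : eqType) (Y : I -> cplx k U),
  qiso (dliftc (fun i => fm F (dinc Y i))).

Section Continuous.
Variables (F : efun k U) (cF : sumcont F) (I : eqType) (Y : I -> cplx k U).

Lemma sumcont_cut J : ceq (ccomp (fm F (dcut Y J)) (dliftc (fun i => fm F (dinc Y i))))
  (ccomp (dliftc (fun i => fm F (dinc Y i))) (dcut (fun i => F (Y i)) J)).
Proof.
apply: dsumc_ext => i n G x.
set t := dliftc _.
rewrite -[LHS]/(fm F (dcut Y J) n G (t n G (dinc _ i n G x))) -[RHS]/(t n G (dcut _ J n G (dinc _ i n G x))).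
rewrite dcutE dliftcE -[LHS]/(ccomp (fm F (dcut Y J)) (fm F (dinc Y i)) n G x) -fm_comp.
case: ifP => iJ; last first.
  by rewrite dliftcE; apply: fm_ceq => m H y; rewrite -[LHS]/(dcut Y J m H (dinc Y i m H y)) dcutE iJ.
rewrite linear0; apply: fm_zero => m H y.
by rewrite -[LHS]/(dcut Y J m H (dinc Y i m H y)) dcutE iJ.
Qed.

Lemma compact'_cont X (h : dmor X (F (dsumc Y))) : compact' X ->
  exists J, deq (dcomp (fD F (dmap (dcut Y J))) h) (dzero _ _).
Proof.
move=> cX; have [J hJ] := cX I _ (dcomp (dinv (cF Y)) h); exists J.
rewrite -(deq_id_comp h) -(deq_map_inv (cF Y)) /= -deq_compA (deq_compA _ (dmap _)) -deq_map_comp.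
by rewrite (dmap_ceq (sumcont_cut J)) deq_map_comp -deq_compA hJ dzero_r.
Qed.
End Continuous.

Lemma compact'_reflect (F : efun k U) X : sumcont F ->
  (forall X Y (f : dmor X Y), deq (fD F f) (dzero _ _) -> deq f (dzero _ _)) ->
  compact' (F X) -> compact' X.
Proof.
move=> cF faith cX I Y h; have [J hJ] := compact'_cont cF (fD F h) cX.
by exists J; apply: faith.
Qed.

Lemma compact'_retract X Y : retract X Y -> compact' Y -> compact' X.
Proof.
move=> [i [r e]] cY I Z h; have [J hJ] := cY I Z (dcomp h r); exists J.
by rewrite -(deq_comp_id h) -e !deq_compA -(deq_compA _ h r) hJ dzero_l.
Qed.

Lemma sumcont_shift : sumcont (@efun_shift k U).
Proof.
move=> I Y; set t := dliftc _.
have e n G (x : dsumc (fun i => shift (Y i)) n G) : t n G x = (x : shift (dsumc Y) n G).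
  move: x; apply: (plin_ext (f := t n G) (g := idfun)) => -[i x].
  by rewrite [LHS](dliftcE (fun i => fm (efun_shift k U) (dinc Y i)) x).
apply: bij_qiso => [n G x|n G y]; first by rewrite e.
by exists y; rewrite e.
Qed.

Lemma sumcont_unshift : sumcont (@efun_unshift k U).
Proof.
move=> I Y; set t := dliftc _.
have e n G (x : dsumc (fun i => unshift (Y i)) n G) : t n G x = (x : unshift (dsumc Y) n G).
  move: x; apply: (plin_ext (f := t n G) (g := idfun)) => -[i x].
  by rewrite [LHS](dliftcE (fun i => fm (efun_unshift k U) (dinc Y i)) x).
apply: bij_qiso => [n G x|n G y]; first by rewrite e.
by exists y; rewrite e.
Qed.

Lemma compact'_diso X Y : diso X Y -> compact' X -> compact' Y.
Proof. by move=> /diso_sym/diso_retract; exact: compact'_retract. Qed.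

Lemma compact'_shift X : compact' (shift X) <-> compact' X.
Proof.
split; first exact: compact'_reflect sumcont_shift (@shift_faithful k U).
move=> cX; apply: compact'_reflect sumcont_unshift (@unshift_faithful k U) _.
exact: compact'_diso (qiso_diso (unit_shift_qiso X)) cX.
Qed.

(** A map out of a cone is cut first on [Y]; what remains factors through the shift of [X] and is
    cut there. Fibres reduce to cones by rotation, using invariance under shifts. *)
Lemma compact'_tclosed : tclosed (@compact' k U).
Proof.
have cone' X Y (f : chmap X Y) : compact' (shift X) -> compact' Y -> compact' (cone f).
  move=> cX cY I Z h; have [J hJ] := cY I Z (dcomp h (dmap (cinj f))).
  rewrite deq_compA in hJ; have [v hv] := half_con2 hJ.
  have [J' hJ'] := cX I Z v; exists (J ++ J').
  have s : {subset J <= J ++ J'} by move=> i; rewrite mem_cat => ->.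
  have s' : {subset J' <= J ++ J'} by move=> i; rewrite mem_cat orbC => ->.
  rewrite -(dmap_ceq (dcut_sub s)) deq_map_comp -deq_compA hv.
  have -> : deq (dmap (dcut Z (J ++ J'))) (dcomp (dmap (dcut Z (J ++ J'))) (dmap (dcut Z J'))).
    by rewrite -deq_map_comp (dmap_ceq (dcut_sub s')).
  by rewrite -deq_compA (deq_compA _ v) hJ' dzero_l dzero_r.
split; last by move=> X Y; exact: compact'_retract.
- by move=> X Y f cX cY; apply: cone' => //; apply/compact'_shift.
- move=> X Y f cY cC; apply/compact'_shift.
  apply: compact'_diso (qiso_diso (cconep_qiso f)) _.
  by apply: cone' => //; apply/compact'_shift.
Qed.

(** By Yoneda a map out is given by finitely many elements, each of finite support. *)
Lemma compact'_free (I : finType) (deg : I -> int) (grp : I -> Uob U) :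
  compact' (ffree k deg grp (fun=> false)).
Proof.
move=> L Y h; have [h' eh] := kproj_roof h (@kproj_free k U I deg grp).
have [J hJ] := dcut_finite_fun (fun i => h' (deg i) (grp i) (fg k (fun=> false) erefl (sid (grp i)))).
exists J; rewrite eh -deq_map_comp; apply: dmap_ceq => n.
apply: (frep_ext (a := ccomp (dcut Y J) h' n) (b := rzero _ _)) => i e.
by destruct e; exact: hJ.
Qed.

Lemma perf_compact' X : perf X -> compact' X.
Proof.
have c := compact'_tclosed.
elim=> {X} [I deg grp|X Y f _ hX _ hY|X Y f _ hY _ hC|X Y r _ hY].
- exact: compact'_free.
- exact: (cl_cone c f hX hY).
- exact: (cl_fib c hY hC).
- exact: (cl_retract c r hY).
Qed.

End Thick.

Section Fiber.
Variables (k : fieldType) (U : finGroupType -> Prop).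
Implicit Types (W X Y Z A B : cplx k U) (G H K : Uob U).

Lemma deq_htp0 X Y (f g : chmap X Y) : nullh (cadd f g) -> deq (dmap f) (dneg (dmap g)).
Proof.
move=> h; rewrite /dneg -deq_map_comp; apply: htp_deq.
by apply: nullh_ext h => n G x /=; rewrite opprK.
Qed.

Lemma shiftm_cproj0 X Y (f : chmap X Y) :
  deq (dcomp (dmap (shiftm f)) (dmap (cproj f))) (dzero _ _).
Proof.
rewrite -deq_map_comp; apply: nullh_dzero.
exists (fun n => @RHom k U (cone f (n + 1)) (shift Y n) (fun G => snd) (fun _ _ _ _ _ => erefl)) => n G [x y].
by rewrite /=; zmod.
Qed.

Lemma cconep_shiftm X Y (f : chmap X Y) :
  deq (dcomp (dmap (shiftm f)) (dmap (cconep f))) (dneg (dmap (cproj (cinj f)))).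
Proof.
rewrite -deq_map_comp; apply: deq_htp0.
exists (fun n => @RHom k U (cone (cinj f) (n + 1)) (shift Y n) (fun G => snd \o snd) (fun _ _ _ _ _ => erefl)).
move=> n G [y [x y']]; rewrite /= /lin_fun /= add0r; zmod.
Qed.

Lemma dneg0 X Y (f : dmor X Y) : deq (dneg f) (dzero X Y) -> deq f (dzero X Y).
Proof. by move=> h; rewrite -(deq_add0r f) -h deq_addN h. Qed.

Lemma dneg_comp X Y Z (f : dmor Y Z) (g : dmor X Y) : deq (dcomp (dneg f) g) (dneg (dcomp f g)).
Proof. by rewrite /dneg deq_compA. Qed.

Lemma deq_neg_unique X Y (a b : dmor X Y) : deq (dadd a b) (dzero X Y) -> deq a (dneg b).
Proof.
by move=> h; rewrite -(deq_add0r a) -(deq_addN b) deq_addA h deq_add0.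
Qed.

Lemma dcomp_neg X Y Z (f : dmor Y Z) (g : dmor X Y) : deq (dcomp f (dneg g)) (dneg (dcomp f g)).
Proof. by apply: deq_neg_unique; rewrite -deq_compDr deq_addC deq_addN dzero_r. Qed.

Lemma csum_factor X Y W Z (u : dmor X Z) (v : dmor Y Z) (a : dmor W X) (b : dmor W Y) :
  exists (c : dmor (csum X Y) Z) (d : dmor W (csum X Y)), deq (dcomp c d) (dadd (dcomp u a) (dcomp v b)).
Proof.
exists (dadd (dcomp u (dmap (csum_pr1 X Y))) (dcomp v (dmap (csum_pr2 X Y)))).
exists (dadd (dcomp (dmap (csum_in1 X Y)) a) (dcomp (dmap (csum_in2 X Y)) b)).
have e11 : deq (dcomp (dmap (csum_pr1 X Y)) (dmap (csum_in1 X Y))) (did X).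
  by rewrite -deq_map_comp; apply: dmap_ceq.
have e22 : deq (dcomp (dmap (csum_pr2 X Y)) (dmap (csum_in2 X Y))) (did Y).
  by rewrite -deq_map_comp; apply: dmap_ceq.
have e12 : deq (dcomp (dmap (csum_pr1 X Y)) (dmap (csum_in2 X Y))) (dzero Y X).
  exact: dmap_comp0.
have e21 : deq (dcomp (dmap (csum_pr2 X Y)) (dmap (csum_in1 X Y))) (dzero X Y).
  exact: dmap_comp0.
rewrite !deq_compDl !deq_compDr -!deq_compA (deq_compA _ _ a) (deq_compA _ _ b) e11 e12.
rewrite (deq_compA _ (dmap (csum_in1 X Y)) a) (deq_compA _ (dmap (csum_in2 X Y)) b) e21 e22.
by rewrite !dzero_l !dzero_r !deq_id_comp deq_add0r deq_add0.
Qed.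

Lemma half_cov3 W X Y (f : chmap X Y) (u : dmor W (shift X)) :
  deq (dcomp (dmap (shiftm f)) u) (dzero _ _) -> exists v, deq u (dcomp (dmap (cproj f)) v).
Proof.
move=> h; pose u1 := dcomp (dinv (cconep_qiso f)) u.
have e1 : deq u (dcomp (dmap (cconep f)) u1) by rewrite /u1 deq_compA deq_map_inv deq_id_comp.
have [|v hv] := @half_cov2 k U W _ _ (cinj f) u1.
  by apply: dneg0; rewrite -dneg_comp -cconep_shiftm -deq_compA -e1.
by exists v; rewrite e1 hv deq_compA -cconep_cinj.
Qed.

Lemma desuspend R A (g : chmap R (shift A)) :
  exists w : chmap (unshift R) A, ceq (shiftm w) (ccomp g (counit_shift R)).
Proof.
have gc a b (e : a = b) (e' : a + 1 = b + 1) G x :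
    ccast A e' G (g a G x) = g b G (ccast R e G x).
  by destruct e; rewrite !ccast_id.
pose w n : rhom (unshift R n) (A n) := rcomp (ccast A (esym (predS n))) (g (n - 1)).
have wE n G x : w (n + 1) G x = g n G (ccast R (Spred n) G x).
  by rewrite /w -(gc _ _ _ (esym (predS (n + 1)))).
have wc n G x : w (n + 1) G (cd (unshift R) n G x) = cd A n G (w n G x).
  rewrite wE -[cd (unshift R) n G x]/(- ccast R (predK n) G (cd R (n - 1) G x)) !linearN.
  rewrite (ccast_trans _ _ (esym (predS n))) -(gc _ _ _ (congr1 (+%R^~ 1) (esym (predS n)))) ccomm linearN opprK.
  by rewrite /w /= (ccast_d _ (congr1 (+%R^~ 1) (esym (predS n)))).
exists (ChMap wc) => n G x; exact: wE.
Qed.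

(** On a K-projective resolution of [B] the word [g] becomes a chain map; desuspending it presents
    the fibre as a cone of objects of [P]. *)
Lemma dfiber (P : cplx k U -> Prop) B A (g : dmor B (shift A)) : tclosed P -> P B -> P A ->
  exists (F : cplx k U) (phi : dmor F B), [/\ P F, deq (dcomp g phi) (dzero _ _) &
    forall W (u : dmor W B), deq (dcomp g u) (dzero _ _) -> exists v, deq u (dcomp phi v)].
Proof.
move=> cP PB PA; have [R [r [kR qr]]] := kproj_resolution B.
have [g' hg'] := kproj_roof (dcomp g (dmap r)) kR.
have [w hw] := desuspend g'.
have cu := counit_shift_qiso R.
have hw' : deq (dmap (shiftm w)) (dcomp (dcomp g (dmap r)) (dmap (counit_shift R))).
  by rewrite (dmap_ceq hw) deq_map_comp hg'.
exists (cone w), (dcomp (dmap r) (dcomp (dmap (counit_shift R)) (dmap (cproj w)))); split.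
- by apply: (cl_cone cP) => //; apply: (cl_unshift cP); apply/(cl_qiso cP qr).
- by rewrite !deq_compA -hw' shiftm_cproj0.
move=> W u hu; pose u1 := dcomp (dinv cu) (dcomp (dinv qr) u).
have e1 : deq u (dcomp (dmap r) (dcomp (dmap (counit_shift R)) u1)).
  by rewrite /u1 (deq_compA _ (dinv cu)) deq_map_inv deq_id_comp deq_compA deq_map_inv deq_id_comp.
have [|v hv] := @half_cov3 W _ _ w u1; first by rewrite hw' -!deq_compA -e1.
by exists v; rewrite {1}e1 hv !deq_compA.
Qed.

End Fiber.

(** * Ghost towers; compact objects are perfect *)

Section Towers.
Variables (k : fieldType) (U : finGroupType -> Prop).
Implicit Types (W X Y Z A B : cplx k U) (G H K : Uob U).

(* A triangle [A -> X -> X' -> A[1]], reduced to its exactness properties. *)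
Record etri A X X' (a : dmor A X) (s : dmor X X') (d : dmor X' (shift A)) : Prop := {
  etri0 : deq (dcomp d s) (dzero _ _);
  etri1 : forall W (u : dmor W X), deq (dcomp s u) (dzero _ _) -> exists v, deq u (dcomp a v);
  etri2 : forall W (u : dmor W X'), deq (dcomp d u) (dzero _ _) -> exists v, deq u (dcomp s v) }.

Lemma etri_cone A X (a : chmap A X) : etri (dmap a) (dmap (cinj a)) (dmap (cproj a)).
Proof.
split; first exact: cproj_cinj.
- by move=> W u; exact: half_cov.
- by move=> W u; exact: half_cov2.
Qed.

Lemma etri_iso A X X' Y Y' (a : dmor A X) (s : dmor X X') (d : dmor X' (shift A))
    (f : dmor X Y) (f' : dmor Y X) (g : dmor X' Y') (g' : dmor Y' X') :
  deq (dcomp f' f) (did _) -> deq (dcomp f f') (did _) ->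
  deq (dcomp g' g) (did _) -> deq (dcomp g g') (did _) ->
  etri a s d -> etri (dcomp f a) (dcomp g (dcomp s f')) (dcomp d g').
Proof.
move=> f1 f2 g1 g2 [h0 h1 h2]; split.
- by rewrite -deq_compA (deq_compA g' g) g1 deq_id_comp deq_compA h0 dzero_l.
- move=> W u e; have [|v hv] := h1 W (dcomp f' u).
    by rewrite deq_compA -(deq_id_comp (dcomp (dcomp s f') u)) -g1 -deq_compA (deq_compA g) e dzero_r.
  by exists v; rewrite -deq_compA -hv deq_compA f2 deq_id_comp.
- move=> W u e; have [|v hv] := h2 W (dcomp g' u); first by rewrite deq_compA.
  exists (dcomp f v); rewrite -!deq_compA (deq_compA f' f) f1 deq_id_comp -hv deq_compA g2.
  by rewrite deq_id_comp.
Qed.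

Fixpoint tcomp (X : nat -> cplx k U) (s : forall i, dmor (X i) (X i.+1)) (n : nat) : dmor (X 0%N) (X n) :=
  match n return dmor (X 0%N) (X n) with 0%N => did _ | m.+1 => dcomp (s m) (tcomp s m) end.

Lemma tcompS (X : nat -> cplx k U) (s : forall i, dmor (X i) (X i.+1)) n :
  deq (tcomp s n.+1) (dcomp (tcomp (X := fun j => X j.+1) (fun j => s j.+1) n) (s 0%N)).
Proof.
elim: n => [|n IH] /=; first by rewrite deq_comp_id deq_id_comp.
by rewrite -[dcomp (s n) _]/(tcomp s n.+1) IH deq_compA.
Qed.

Lemma tcompD (X : nat -> cplx k U) (s : forall i, dmor (X i) (X i.+1)) m n :
  deq (tcomp s (m + n)) (dcomp (tcomp (X := fun j => X (j + n)%N) (fun j => s (j + n)%N) m) (tcomp s n)).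
Proof.
elim: m => [|m IH]; first by rewrite -[tcomp _ 0]/(did _) deq_id_comp.
by rewrite -[tcomp s _]/(dcomp (s (m + n)%N) (tcomp s (m + n))) IH /= deq_compA.
Qed.

Section Factor.
Variables (P : cplx k U -> Prop) (clP : tclosed P) (K : cplx k U).

(* [A] need not lie in [P] (it may be an infinite sum), but maps into [A] from [K],
   and maps into its shift from objects of [P], live on a retract that does. *)
Definition approx A := 
  (forall y : dmor K A, exists A' (j : dmor A' A) (r : dmor A A'), P A' /\ deq (dcomp (dcomp j r) y) y) /\
  (forall B (h : dmor B (shift A)), P B -> exists A' (j : dmor A' A) (r : dmor A A'),
      P A' /\ deq (dcomp (dcomp (fD (efun_shift k U) j) (fD (efun_shift k U) r)) h) h).

Lemma approx_self A : P A -> approx A.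
Proof.
move=> PA; split=> [y|B h PB]; exists A, (did A), (did A); split=> //.
  by rewrite !deq_id_comp.
have -> : deq (fD (efun_shift k U) (did A)) (did (shift A)) by apply: dmap_ceq.
by rewrite !deq_id_comp.
Qed.

(* The octahedral argument: peeling off one stage at a time, a map that dies after
   [n] stages factors through an [n]-fold extension of pieces of the [A i]. *)
Lemma factor_tower (A X : nat -> cplx k U) (a : forall i, dmor (A i) (X i))
    (s : forall i, dmor (X i) (X i.+1)) (d : forall i, dmor (X i.+1) (shift (A i))) :
  (forall i, etri (a i) (s i) (d i)) -> (forall i, approx (A i)) -> (exists Z, P Z) ->
  forall n (x : dmor K (X 0%N)), deq (dcomp (tcomp s n) x) (dzero _ _) ->
  exists B (c : dmor B (X 0%N)) (b : dmor K B), P B /\ deq x (dcomp c b).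
Proof.
move=> ht hA [Z PZ] n; elim: n A X a s d ht hA => [|n IH] A X a s d ht hA x hx.
  exists Z, (dzero _ _), (dzero _ _); split=> //.
  by rewrite dzero_l -hx /= deq_id_comp.
rewrite tcompS -deq_compA in hx.
have [B [c [b [PB e1]]]] := IH (fun j => A j.+1) (fun j => X j.+1) _ _ _ (fun j => ht j.+1) (fun j => hA j.+1) _ hx.
have [_ apS] := hA 0%N.
have [A' [j [r [PA' hg]]]] := apS B (dcomp (d 0%N) c) PB.
have [F [phi [PF h1 h2]]] := dfiber (dcomp (fD (efun_shift k U) r) (dcomp (d 0%N) c)) clP PB PA'.
have [|b' hb'] := h2 K b.
  by rewrite -!deq_compA -e1 (deq_compA (d 0%N)) (etri0 (ht 0%N)) dzero_l dzero_r.
have [|psi hpsi] := etri2 (ht 0%N) (u := dcomp c phi).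
  by rewrite deq_compA -hg -!deq_compA (deq_compA (d 0%N)) (deq_compA (fD _ r)) h1 dzero_r.
have [|y hy] := etri1 (ht 0%N) (u := dadd x (dneg (dcomp psi b'))).
  by rewrite deq_compDr dcomp_neg e1 {1}hb' !deq_compA hpsi deq_addN.
have [A'' [j' [r' [PA'' hjr]]]] := (hA 0%N).1 y.
have [c' [b'' e]] := csum_factor psi (dcomp (a 0%N) j') b' (dcomp r' y).
exists (csum F A''), c', b''; split; first exact: cl_csum.
rewrite e -deq_compA (deq_compA j') hjr; apply: deq_subK; exact: hy.
Qed.

End Factor.

Lemma tcomp_map (F : efun k U) (X : nat -> cplx k U) (s : forall i, dmor (X i) (X i.+1)) n :
  deq (fD F (tcomp s n)) (tcomp (X := fun i => F (X i)) (fun i => fD F (s i)) n).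
Proof. by elim: n => [|n IH] /=; [apply: dmap_ceq; exact: fm_id|rewrite IH]. Qed.

Lemma ghost_shiftm X Y (f : chmap X Y) : ghost (shiftm f) <-> ghost f.
Proof.
split=> g; last by move=> n G z /shift_cocycle hz; apply/bdry_shift/g.
by apply: int_succ_ind => n G z hz; apply/bdry_shift/g/shift_cocycle.
Qed.

Lemma ghost_comp_r X Y Z (g : chmap Y Z) (f : chmap X Y) : ghost g -> ghost (ccomp g f).
Proof. by move=> h n G z hz; apply: h; rewrite -ccomm hz linear0. Qed.

Lemma ghost_qiso X Y Z (g : chmap Y Z) (f : chmap X Y) : qiso g -> ghost (ccomp g f) -> ghost f.
Proof.
move=> q h n G z hz; have [qi _] := q n G; apply: qi; last exact: h.
by rewrite -ccomm hz linear0.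
Qed.

Lemma ghost_ceq X Y (f g : chmap X Y) : ceq f g -> ghost f -> ghost g.
Proof. by move=> e h n G z hz; rewrite -e; exact: h. Qed.

Lemma ghost_unshiftm X Y (f : chmap X Y) : ghost f -> ghost (unshiftm f).
Proof.
move=> g; apply/ghost_shiftm; apply: (ghost_qiso (counit_shift_qiso Y)).
apply: (ghost_ceq (f := ccomp f (counit_shift X))) => [n G x|]; first by rewrite counit_shift_nat.
exact: ghost_comp_r.
Qed.

(** Finite ghost length. The leading morphism [f] is arbitrary, which lets the notion pass to
    retracts and extensions. *)
Definition ghostnil A := exists n, forall (Z : nat -> cplx k U) (s : forall i, chmap (Z i) (Z i.+1)),
  (forall i, ghost (s i)) -> forall f : dmor A (Z 0%N),
  deq (dcomp (tcomp (fun i => dmap (s i)) n) f) (dzero _ _).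

Lemma ghostnil_retract X Y : retract X Y -> ghostnil Y -> ghostnil X.
Proof.
move=> [i [r e]] [n hn]; exists n => Z s gs f.
by rewrite -(deq_comp_id f) -e (deq_compA f) (deq_compA _ (dcomp f r)) (hn _ _ gs) dzero_l.
Qed.

Lemma ghostnil_shift A : ghostnil (shift A) <-> ghostnil A.
Proof.
split=> -[n hn]; exists n => Z s gs f.
  apply: shift_faithful => /=; rewrite tcomp_map.
  by apply: hn => i; apply/ghost_shiftm.
apply: unshift_faithful => /=; rewrite tcomp_map; apply: (qiso_epi (unit_shift_qiso A)).
rewrite dzero_l -deq_compA.
by apply: (hn (fun i => unshift (Z i)) (fun i => unshiftm (s i))) => i; exact: ghost_unshiftm.
Qed.

(** Ghost lengths add: after [n] steps the map vanishes on [Y] and so factors through the shift of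
    [X], where [m] further steps finish. *)
Lemma ghostnil_cone X Y (f : chmap X Y) : ghostnil X -> ghostnil Y -> ghostnil (cone f).
Proof.
move=> /ghostnil_shift[m hm] [n hn]; exists (m + n)%N => Z s gs g.
rewrite tcompD -deq_compA.
have [|v hv] := @half_con2 k U X Y _ f (dcomp (tcomp (fun i => dmap (s i)) n) g).
  by rewrite -deq_compA (hn _ _ gs).
rewrite hv deq_compA.
by rewrite (hm (fun j => Z (j + n)%N) (fun j => s (j + n)%N)) ?dzero_l // => i; exact: gs.
Qed.

Lemma ghostnil_tclosed : tclosed ghostnil.
Proof.
split; [exact: ghostnil_cone| |exact: ghostnil_retract].
move=> X Y f hY hC; apply/ghostnil_shift.
apply: ghostnil_retract (diso_retract (diso_sym (qiso_diso (cconep_qiso f)))) _.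
exact: ghostnil_cone.
Qed.

Lemma ghostnil_free I deg grp : ghostnil (ffree k (I := I) deg grp (fun=> false)).
Proof.
exists 1%N => Z s gs f; have [f' e] := kproj_roof f (@kproj_free k U I deg grp).
rewrite e /= deq_comp_id -deq_map_comp; apply: nullh_dzero; apply: free_null => i n d.
by apply: gs; rewrite -ccomm linear0.
Qed.

Lemma perf_ind_tclosed (P : cplx k U -> Prop) : tclosed P ->
  (forall (I : finType) (deg : I -> int) (grp : I -> Uob U), P (ffree k deg grp (fun=> false))) ->
  forall X, perf X -> P X.
Proof.
move=> c h X; elim=> {X} [I deg grp|X Y f _ hX _ hY|X Y f _ hY _ hC|X Y r _ hY].
- exact: h.
- exact: (cl_cone c f hX hY).
- exact: (cl_fib c hY hC).
- exact: (cl_retract c r hY).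
Qed.

Lemma perf_ghostnil X : perf X -> ghostnil X.
Proof.
by apply: perf_ind_tclosed; [exact: ghostnil_tclosed|move=> I deg grp; exact: ghostnil_free].
Qed.

Section Attach.
Variable X : cplx k U.

Definition aidx := {classic {s : skel U & {n : int & {z : X (n + 1) (skob s) | cd X (n + 1) (skob s) z = 0}}}}.
Definition asort (i : aidx) : {s : skel U & {n : int & {z : X (n + 1) (skob s) | cd X (n + 1) (skob s) z = 0}}} := i.
Definition agrp (i : aidx) (u : unit) := skob (projT1 (asort i)).
Definition adeg (i : aidx) (u : unit) : int := projT1 (projT2 (asort i)) + 1.
Definition acyc (i : aidx) (u : unit) : X (adeg i u) (agrp i u) := sval (projT2 (projT2 (asort i))).

Definition acell (i : aidx) := ffree k (adeg i) (agrp i) (fun=> false).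

Definition amap (i : aidx) : chmap (acell i) X :=
  @fchain k U unit (adeg i) (agrp i) (fun=> false) X (acyc i)
    (fun u K a b => @nosym_inv k U unit (agrp i) (fun=> false) (fun=> erefl) (X (adeg i u)) u (acyc i u) K a b)
    (fun u => proj2_sig (projT2 (projT2 (asort i)))).

Definition aall : chmap (dsumc acell) X := dliftc amap.

(** Every cocycle at a representative group is hit by a cell and hence bounds in the cone; other
    groups follow along isomorphisms. *)
Lemma aall_ghost : ghost (cinj aall).
Proof.
move=> n G z hz; have [s [a [b [ab ba]]] _] := skob_giso G.
apply: (bdry_iso ab).
pose z' := sres (X (n + 1)) b z.
have hz' : cd X (n + 1) _ z' = 0 by rewrite /z' sres_nat hz linear0.
pose i : aidx := existT _ s (existT _ n (exist _ z' hz')).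
pose w : acell i (n + 1) (skob s) := fg k (fun=> false) (erefl (adeg i tt)) (sid (agrp i tt)).
have w1 : amap i _ _ w = z' by rewrite fchainE sres_id ccast_id.
exists (dinc acell i _ _ w, 0).
rewrite cone_dE linear0 addr0 -ccomm.
have -> : cd (acell i) (n + 1) (skob s) w = 0 by [].
rewrite linear0 oppr0 [aall _ _ _]dliftcE w1.
by rewrite -(sres_nat (cinj aall (n + 1)) b z).
Qed.

End Attach.

(** Each step of the tower [X] over [K] kills all cohomology, so [tsig] is invertible. Compactness
    confines the preimage of the inclusion of [K] to finitely many stages, which forces a finite
    composite of the ghosts to vanish; [factor_tower] then makes [K] a retract of a finite extension
    of cells. *)
Lemma compact'_perf (K : cplx k U) : compact' K -> perf K.
Proof.
move=> cK.
pose X : nat -> cplx k U := fix X i := if i is j.+1 then cone (aall (X j)) else K.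
pose s i : chmap (X i) (X i.+1) := cinj (aall (X i)).
have gs i : ghost (s i) by exact: aall_ghost.
have [h hh] : exists h : dmor K (dsumc X), deq (dcomp (dmap (tsig s)) h) (dmap (dinc X 0%N)).
  exists (dcomp (dinv (tsig_qiso gs)) (dmap (dinc X 0%N))).
  by rewrite deq_compA deq_map_inv deq_id_comp.
have [J hJ] := cK _ X h.
(* The equation for [h] determines its components recursively: [x n] is the composite of the first
   [n] maps of the tower. *)
pose x i := dcomp (dmap (dproj X i)) h.
have x0 : deq (x 0%N) (did K).
  have : deq (dcomp (dmap (dproj X 0%N)) (dcomp (dmap (tsig s)) h)) (did K).
    by rewrite hh -deq_map_comp; apply: dmap_ceq => n G y; exact: dproj_eq.
  rewrite deq_compA -deq_map_comp => <-; rewrite /x; apply: deq_comp => //; apply: dmap_ceq => n G y.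
  by rewrite -[RHS]/(dproj X 0%N n G (tsig s n G y)) tsigE linearB dproj_tsh0 subr0.
have xS i : deq (x i.+1) (dcomp (dmap (s i)) (x i)).
  rewrite /x deq_compA -deq_map_comp; apply: deq_sub0; rewrite /dneg deq_compA -deq_compDl.
  rewrite -deq_map_comp -deq_map_add.
  have -> : deq (dmap (cadd (dproj X i.+1) (ccomp (cneg (Defs.cid (X i.+1))) (ccomp (s i) (dproj X i)))))
      (dmap (ccomp (dproj X i.+1) (tsig s))).
    apply: dmap_ceq => n G y; rewrite -[RHS]/(dproj X i.+1 n G (tsig s n G y)) tsigE linearB dproj_tshS //.
  by rewrite deq_map_comp -deq_compA hh dmap_comp0 // => n G y; rewrite dproj_ne.
have xE n : deq (tcomp (fun i => dmap (s i)) n) (x n).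
  by elim: n => [|n IH] /=; [rewrite x0|rewrite IH xS].
have [N hN] : exists N, N \notin J.
  exists (foldr maxn 0%N J).+1; apply/negP.
  have le i : i \in J -> (i <= foldr maxn 0 J)%N.
    elim: J {hJ} => //= j J IH; rewrite inE leq_max => /orP[/eqP->|/IH->]; rewrite ?leqnn ?orbT //.
  by move/le; rewrite ltnn.
have xN : deq (x N) (dzero _ _).
  rewrite /x; have -> : deq (dmap (dproj X N)) (dcomp (dmap (dproj X N)) (dmap (dcut X J))).
    rewrite -deq_map_comp; apply: dmap_ceq.
    apply: dsumc_ext => j n G y.
    rewrite -[LHS]/(dproj X N n G (dinc X j n G y)) -[RHS]/(dproj X N n G (dcut X J n G (dinc X j n G y))) dcutE.
    by case: ifP => // jJ; rewrite linear0 dproj_ne //; apply: contraNneq hN => <-.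
  by rewrite -deq_compA hJ dzero_r.
(* What [dcut L] removes from the identity factors through a finite, hence perfect, sum. This
   supplies the retracts for [approx], the sums of cells being infinite. *)
have cut (I : eqType) (Y : I -> cplx k U) (L : seq I) : (forall i, perf (Y i)) -> uniq L ->
    exists A' (j : dmor A' (dsumc Y)) r, perf A' /\ deq (dadd (dcomp j r) (dmap (dcut Y L))) (did _).
  move=> pY; elim: L => [|i L IH] /= => [_|/andP[iL /IH[A' [j [r [pA' e]]]]]].
    exists (zcplx k U), (dzero _ _), (dzero _ _); split; first exact: perf_free.
    by rewrite dzero_l deq_add0; apply: dmap_ceq; exact: dcut_nil.
  have [c [d e']] := csum_factor (dmap (dinc Y i)) j (dmap (dproj Y i)) r.
  exists (csum (Y i) A'), c, d; split; first exact: (cl_csum (@perf_tclosed k U) (pY i) pA').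
  have ec : deq (dmap (dcut Y L)) (dadd (dcomp (dmap (dinc Y i)) (dmap (dproj Y i))) (dmap (dcut Y (i :: L)))).
    by rewrite -deq_map_comp -deq_map_add; apply: dmap_ceq => n G y; rewrite (dcut_cons iL).
  by rewrite e' (deq_addC (dcomp (dmap _) _)) -deq_addA -ec.
have ap i : approx (@perf k U) K (dsumc (acell (X := X i))).
  split=> [y|B l pB].
    have [L hL] := cK _ _ y; have [|A' [j [r [pA' e]]]] := cut _ (acell (X := X i)) (undup L) _ (undup_uniq L).
      by move=> u; exact: perf_free.
    exists A', j, r; split=> //; rewrite -{2}(deq_id_comp y) -e deq_compDl.
    have -> : deq (dcomp (dmap (dcut (acell (X := X i)) (undup L))) y) (dzero _ _).
      have sL : {subset L <= undup L} by move=> t; rewrite mem_undup.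
      by rewrite -(dmap_ceq (dcut_sub sL)) deq_map_comp -deq_compA hL dzero_r.
    by rewrite deq_add0r.
  have [L hL] := compact'_cont (@sumcont_shift k U) l (perf_compact' pB).
  have [|A' [j [r [pA' e]]]] := cut _ (acell (X := X i)) (undup L) _ (undup_uniq L).
    by move=> u; exact: perf_free.
  exists A', j, r; split=> //; rewrite -{2}(deq_id_comp l).
  have <- : deq (fD (efun_shift k U) (did _)) (did (shift (dsumc (acell (X := X i))))).
    by apply: dmap_ceq.
  rewrite -(fD_deq (efun_shift k U) e) /= deq_compDl.
  have -> : deq (dcomp (dmap (shiftm (dcut (acell (X := X i)) (undup L)))) l) (dzero _ _).
    have sL : {subset L <= undup L} by move=> t; rewrite mem_undup.
    have -> : deq (dmap (shiftm (dcut (acell (X := X i)) (undup L))))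
      (dcomp (dmap (shiftm (dcut (acell (X := X i)) (undup L)))) (dmap (shiftm (dcut (acell (X := X i)) L)))).
      by rewrite -deq_map_comp; apply: dmap_ceq => n G y; exact: (esym (dcut_sub sL _)).
    by rewrite -deq_compA [X in dcomp _ X]hL dzero_r.
  by rewrite deq_add0r.
have [|B [c [b [pB e]]]] := @factor_tower _ (@perf_tclosed k U) K (fun i => dsumc (acell (X := X i))) X _ _ _
   (fun i => etri_cone (aall (X i))) ap (ex_intro _ _ (perf_free k (fun v : void => of_void int v) (fun v => of_void (Uob U) v))) N (did K).
  by rewrite deq_comp_id xE.
by apply: (@perf_retract k U K B) pB; exists b, c; rewrite e.
Qed.

Lemma compact_perf (K : cplx k U) : compact K <-> perf K.
Proof.
split; first by move/compact'_of_compact; exact: compact'_perf.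
by move/perf_compact'; exact: compact_of_compact'.
Qed.

End Towers.

(** * Tensor products *)

Section LinearRelations.
Variables (k : fieldType) (V W : lmodType k) (R : V -> W -> Prop).
Hypotheses (R0 : R 0 0) (RD : forall a b a' b', R a b -> R a' b' -> R (a + a') (b + b'))
  (RZ : forall c a b, R a b -> R (c *: a) (c *: b)).

Let good (S : V * W -> Prop) := [/\ forall s t, S s -> S t -> S (s.1 + t.1, s.2 + t.2),
  forall c s, S s -> S (c *: s.1, c *: s.2), forall w, S (0, w) -> w = 0 &
  forall v w w', S (v, w) -> R v w' -> R v w].

(** Zorn's lemma on graphs of partial linear maps that obey [R] wherever [R] has a value.
    Pseudo-inverses and separating functionals are both instances, so that no bases are needed. *)
Lemma linear_selection : exists f : {linear V -> W}, forall v w, R v w -> R v (f v).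
Proof.
have [|A [[AD AZ A0 AR] Amax]] := @classical_sets.Zorn_bigcup (V * W)%type good.
  move=> F Fgood Ftot; split.
  - move=> s t [X FX Xs] [Y FY Yt]; have [XY|YX] := Ftot _ _ FX FY.
      by exists Y => //; have [h _ _ _] := Fgood _ FY; apply: h => //; exact: XY.
    by exists X => //; have [h _ _ _] := Fgood _ FX; apply: h => //; exact: YX.
  - by move=> c s [X FX Xs]; exists X => //; have [_ h _ _] := Fgood _ FX; exact: h.
  - by move=> w [X FX Xs]; have [_ _ h _] := Fgood _ FX; exact: h.
  - by move=> v w w' [X FX Xs]; have [_ _ _ h] := Fgood _ FX; exact: h Xs.
(* The empty graph is [good] as well; it is not maximal, since the zero graph extends it. *)
have A00 : A (0, 0).
  have [[s As]|ne] := pselect (exists s, A s); first by have := AZ 0 s As; rewrite !scale0r.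
  have [] := Amax (fun s => s = (0, 0)).
    by split=> [s As|/(_ (0, 0) erefl) h]; case: ne; [exists s|exists (0, 0)].
  split=> [s t -> ->|c s ->|w [->] //|v w w' [-> ->] _ //]; by rewrite /= ?addr0 ?scaler0.
have tot v : exists w, A (v, w).
  apply: contrapT => nv.
  have nv' c s : A s -> s.1 + c *: v = 0 -> c = 0.
    move=> As e; apply/eqP; apply: contraPT nv => c0; apply; exists (- c^-1 *: s.2).
    have := AZ (- c^-1) s As; congr (A (_, _)).
    by rewrite -(addr0_eq (etrans (addrC _ _) e)) scaleNr scalerN opprK scalerA mulVf ?scale1r.
  (* The value at the new vector [v]: if [R] has a value [w0] at some [s0.1 + v], then [w0 - s0.2]
     works for all multiples by linearity of [R]; otherwise [R] constrains nothing and 0 is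
     taken. *)
  have [m hm] : exists m, forall c s w', A s -> R (s.1 + c *: v) w' -> c != 0 -> R (s.1 + c *: v) (s.2 + c *: m).
    have [[s0 [w0 [As0 R0']]]|none] := pselect (exists s0 w0, A s0 /\ R (s0.1 + v) w0); last first.
      exists 0 => c s w' As Rs c0; case: none; exists (c^-1 *: s.1, c^-1 *: s.2), (c^-1 *: w').
      split; first exact: AZ.
      by have := RZ c^-1 Rs; rewrite scalerDr scalerA mulVf // scale1r.
    exists (w0 - s0.2) => c s w' As Rs c0.
    have At : A (s.1 + (- c) *: s0.1, s.2 + (- c) *: s0.2).
      by apply: (AD s (_, _)) => //; exact: (AZ _ s0).
    have Rt := RD Rs (RZ (- c) R0').
    have e : s.1 + c *: v + - c *: (s0.1 + v) = s.1 + - c *: s0.1.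
      by rewrite scalerDr !scaleNr; zmod.
    rewrite e in Rt; have := RD (AR _ _ _ At Rt) (RZ c R0').
    by congr (R _ _); rewrite /= !scalerDr ?scaleNr ?scalerN; zmod.
  have [] := Amax (fun t => exists c s, A s /\ t = (s.1 + c *: v, s.2 + c *: m)).
    split=> [[s1 s2] As|/(_ (v, m)) h]; first by exists 0, (s1, s2); rewrite /= !scale0r !addr0.
    by apply: nv; exists m; apply: h; exists 1, (0, 0); rewrite /= !scale1r !add0r.
  split=> [_ _ [c [s [As ->]]] [d [t [At ->]]]|a _ [c [s [As ->]]]|w [c [s [As [e1 ->]]]]|x w w' [c [s [As [-> ->]]]] h].
  - exists (c + d), (s.1 + t.1, s.2 + t.2); split; first exact: AD.
    by congr pair; rewrite /= scalerDl; zmod.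
  - exists (a * c), (a *: s.1, a *: s.2); split; first exact: AZ.
    by congr pair; rewrite /= scalerDr scalerA.
  - have c0 : c = 0 by apply: (nv' c s As).
    rewrite c0 !scale0r !addr0 in e1 *; apply: A0.
    by have : A (s.1, s.2); [case: (s) As|rewrite -e1].
  - have [c0|c0] := eqVneq c 0; last exact: (hm _ _ _ As h c0).
    rewrite c0 !scale0r !addr0 in h *; apply: (AR _ _ _ _ h).
    by case: (s) As.
have [f hf] := dep_choice tot.
have uniq v w w' : A (v, w) -> A (v, w') -> w = w'.
  move=> h h'; apply/subr0_eq/A0; have := AD _ _ h (AZ (-1) _ h').
  by rewrite /= !scaleN1r subrr.
have lin : linear f.
  move=> a x y; apply: uniq (hf _) _; exact: (AD (_, _) (_, _) (AZ a _ (hf x)) (hf y)).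
by exists (mklin lin) => v w; apply: AR; exact: hf.
Qed.

End LinearRelations.

Section LinearAlgebra.
Variable k : fieldType.

Lemma lin_pinv (V W : lmodType k) (d : {linear V -> W}) :
  exists s : {linear W -> V}, forall v, d (s (d v)) = d v.
Proof.
have [||s hs] := @linear_selection k W V (fun w v => d v = w) (linear0 _).
- by move=> a b a' b' <- <-; rewrite linearD.
- by move=> c a b <-; rewrite linearZ.
by exists s => v; exact: (hs (d v) v erefl).
Qed.

Lemma lin_sep (V : lmodType k) (W : V -> Prop) (v : V) : W 0 ->
  (forall a b, W a -> W b -> W (a + b)) -> (forall c a, W a -> W (c *: a)) -> ~ W v ->
  exists f : {linear V -> k^o}, (forall w, W w -> f w = 0) /\ f v = 1.
Proof.
move=> W0 WD WZ Wv.
(* The relation is [u = c v] modulo [W]; it determines [c] because [v] is not in [W]. *)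
have [|||f hf] := @linear_selection k V k^o (fun u c => W (u - c *: v)).
- by rewrite scale0r subr0.
- by move=> a b a' b' h h'; have := WD _ _ h h'; congr W; rewrite scalerDl; zmod.
- by move=> c a b /(WZ c); congr W; rewrite scalerBr scalerA.
have key c : W (c *: v) -> c = 0.
  move=> h; apply/eqP; apply: contraPT Wv => c0; apply.
  by have := WZ c^-1 _ h; rewrite scalerA mulVf // scale1r.
exists f; split=> [w Ww|].
  have h : W (w - f w *: v) by apply: (hf w 0); rewrite scale0r subr0.
  apply: key; have := WD _ _ Ww (WZ (-1) _ h); congr W; rewrite scaleN1r; zmod.
have h : W (v - f v *: v) by apply: (hf v 1); rewrite scale1r subrr.
by apply/esym/subr0_eq/key; rewrite scalerBl scale1r.
Qed.

Variable U : finGroupType -> Prop.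
Implicit Types (X Y : cplx k U) (G : Uob U).

(** Since [d s d = d], the operator [x - s d x] projects onto cocycles, and [s] after this
    projection is a contraction. *)
Lemma contraction X G : acyclic_at G X ->
  exists h : forall n, {linear X (n + 1) G -> X n G},
  forall n x, x = cd X n G (h n x) + h (n + 1) (cd X (n + 1) G x).
Proof.
move=> ac; have [s hs] := dep_choice (fun n => lin_pinv (cd X n G)).
have lin n : linear (fun x : X (n + 1) G => s n (x - s (n + 1) (cd X (n + 1) G x))).
  by move=> a x y; rewrite -linearP; congr (s n _); rewrite (linearP (cd X (n + 1) G)) (linearP (s (n + 1))) scalerDr scalerN; zmod.
exists (fun n => mklin (lin n)) => n x.
rewrite -[mklin (lin n) x]/(s n (x - s (n + 1) (cd X (n + 1) G x))).
rewrite -[mklin (lin (n + 1)) _]/(s (n + 1) (cd X (n + 1) G x - s (n + 1 + 1) (cd X (n + 1 + 1) G (cd X (n + 1) G x)))).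
have [|w hw] := ac n (x - s (n + 1) (cd X (n + 1) G x)); first by rewrite linearB hs subrr.
by rewrite cdd linear0 subr0 -{1}hw hs hw subrK.
Qed.

(** Vanishing on boundaries and in all other degrees, [f] is a chain map to [k] placed in degree
    [n + 1], and it detects the class of [z]. *)
Lemma cofunctional X G n (z : X (n + 1) G) : ~ bdry z ->
  exists f : forall i, {linear X i G -> k^o},
    [/\ f (n + 1) z = 1, forall i x, f (i + 1) (cd X i G x) = 0 & forall i x, i != n + 1 -> f i x = 0].
Proof.
move=> nz; have [|||g [g0 g1]] := @lin_sep _ (@bdry k U X n G) z _ _ _ nz.
- by exists 0; rewrite linear0.
- by move=> a b [x <-] [y <-]; exists (x + y); rewrite linearD.
- by move=> c a [x <-]; exists (c *: x); rewrite linearZ.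
pose f i : {linear X i G -> k^o} := match @eqP _ i (n + 1) with
  | ReflectT e => g \o ccast X e G | ReflectF _ => \0 end.
have fE x : f (n + 1) x = g x.
  by rewrite /f; case: eqP => // e; rewrite /= ccast_id.
have f0 i x : i != n + 1 -> f i x = 0 by rewrite /f; case: eqP.
exists f; split=> [|i x|//]; first by rewrite fE.
have [e|ne] := eqVneq i n; first by destruct e; rewrite fE g0 //; exists x.
by rewrite f0 //; apply: contra ne => /eqP/addIr->.
Qed.

End LinearAlgebra.

Section TensorBasics.
Variables (k : fieldType) (U : finGroupType -> Prop).
Implicit Types (G H K : Uob U) (V : rep k U).
Variables (X Y : cplx k U).

Definition tp n G i j (e : i + j == n) (x : X i G) (y : Y j G) : tensor X Y n G :=
  @pure k U X Y n G (exist _ (i, j) e) x y.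

Lemma tp_linl n G i j (e : i + j == n) y : linear (fun x : X i G => @tp n G i j e x y).
Proof. exact: (@pure_linl k U X Y n G (exist _ (i, j) e) y). Qed.

Lemma tp_linr n G i j (e : i + j == n) x : linear (fun y : Y j G => @tp n G i j e x y).
Proof. exact: (@pure_linr k U X Y n G (exist _ (i, j) e) x). Qed.

Lemma tp0l n G i j (e : i + j == n) y : @tp n G i j e 0 y = 0.
Proof. exact: (linear0 (mklin (@tp_linl n G i j e y))). Qed.

Lemma tp0r n G i j (e : i + j == n) x : @tp n G i j e x 0 = 0.
Proof. exact: (linear0 (mklin (@tp_linr n G i j e x))). Qed.

Lemma tpDl n G i j (e : i + j == n) x x' y : @tp n G i j e (x + x') y = tp e x y + tp e x' y.
Proof. exact: (linearD (mklin (@tp_linl n G i j e y))). Qed.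

Lemma tpNl n G i j (e : i + j == n) x y : @tp n G i j e (- x) y = - tp e x y.
Proof. exact: (linearN (mklin (@tp_linl n G i j e y))). Qed.

Lemma tpZl n G i j (e : i + j == n) c x y : @tp n G i j e (c *: x) y = c *: tp e x y.
Proof. exact: (linearZ_LR (mklin (@tp_linl n G i j e y))). Qed.

Lemma tpZr n G i j (e : i + j == n) c x y : @tp n G i j e x (c *: y) = c *: tp e x y.
Proof. exact: (linearZ_LR (mklin (@tp_linr n G i j e x))). Qed.

Lemma tp_eq n G i j i' j' (e : i + j == n) (e' : i' + j' == n) (ei : i = i') (ej : j = j') x y :
  @tp n G i j e x y = tp e' (ccast X ei G x) (ccast Y ej G y).
Proof. by destruct ei, ej; rewrite !ccast_id; exact: pure_irr. Qed.

Lemma tp_res n G H (f : {multiplicative G -> H}) (hf : surjective f) i j (e : i + j == n) x y :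
  res (tensor X Y n) hf (tp e x y) = tp e (res (X i) hf x) (res (Y j) hf y).
Proof. exact: tres_pure. Qed.

Lemma tp_sres n G H (f : surj G H) i j (e : i + j == n) x y :
  sres (tensor X Y n) f (tp e x y) = tp e (sres (X i) f x) (sres (Y j) f y).
Proof. exact: tp_res. Qed.

Lemma td_tp n G i j (e : i + j == n) (el : i + 1 + j == n + 1) (er : i + (j + 1) == n + 1) x y :
  cd (tensor X Y) n G (tp e x y) = tp el (cd X i G x) y + (-1) ^ i *: tp er x (cd Y j G y).
Proof.
rewrite [LHS](@td_pure k U X Y n G (exist _ (i, j) e) x y); congr (_ + _ *: _); exact: pure_irr.
Qed.

Lemma tensor_lin_ext n G (M : lmodType k) (f g : {linear tensor X Y n G -> M}) :
  (forall i j (e : i + j == n) x y, f (tp e x y) = g (tp e x y)) -> forall z, f z = g z.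
Proof. by move=> h; apply: plin_ext => -[[[i j] e] [x y]]; exact: h. Qed.

Lemma tensor_ext n V (f g : rhom (tensor X Y n) V) :
  (forall G i j (e : i + j == n) x y, f G (tp e x y) = g G (tp e x y)) -> forall G z, f G z = g G z.
Proof. by move=> h G; apply: tensor_lin_ext; exact: h. Qed.

Section LiftL.
Variables (n : int) (G : Uob U) (M : lmodType k).
Variable t : forall i j, i + j == n -> X i G -> Y j G -> M.
Hypothesis tl : forall i j (e : i + j == n) y, linear (fun x => t e x y).
Hypothesis tr : forall i j (e : i + j == n) x, linear (t e x).

Definition tlin_gen (a : tgen X Y n G) : M :=
  t (i := (sval (projT1 a)).1) (j := (sval (projT1 a)).2) (proj2_sig (projT1 a)) (projT2 a).1 (projT2 a).2.

Lemma tlin_bilin : bilin tlin_gen.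
Proof. by move=> [[i j] e]; split=> [y|x]; [exact: tl|exact: tr]. Qed.

Definition tlin : {linear tensor X Y n G -> M} := plift tlin_bilin.

Lemma tlinE i j (e : i + j == n) x y : tlin (tp e x y) = t e x y.
Proof. exact: plift_gen. Qed.
End LiftL.

Section Lift.
Variables (n : int) (V : rep k U).
Variable t : forall G i j, i + j == n -> X i G -> Y j G -> V G.
Hypothesis tl : forall G i j (e : i + j == n) y, linear (fun x => @t G i j e x y).
Hypothesis tr : forall G i j (e : i + j == n) x, linear (@t G i j e x).
Hypothesis tn : forall G H (f : {multiplicative G -> H}) (hf : surjective f) i j (e : i + j == n) x y,
  t e (res (X i) hf x) (res (Y j) hf y) = res V hf (t e x y).

Lemma tlift_nat G H (f : {multiplicative G -> H}) (hf : surjective f) x :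
  tlin (@tl G) (@tr G) (res (tensor X Y n) hf x) = res V hf (tlin (@tl H) (@tr H) x).
Proof.
move: x; apply: (tensor_lin_ext (f := tlin (@tl G) (@tr G) \o res (tensor X Y n) hf)
  (g := res V hf \o tlin (@tl H) (@tr H))) => i j e x y.
rewrite -[LHS]/(tlin (@tl G) (@tr G) (res (tensor X Y n) hf (tp e x y))).
rewrite -[RHS]/(res V hf (tlin (@tl H) (@tr H) (tp e x y))).
by rewrite tp_res !tlinE tn.
Qed.

Definition tlift : rhom (tensor X Y n) V :=
  @RHom k U (tensor X Y n) V (fun G => tlin (@tl G) (@tr G)) tlift_nat.

Lemma tliftE G i j (e : i + j == n) x y : tlift G (tp e x y) = t e x y.
Proof. exact: tlinE. Qed.
End Lift.

(* generators in the shape in which the differential of either factor can be undone *)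
Lemma tensor_lin_ext_succ n G (M : lmodType k) (f g : {linear tensor X Y n G -> M}) :
  (forall i j (e : i + 1 + j == n) x y, f (tp e x y) = g (tp e x y)) -> forall z, f z = g z.
Proof.
move=> h; apply: (tensor_lin_ext (f := f) (g := g)) => i.
have := @int_succ_ind (fun i => forall j (e : i + j == n) x y, f (tp e x y) = g (tp e x y)).
by apply=> {}i j e x y; exact: h.
Qed.

End TensorBasics.

Section TensorFunctor.
Variables (k : fieldType) (U : finGroupType -> Prop).
Implicit Types (X Y W Z : cplx k U) (G H K : Uob U).

Lemma eqS1 (i j n : int) : i + j == n -> i + 1 + j == n + 1.
Proof. by move/eqP <-; rewrite addrAC. Qed.
Lemma eqS2 (i j n : int) : i + j == n -> i + (j + 1) == n + 1.
Proof. by move/eqP <-; rewrite addrA. Qed.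

Section Map.
Variables (X X' W : cplx k U) (f : chmap X X').

Definition tmap1 n : rhom (tensor X W n) (tensor X' W n) :=
  @tlift k U X W n (tensor X' W n) (fun G i j e x w => tp e (f i G x) w)
    (fun G i j e w a x y => etrans (congr1 (fun z => tp e z w) (linearP (f i G) a x y)) (tp_linl e w a (f i G x) (f i G y)))
    (fun G i j e x => tp_linr e (f i G x))
    (fun G H u hu i j e x w => etrans (congr1 (fun z => tp e z _) (rnat (f i) hu x)) (esym (tp_res hu e (f i H x) w))).

Lemma tmap1E n G i j (e : i + j == n) x w : tmap1 n G (tp e x w) = tp e (f i G x) w.
Proof. exact: tliftE. Qed.

Lemma tmap1_comm n G z : tmap1 (n + 1) G (cd (tensor X W) n G z) = cd (tensor X' W) n G (tmap1 n G z).
Proof.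
move: G z; apply: (tensor_ext (f := rcomp (tmap1 (n + 1)) (cd (tensor X W) n)) (g := rcomp (cd (tensor X' W) n) (tmap1 n))).
move=> G i j e x w.
rewrite -[LHS]/(tmap1 (n + 1) G (cd (tensor X W) n G _)) -[RHS]/(cd (tensor X' W) n G (tmap1 n G _)).
by rewrite tmap1E !(td_tp _ (eqS1 e) (eqS2 e)) linearD linearZ /= !tmap1E ccomm.
Qed.

Definition tens1 : chmap (tensor X W) (tensor X' W) := @ChMap k U _ _ tmap1 tmap1_comm.

Lemma tens1E n G i j (e : i + j == n) x w : tens1 n G (tp e x w) = tp e (f i G x) w.
Proof. exact: tmap1E. Qed.
End Map.

Lemma chmap_tensor_ext X W Z (f g : chmap (tensor X W) Z) :
  (forall n G i j (e : i + j == n) x w, f n G (tp e x w) = g n G (tp e x w)) -> ceq f g.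
Proof. by move=> h n; apply: tensor_ext => G i j e x w; exact: h. Qed.

Lemma tens1_ceq X X' W (f g : chmap X X') : ceq f g -> ceq (tens1 W f) (tens1 W g).
Proof. by move=> h; apply: chmap_tensor_ext => n G i j e x w; rewrite !tens1E h. Qed.

Lemma tens1_id X W : ceq (tens1 W (Defs.cid X)) (Defs.cid (tensor X W)).
Proof. by apply: chmap_tensor_ext => n G i j e x w; rewrite tens1E. Qed.

Lemma tens1_comp X X' X'' W (g : chmap X' X'') (f : chmap X X') :
  ceq (tens1 W (ccomp g f)) (ccomp (tens1 W g) (tens1 W f)).
Proof.
apply: chmap_tensor_ext => n G i j e x w.
by rewrite -[RHS]/(tens1 W g n G (tens1 W f n G (tp e x w))) !tens1E.
Qed.

Lemma tens1_add X X' W (f g : chmap X X') : ceq (tens1 W (cadd f g)) (cadd (tens1 W f) (tens1 W g)).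
Proof.
apply: chmap_tensor_ext => n G i j e x w.
by rewrite -[RHS]/(tens1 W f n G (tp e x w) + tens1 W g n G (tp e x w)) !tens1E tpDl.
Qed.

(* Contracting one factor contracts the tensor product. *)
Lemma tensor_acyclic_at X W G : acyclic_at G X -> acyclic_at G (tensor X W).
Proof.
move=> /contraction[h hh] n.
have hc a b (e : a = b) (e' : a + 1 = b + 1) x :
    h b (ccast X e' G x) = ccast X e G (h a x) by destruct e; rewrite !ccast_id.
pose c i : {linear X i G -> X (i - 1) G} := h (i - 1) \o ccast X (predS i) G.
have cE i x : c (i + 1) x = ccast X (esym (Spred i)) G (h i x).
  by rewrite /c /= -(hc _ _ _ (predS (i + 1))).
have ep m (i j : int) : i + j == m + 1 -> i - 1 + j == m by move/eqP => e; rewrite addrAC e addrK.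
have tl m i j (e : i + j == m + 1) (w : W j G) : linear (fun x : X i G => tp (ep m i j e) (c i x) w).
  by move=> a x y; rewrite linearP tp_linl.
have tr m i j (e : i + j == m + 1) (x : X i G) : linear (fun w : W j G => tp (ep m i j e) (c i x) w).
  exact: tp_linr.
pose T m : {linear tensor X W (m + 1) G -> tensor X W m G} := tlin (tl m) (tr m).
have TE m i j (e : i + 1 + j == m + 1) (e' : i + j == m) x w : T m (tp e x w) = tp e' (h i x) w.
  by rewrite [T m _]tlinE cE (tp_eq e' (ep m _ _ e) (esym (Spred i)) erefl) ccast_id.
suff key : forall z : tensor X W (n + 1) G,
    z = cd (tensor X W) n G (T n z) + T (n + 1) (cd (tensor X W) (n + 1) G z).
  by move=> z hz; exists (T n z); rewrite [RHS]key hz linear0 addr0.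
apply: (tensor_lin_ext_succ (f := idfun) (g := (cd (tensor X W) n G \o T n) \+ (T (n + 1) \o cd (tensor X W) (n + 1) G))).
move=> i j e x w.
rewrite -[RHS]/(cd (tensor X W) n G (T n _) + T (n + 1) (cd (tensor X W) (n + 1) G _)).
have e0 : i + j == n by rewrite addrAC in e; rewrite -(inj_eq (addIr 1)).
rewrite (TE _ _ _ e e0) (td_tp _ e (eqS2 e0)) (td_tp _ (eqS1 e) (eqS2 e)) linearD linearZ /=.
rewrite (TE _ _ _ (eqS1 e) e) (TE _ _ _ (eqS2 e) (eqS2 e0)) sign_succ scaleNr.
by rewrite [in LHS](hh i x) tpDl; zmod.
Qed.

Section ConeTensor.
Variables (X Y W : cplx k U) (f : chmap X Y).

(* [(x, y) (x) w] goes to [(x (x) w, y (x) w)], where [x] has degree one more in the first factor *)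
Definition tcone n : rhom (tensor (cone f) W n) (cone (tens1 W f) n).
Proof.
apply: (@tlift k U (cone f) W n (cone (tens1 W f) n)
  (fun G i j e z w => (tp (eqS1 e) z.1 w, tp e z.2 w) : cone (tens1 W f) n G)).
- by move=> G i j e w a x y; congr pair; rewrite /= tp_linl.
- by move=> G i j e z a x y; congr pair; rewrite /= tp_linr.
- by move=> G H u hu i j e z w; congr pair; rewrite /= [RHS]tp_res.
Defined.

Lemma tconeE n G i j (e : i + j == n) z w : tcone n G (tp e z w) = (tp (eqS1 e) z.1 w, tp e z.2 w).
Proof. exact: tliftE. Qed.

Lemma tcone_comm n G z : tcone (n + 1) G (cd (tensor (cone f) W) n G z) = cd (cone (tens1 W f)) n G (tcone n G z).
Proof.
move: G z; apply: (tensor_ext (f := rcomp (tcone (n + 1)) (cd (tensor (cone f) W) n)) (g := rcomp (cd (cone (tens1 W f)) n) (tcone n))).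
move=> G i j e [x y] w.
rewrite -[LHS]/(tcone (n + 1) G (cd (tensor (cone f) W) n G _)) -[RHS]/(cd (cone (tens1 W f)) n G (tcone n G _)).
rewrite tconeE cone_dE !(td_tp _ (eqS1 e) (eqS2 e)) (td_tp _ (eqS1 (eqS1 e)) (eqS2 (eqS1 e))) linearD linearZ /= !tconeE tens1E.
rewrite cone_dE; congr pair; rewrite /=.
  rewrite tpNl sign_succ scaleNr opprD opprK; congr (- _ + _ *: _); exact: pure_irr.
by rewrite tpDl -addrA.
Qed.

Definition tconem : chmap (tensor (cone f) W) (cone (tens1 W f)) := @ChMap k U _ _ tcone tcone_comm.

(** An inverse is written down on the two summands of the cone, group by group; on the first it
    needs tensors whose left degree has the form [i + 1]. *)
Lemma tconem_qiso : qiso tconem.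
Proof.
have ep m (i j : int) : i + j == m + 1 -> i - 1 + j == m by move/eqP => e; rewrite addrAC e addrK.
pose inX i G (x : X (i + 1) G) : cone f i G := (x, 0).
have inXlin i G : linear (@inX i G) by move=> a x y; congr pair; rewrite /= ?scaler0 ?addr0.
have gXl n G i j (e : i + j == n + 1) (w : W j G) :
    linear (fun x : X i G => tp (ep n i j e) (inX (i - 1) G (ccast X (predS i) G x)) w).
  by move=> a x y; rewrite linearP inXlin tp_linl.
have gXr n G i j (e : i + j == n + 1) (x : X i G) :
    linear (fun w : W j G => tp (ep n i j e) (inX (i - 1) G (ccast X (predS i) G x)) w).
  exact: tp_linr.
pose gX n G : {linear tensor X W (n + 1) G -> tensor (cone f) W n G} := tlin (gXl n G) (gXr n G).
pose gY n G : {linear tensor Y W n G -> tensor (cone f) W n G} := tens1 W (cinj f) n G.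
have gXE n G i j (e : i + 1 + j == n + 1) (e' : i + j == n) x w :
    gX n G (tp e x w) = tp e' (inX i G x) w.
  rewrite [gX n G _]tlinE (tp_eq e' (ep n _ _ e) (esym (Spred i)) erefl) ccast_id; congr tp.
  have inXc a b (e1 : a = b) (e2 : a + 1 = b + 1) v : inX b G (ccast X e2 G v) = ccast (cone f) e1 G (inX a G v).
    by destruct e1; rewrite !ccast_id.
  exact: inXc.
have gYE n G i j (e : i + j == n) y w : gY n G (tp e y w) = tp e ((0, y) : cone f i G) w.
  by rewrite [gY n G _]tens1E.
pose g n G : {linear cone (tens1 W f) n G -> tensor (cone f) W n G} :=
  (gX n G \o fst) \+ (gY n G \o snd).
have gt n G z : g n G (tconem n G z) = z.
  move: z; apply: (tensor_lin_ext (f := g n G \o tconem n G) (g := idfun)) => i j e [x y] w.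
  rewrite -[LHS]/(g n G (tcone n G _)) tconeE.
  rewrite -[LHS]/(gX n G (tp (eqS1 e) x w) + gY n G (tp e y w)) (gXE _ _ _ _ _ e) gYE -tpDl.
  by congr tp; congr pair; rewrite /= ?addr0 ?add0r.
have tgX n G z : tconem n G (gX n G z) = (z, 0).
  have zlin : linear (fun z : tensor X W (n + 1) G => (z, 0) : cone (tens1 W f) n G).
    by move=> a x y; congr pair; rewrite /= ?scaler0 ?addr0.
  move: z; apply: (tensor_lin_ext_succ (f := tconem n G \o gX n G) (g := mklin zlin)) => i j e x w.
  have e0 : i + j == n by rewrite addrAC in e; rewrite -(inj_eq (addIr 1)).
  rewrite -[LHS]/(tcone n G (gX n G _)) (gXE _ _ _ _ _ e0) tconeE.
  by rewrite -[RHS]/(tp e x w, 0) /= tp0l; congr pair; exact: pure_irr.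
have tgY n G z : tconem n G (gY n G z) = (0, z).
  move: z; apply: (tensor_lin_ext (f := tconem n G \o gY n G) (g := cinj (tens1 W f) n G)) => i j e y w.
  by rewrite -[LHS]/(tcone n G (gY n G _)) gYE tconeE /= tp0l.
apply: bij_qiso => [n G z e|n G [a b]]; first by rewrite -(gt n G z) e linear0.
exists (gX n G a + gY n G b); rewrite linearD tgX tgY.
by congr pair; rewrite /= ?addr0 ?add0r.
Qed.
End ConeTensor.

(** The cone of [f (x) W] is [cone f (x) W], which is acyclic because acyclic complexes of vector
    spaces are contractible. *)
Lemma tens1_qiso X X' W (f : chmap X X') : qiso f -> qiso (tens1 W f).
Proof.
move=> /qiso_cone_acyclic ac; apply: cone_acyclic_qiso => G n z hz.
have aT : acyclic_at G (tensor (cone f) W) by apply: tensor_acyclic_at.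
have q := @tconem_qiso X X' W f n G; have [_ qs] := q.
have [x hx [w hw]] := qs z hz; have [v hv] := aT n x hx.
by exists (w + tconem W f n G v); rewrite linearD hw -ccomm hv subrK.
Qed.

Definition efun_tensor W : efun k U :=
  @EFun k U (fun X => tensor X W) (fun X Y f => tens1 W f)
   (fun X Y f g => @tens1_ceq X Y W f g) (fun X => @tens1_id X W)
   (fun X Y Z g f => @tens1_comp X Y Z W g f) (fun X Y f g => @tens1_add X Y W f g)
   (fun X Y f => @tens1_qiso X Y W f).

Lemma tensor_tclosed (P : cplx k U -> Prop) W : tclosed P -> tclosed (fun X => P (tensor X W)).
Proof.
move=> c; split.
- move=> X Y f hX hY; apply/(cl_qiso c (tconem_qiso W f)); exact: cl_cone.
- move=> X Y f hY /(cl_qiso c (tconem_qiso W f)) hC; exact: (cl_fib c (f := tens1 W f)).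
- by move=> X Y /(fD_retract (efun_tensor W)); exact: cl_retract.
Qed.

Section Swap.
Variables (X Y : cplx k U).
Lemma eqC (i j n : int) : i + j == n -> j + i == n. Proof. by rewrite addrC. Qed.

Definition tswap_r n : rhom (tensor X Y n) (tensor Y X n).
Proof.
apply: (@tlift k U X Y n (tensor Y X n) (fun G i j e x y => (-1) ^ (i * j) *: tp (eqC e) y x)).
- by move=> G i j e y a x x'; rewrite tp_linr scalerDr !scalerA mulrC.
- by move=> G i j e x a y y'; rewrite tp_linl scalerDr !scalerA mulrC.
- by move=> G H u hu i j e x y; rewrite linearZ [res _ _ (tp _ _ _)]tp_res.
Defined.

Lemma tswap_rE n G i j (e : i + j == n) x y : tswap_r n G (tp e x y) = (-1) ^ (i * j) *: tp (eqC e) y x.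
Proof. exact: tliftE. Qed.

Lemma sign_sq (i : int) : (-1) ^ i * (-1) ^ i = 1 :> k.
Proof. by rewrite -expfzMl mulrNN mulr1 exp1rz. Qed.

Lemma tswap_comm n G z : tswap_r (n + 1) G (cd (tensor X Y) n G z) = cd (tensor Y X) n G (tswap_r n G z).
Proof.
move: G z; apply: (tensor_ext (f := rcomp (tswap_r (n + 1)) (cd (tensor X Y) n)) (g := rcomp (cd (tensor Y X) n) (tswap_r n))).
move=> G i j e x y.
rewrite -[LHS]/(tswap_r (n + 1) G (cd (tensor X Y) n G _)) -[RHS]/(cd (tensor Y X) n G (tswap_r n G _)).
rewrite tswap_rE (td_tp _ (eqS1 e) (eqS2 e)) linearD !linearZ /= !tswap_rE (td_tp _ (eqS1 (eqC e)) (eqS2 (eqC e))).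
rewrite scalerDr !scalerA [LHS]addrC; congr (_ *: _ + _ *: _).
- rewrite mulrDr mulr1 expfzDr ?oppr_eq0 ?oner_eq0 //.
  by rewrite [_ ^ (i * j) * _]mulrC mulrA sign_sq mul1r.
- exact: pure_irr.
- by rewrite mulrDl mul1r expfzDr ?oppr_eq0 ?oner_eq0.
- exact: pure_irr.
Qed.

Definition tswap : chmap (tensor X Y) (tensor Y X) := @ChMap k U _ _ tswap_r tswap_comm.

Lemma tswapE n G i j (e : i + j == n) x y : tswap n G (tp e x y) = (-1) ^ (i * j) *: tp (eqC e) y x.
Proof. exact: tswap_rE. Qed.
End Swap.

Lemma tswapK X Y n G z : tswap Y X n G (tswap X Y n G z) = z.
Proof.
move: n G z; apply: (chmap_tensor_ext (f := ccomp (tswap Y X) (tswap X Y)) (g := Defs.cid _)) => n G i j e x y.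
rewrite -[LHS]/(tswap Y X n G (tswap X Y n G _)) tswapE linearZ /= tswapE scalerA mulrC [j * i]mulrC sign_sq scale1r.
exact: pure_irr.
Qed.

Lemma tswap_qiso X Y : qiso (tswap X Y).
Proof. by apply: (can_qiso (g := tswap Y X)) => n G z; exact: tswapK. Qed.

(* Kuenneth: the class of [x (x) y] is detected by functionals on the factors. *)
Lemma tensor_acyclic_prime X Y G : acyclic_at G (tensor X Y) -> acyclic_at G X \/ acyclic_at G Y.
Proof.
move=> ac; case: (pselect (acyclic_at G X)) => [|nX]; [by left|right].
move=> m y hy; apply: contrapT => ny; apply: nX => n x hx; apply: contrapT => nx.
have [f [f1 f0 _]] := cofunctional nx; have [g [g1 g0 _]] := cofunctional ny.
have e : n + 1 + (m + 1) == n + 1 + m + 1 by rewrite addrA.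
have [|z hz] := ac (n + 1 + m) (tp e x y).
  by rewrite (td_tp _ (eqS1 e) (eqS2 e)) hx hy tp0l tp0r scaler0 addr0.
have tl q i j (_ : i + j == q) (v : Y j G) : linear (fun u : X i G => f i u * g j v : k^o).
  by move=> a u u'; rewrite linearP mulrDl -mulrA.
have tr q i j (_ : i + j == q) (u : X i G) : linear (fun v : Y j G => f i u * g j v : k^o).
  by move=> a v v'; rewrite linearP mulrDr mulrCA.
pose F q : {linear tensor X Y q G -> k^o} := tlin (tl q) (tr q).
have FE q i j (e' : i + j == q) u v : F q (tp e' u v) = f i u * g j v by exact: tlinE.
have F0 q u : F (q + 1) (cd (tensor X Y) q G u) = 0.
  move: u; apply: (tensor_lin_ext (f := F (q + 1) \o cd (tensor X Y) q G) (g := \0)) => i j e' u v.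
  rewrite -[LHS]/(F (q + 1) (cd (tensor X Y) q G _)) (td_tp _ (eqS1 e') (eqS2 e')) linearD linearZ /=.
  by rewrite !FE f0 g0 mul0r mulr0 scaler0 addr0.
have := congr1 (F _) hz; rewrite F0 FE f1 g1 mulr1 => /eqP; by rewrite eq_sym oner_eq0.
Qed.

End TensorFunctor.

(** * Averaging, and tensor products of free complexes *)

Section Averages.
Variables (k : fieldType) (k_char0 : [pchar k] =i pred0).

Lemma natr_neq0 (n : nat) : (0 < n)%N -> n%:R != 0 :> k.
Proof. by move/pcharf0P: k_char0 => ->; rewrite lt0n. Qed.

Definition average (V : lmodType k) (T : finType) (f : T -> V) : V := (#|T|%:R)^-1 *: \sum_t f t.

Lemma average_const (V : lmodType k) (T : finType) (f : T -> V) v : (0 < #|T|)%N ->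
  (forall t, f t = v) -> average f = v.
Proof.
move=> T0 h; rewrite /average (eq_bigr (fun=> v)) // sumr_const -scaler_nat scalerA mulVf ?scale1r //.
exact: natr_neq0.
Qed.

Lemma average_linear (V W : lmodType k) (T : finType) (g : {linear V -> W}) (f : T -> V) :
  g (average f) = average (fun t => g (f t)).
Proof. by rewrite /average linearZ linear_sum. Qed.

Lemma average_reindex (V : lmodType k) (T : finType) (p : T -> T) (f : T -> V) :
  injective p -> average (fun t => f (p t)) = average f.
Proof. by move=> ip; rewrite /average [in RHS](reindex_inj ip). Qed.

End Averages.

Section Bilinear.
Variables (k : fieldType) (U : finGroupType -> Prop).
Variables (I I' : Type) (deg : I -> int) (grp : I -> Uob U) (sym : I -> bool).
Variables (deg' : I' -> int) (grp' : I' -> Uob U) (sym' : I' -> bool).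
Variables (n n' : int) (K : Uob U) (M : lmodType k).
Variable val : fgen deg grp n K -> fgen deg' grp' n' K -> M.
Hypothesis val1 : forall b, fcompat (k := k) sym (val ^~ b).
Hypothesis val2 : forall a, fcompat (k := k) sym' (val a).

Definition fbil_r (a : fgen deg grp n K) : {linear fmod k deg' grp' sym' n' K -> M} := plift (@val2 a).

Lemma fbil_compat y : fcompat (k := k) sym (fun a => fbil_r a y).
Proof.
move=> i e f g h; move: y; apply: plin_ext => b.
by rewrite /fbil_r !plift_gen; exact: (val1 b e h).
Qed.

Definition fbil (x : fmod k deg grp sym n K) (y : fmod k deg' grp' sym' n' K) : M :=
  plift (@fbil_compat y) x.

Lemma fbil_linl y : linear (fbil ^~ y).
Proof. by move=> a u v; exact: linearP. Qed.

Lemma fbil_linr x : linear (fbil x).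
Proof.
(* The lift unfolds to a finite sum over a representative of [x], which exposes the dependence on
   [y]. *)
have E y : fbil x y = \sum_(c <- generic_quotient.repr x) c.1 *: fbil_r c.2 y by [].
move=> a u v; rewrite !E scaler_sumr -big_split.
by apply: eq_bigr => c _; rewrite (linearP (fbil_r c.2)) scalerDr !scalerA mulrC.
Qed.

Lemma fbilE i (e : deg i = n) (f : surj K (grp i)) i' (e' : deg' i' = n') (f' : surj K (grp' i')) :
  fbil (fg k sym e f) (fg k sym' e' f') = val (FGen e f) (FGen e' f').
Proof. by rewrite /fbil [LHS]plift_gen; exact: plift_gen. Qed.
End Bilinear.

Section ConjSurj.
Variable U : finGroupType -> Prop.
Implicit Types G H K : Uob U.

Lemma conjs_mul K G (f : surj K G) (x : G) : {morph (fun y => f y ^ x)%g : y z / (y * z)%g}.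
Proof. by move=> y z; rewrite gmulfM conjMg. Qed.

Lemma conjs_surj K G (f : surj K G) (x : G) : surjective (fun y => f y ^ x)%g.
Proof. by move=> y; have [z hz] := surjP f (y ^ x^-1)%g; exists z; rewrite hz conjgKV. Qed.

Definition conjs K G (f : surj K G) (x : G) : surj K G :=
  @Surj U K G (mkmult (conjs_mul f x)) (conjs_surj f x).

Lemma conjs_twist s K G (f : surj K G) (x : G) : stwist s f (conjs f x).
Proof. by left; exists x. Qed.

End ConjSurj.

Section FreeTensor.
Variables (k : fieldType) (k_char0 : [pchar k] =i pred0) (U : finGroupType -> Prop) (U_down : downward_closed U).
Implicit Types G H K : Uob U.

Section Image.
Variables (K G H : Uob U) (f : surj K G) (g : surj K H).
Let pr (x : K) : (Ugrp G * Ugrp H)%type := (f x, g x).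

Lemma image_group_set : group_set (pr @: [set: Ugrp K])%SET.
Proof.
have prM x y : pr (x * y)%g = (pr x * pr y)%g by rewrite /pr !gmulfM.
have pr1 : pr 1%g = 1%g.
  by apply: (mulgI (pr 1%g)); rewrite -prM !mulg1.
apply/group_setP; split; first by rewrite -pr1 imset_f.
by move=> _ _ /imsetP[x _ ->] /imsetP[y _ ->]; rewrite -prM imset_f.
Qed.

Definition image_group : {group (Ugrp G * Ugrp H)%type} := Group image_group_set.

Lemma image_mem x : pr x \in image_group. Proof. exact: imset_f. Qed.

Definition corestr (x : K) : subg_of image_group := Subg (image_mem x).

Lemma corestrM : {morph corestr : x y / (x * y)%g}.
Proof. by move=> x y; apply: val_inj => /=; rewrite /pr !gmulfM. Qed.

Lemma corestr_surj : surjective corestr.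
Proof. by move=> [y hy]; have /imsetP[x _ e] := hy; exists x; apply: val_inj. Qed.

Lemma image_U : U (subg_of image_group).
Proof. exact: (U_down (f := mkmult corestrM) (svalP K) corestr_surj). Qed.
End Image.

Definition subdirect G H (L : {group (Ugrp G * Ugrp H)%type}) : Prop :=
  [/\ U (subg_of L), surjective (fun x : subg_of L => (sgval x).1) & surjective (fun x : subg_of L => (sgval x).2)].

Lemma image_subdirect K G H (f : surj K G) (g : surj K H) : subdirect (image_group f g).
Proof.
split; first exact: image_U.
- by move=> y; have [x e] := surjP f y; exists (corestr f g x).
- by move=> y; have [x e] := surjP g y; exists (corestr f g x).
Qed.

Variables (I I' : finType) (deg : I -> int) (grp : I -> Uob U) (deg' : I' -> int) (grp' : I' -> Uob U).
Local Notation F1 := (ffree k deg grp (fun=> false)).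
Local Notation F2 := (ffree k deg' grp' (fun=> false)).

(* A pair of surjections [K -> G], [K -> H] factors through its image, a subdirect
   product, so free (x) free is spanned by the classes of subdirect products [L];
   averaging over conjugation by [G x H] makes it a retract of the free complex on
   them, which is where characteristic zero enters. *)
Definition sd_idx0 := {i : I & {i' : I' & {group (Ugrp (grp i) * Ugrp (grp' i'))%type}}}.
Definition sd_idx := {t : sd_idx0 | `[< subdirect (projT2 (projT2 t)) >]}.
Definition sd_left (t : sd_idx) : I := projT1 (sval t).
Definition sd_right (t : sd_idx) : I' := projT1 (projT2 (sval t)).
Definition sd_group (t : sd_idx) : {group (Ugrp (grp (sd_left t)) * Ugrp (grp' (sd_right t)))%type} := projT2 (projT2 (sval t)).
Lemma sd_groupP (t : sd_idx) : subdirect (sd_group t). Proof. exact/asboolP/(svalP t). Qed.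
Definition sd_grp (t : sd_idx) : Uob U := exist U (subg_of (sd_group t)) (let: And3 h _ _ := sd_groupP t in h).
Definition sd_deg (t : sd_idx) : int := deg (sd_left t) + deg' (sd_right t).
Definition sd_free := ffree k sd_deg sd_grp (fun=> false).

Definition mk_sd_idx i i' (L : {group (Ugrp (grp i) * Ugrp (grp' i'))%type}) (h : subdirect L) : sd_idx :=
  exist _ (existT _ i (existT _ i' L)) (introT (asboolP _) h).

(** The index of a generator contains the subgroup, so the two subgroups must first be identified:
    each is the image of its surjection. *)
Lemma sd_fg_eq n K i i' (L L' : {group (Ugrp (grp i) * Ugrp (grp' i'))%type}) (h : subdirect L) (h' : subdirect L')
   (e : sd_deg (mk_sd_idx h) = n) (e' : sd_deg (mk_sd_idx h') = n) (s : surj K (sd_grp (mk_sd_idx h))) (s' : surj K (sd_grp (mk_sd_idx h'))) :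
  (forall x, sgval (s x) = sgval (s' x)) -> fg k (fun=> false) e s = fg k (fun=> false) e' s'.
Proof.
move=> es; have eL : L = L'.
  apply/group_inj/setP => y; apply/idP/idP => hy.
    by have [x hx] := surjP s (Subg hy); have := subgP (s' x); rewrite -es hx.
  by have [x hx] := surjP s' (Subg hy); have := subgP (s x); rewrite es hx.
destruct eL; rewrite (Prop_irrelevance h h') in e e' s s' es *.
rewrite (eq_irrelevance e e'); congr (fg _ _ _ _); apply: surj_eq => x; apply: val_inj; exact: es.
Qed.

Lemma sd_pr1_mul (t : sd_idx) : {morph (fun x : subg_of (sd_group t) => (sgval x).1) : x y / (x * y)%g}.
Proof. by []. Qed.
Lemma sd_pr2_mul (t : sd_idx) : {morph (fun x : subg_of (sd_group t) => (sgval x).2) : x y / (x * y)%g}.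
Proof. by []. Qed.
Definition sd_pr1 (t : sd_idx) : surj (sd_grp t) (grp (sd_left t)) :=
  @Surj U (sd_grp t) (grp (sd_left t)) (mkmult (@sd_pr1_mul t)) (let: And3 _ h _ := sd_groupP t in h).
Definition sd_pr2 (t : sd_idx) : surj (sd_grp t) (grp' (sd_right t)) :=
  @Surj U (sd_grp t) (grp' (sd_right t)) (mkmult (@sd_pr2_mul t)) (let: And3 _ _ h := sd_groupP t in h).

Definition tz (t : sd_idx) : tensor F1 F2 (sd_deg t) (sd_grp t) :=
  @tp k U F1 F2 _ _ (deg (sd_left t)) (deg' (sd_right t)) (eqxx _)
    (fg k (fun=> false) erefl (sd_pr1 t)) (fg k (fun=> false) erefl (sd_pr2 t)).

Lemma ftensor_d0 n G (z : tensor F1 F2 n G) : cd (tensor F1 F2) n G z = 0.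
Proof.
move: z; apply: (tensor_lin_ext (f := cd (tensor F1 F2) n G) (g := \0)) => i j e x y.
by rewrite (td_tp _ (eqS1 e) (eqS2 e)) tp0l tp0r scaler0 addr0.
Qed.

Definition tretr : chmap sd_free (tensor F1 F2) :=
  @fchain k U sd_idx sd_deg sd_grp (fun=> false) (tensor F1 F2) tz
    (fun t K u v => @nosym_inv k U sd_idx sd_grp (fun=> false) (fun=> erefl) (tensor F1 F2 (sd_deg t)) t (tz t) K u v)
    (fun t => ftensor_d0 (tz t)).

Section SubdirectSection.
Variables (n i0 j0 : int) (e : i0 + j0 == n) (K : Uob U).

Definition cores i i' (f : surj K (grp i)) (g : surj K (grp' i')) : surj K (sd_grp (mk_sd_idx (image_subdirect f g))) :=
  @Surj U K (sd_grp (mk_sd_idx (image_subdirect f g))) (mkmult (corestrM f g)) (@corestr_surj K _ _ f g).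

Lemma cores_deg i i' (d : deg i = i0) (d' : deg' i' = j0) (f : surj K (grp i)) (g : surj K (grp' i')) :
  sd_deg (mk_sd_idx (image_subdirect f g)) = n.
Proof. by rewrite /sd_deg /sd_left /sd_right /= d d'; exact/eqP. Qed.

Definition tcoord i i' (d : deg i = i0) (d' : deg' i' = j0) (f : surj K (grp i)) (g : surj K (grp' i')) : sd_free n K :=
  fg k (fun=> false) (cores_deg d d' f g) (cores f g).

Definition tval (a : fgen deg grp i0 K) (b : fgen deg' grp' j0 K) : sd_free n K :=
  average (fun t : (Ugrp (grp (fidx a)) * Ugrp (grp' (fidx b)))%type =>
    tcoord (fdeg a) (fdeg b) (conjs (fsurj a) t.1) (conjs (fsurj b) t.2)).

(** Conjugating [f] permutes the terms of the average by a translation. A single term would not be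
    invariant, as the image subgroup depends on the representative. *)
Lemma tval1 b : fcompat (k := k) (fun=> false) (tval ^~ b).
Proof.
move=> i d f g [[h eh]|[]//]; rewrite /tval /=.
rewrite -(average_reindex (p := fun t : (Ugrp (grp i) * Ugrp (grp' (fidx b)))%type => ((h * t.1)%g, t.2))); last first.
  by move=> [x y] [x' y'] [/mulgI -> ->].
congr average; apply/funext => -[x y] /=; congr (tcoord _ _ _ _).
by apply: surj_eq => z; rewrite /= eh conjgM.
Qed.

Lemma tval2 a : fcompat (k := k) (fun=> false) (tval a).
Proof.
move=> i d f g [[h eh]|[]//]; rewrite /tval /=.
rewrite -(average_reindex (p := fun t : (Ugrp (grp (fidx a)) * Ugrp (grp' i))%type => (t.1, (h * t.2)%g))); last first.
  by move=> [x y] [x' y'] [-> /mulgI ->].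
congr average; apply/funext => -[x y] /=; congr (tcoord _ _ _ _).
by apply: surj_eq => z; rewrite /= eh conjgM.
Qed.

Definition tsect_val (x : F1 i0 K) (y : F2 j0 K) : sd_free n K := fbil tval1 tval2 x y.

Lemma tsect_valE i (d : deg i = i0) (f : surj K (grp i)) i' (d' : deg' i' = j0) (g : surj K (grp' i')) :
  tsect_val (fg k (fun=> false) d f) (fg k (fun=> false) d' g) =
  average (fun t : (Ugrp (grp i) * Ugrp (grp' i'))%type => tcoord d d' (conjs f t.1) (conjs g t.2)).
Proof. exact: fbilE. Qed.
End SubdirectSection.

Lemma fmod_bil_ext (J J' : Type) (dg : J -> int) (gr : J -> Uob U) (dg' : J' -> int) (gr' : J' -> Uob U)
    (s : J -> bool) (s' : J' -> bool) n n' K (M : lmodType k)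
    (p q : fmod k dg gr s n K -> fmod k dg' gr' s' n' K -> M) :
  (forall y, linear (p ^~ y)) -> (forall x, linear (p x)) ->
  (forall y, linear (q ^~ y)) -> (forall x, linear (q x)) ->
  (forall i (e : dg i = n) f i' (e' : dg' i' = n') f', p (fg k s e f) (fg k s' e' f') = q (fg k s e f) (fg k s' e' f')) ->
  forall x y, p x y = q x y.
Proof.
move=> pl pr ql qr h x y.
move: x; apply: (plin_ext (f := mklin (pl y)) (g := mklin (ql y))) => -[i e f].
move: y; apply: (plin_ext (f := mklin (pr _)) (g := mklin (qr _))) => -[i' e' f'].
exact: h.
Qed.

Lemma tsect_nat n K H (u : {multiplicative Ugrp K -> Ugrp H}) (hu : surjective u) i0 j0 (e : i0 + j0 == n) x y :
  tsect_val e (res (F1 i0) hu x) (res (F2 j0) hu y) = res (sd_free n) hu (tsect_val e x y).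
Proof.
move: x y; apply: (fmod_bil_ext (p := fun x y => tsect_val e (res (F1 i0) hu x) (res (F2 j0) hu y))
  (q := fun x y => res (sd_free n) hu (tsect_val e x y))).
- by move=> y a v w; rewrite linearP; exact: fbil_linl.
- by move=> x a v w; rewrite linearP; exact: fbil_linr.
- by move=> y a v w; rewrite -linearP; congr (res _ _ _); exact: fbil_linl.
- by move=> x a v w; rewrite -linearP; congr (res _ _ _); exact: fbil_linr.
move=> i d f i' d' f'.
rewrite [res (F1 i0) _ _](fres_fg k _ (Surj hu)) [res (F2 j0) _ _](fres_fg k _ (Surj hu)) !tsect_valE average_linear.
congr average; apply/funext => -[x y].
by rewrite /tcoord [RHS](fres_fg k _ (Surj hu)); apply: sd_fg_eq.
Qed.

Lemma tsect_tl n G i j (e : i + j == n) (y : F2 j G) : linear (fun x : F1 i G => tsect_val e x y).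
Proof. exact: fbil_linl. Qed.
Lemma tsect_tr n G i j (e : i + j == n) (x : F1 i G) : linear (tsect_val e x).
Proof. exact: fbil_linr. Qed.

Definition tsect_r n : rhom (tensor F1 F2 n) (sd_free n) :=
  @tlift k U F1 F2 n (sd_free n) (fun G i j e x y => tsect_val e x y) (@tsect_tl n) (@tsect_tr n)
    (fun G H f hf i j e x y => tsect_nat hf e x y).

Lemma tsect_comm n G z : tsect_r (n + 1) G (cd (tensor F1 F2) n G z) = cd sd_free n G (tsect_r n G z).
Proof. by rewrite ftensor_d0 linear0. Qed.

Definition tsect : chmap (tensor F1 F2) sd_free := @ChMap k U _ _ tsect_r tsect_comm.

(** Every term of the average returns the same tensor, since generators of the factors depend on
    conjugacy classes only. *)
Lemma tretr_tsect n G z : tretr n G (tsect n G z) = z.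
Proof.
move: G z; apply: (tensor_ext (f := rcomp (tretr n) (tsect n)) (g := rid _)) => G i j e.
apply: (fmod_bil_ext (p := fun (x : F1 i G) (y : F2 j G) => tretr n G (tsect n G (tp e x y)))
  (q := fun (x : F1 i G) (y : F2 j G) => tp e x y)).
- by move=> y a v w; rewrite tp_linl !linearP.
- by move=> x a v w; rewrite tp_linr !linearP.
- by move=> y; exact: (tp_linl (X := F1) (Y := F2) e y).
- by move=> x; exact: (tp_linr (X := F1) (Y := F2) e x).
move=> l d f l' d' g.
rewrite [tsect n G _]tliftE tsect_valE average_linear.
apply: (average_const k_char0); first by apply/card_gt0P; exists (1%g, 1%g).
move=> [x y]; rewrite /tcoord [LHS]fchainE /tz.
destruct d, d'.
pose dd := cores_deg e erefl erefl (conjs f x) (conjs g y).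
rewrite -[cores_deg _ _ _ _ _]/dd; clearbody dd; destruct dd; rewrite ccast_id tp_sres.
rewrite !frep_sres (bool_irrelevance e (eqxx _)); congr (tp _ _ _); symmetry.
  by rewrite (fg_twist k erefl (conjs_twist _ f x)); congr (fg _ _ _ _); exact: surj_eq.
by rewrite (fg_twist k erefl (conjs_twist _ g y)); congr (fg _ _ _ _); exact: surj_eq.
Qed.

Lemma perf_free_tensor : perf (tensor F1 F2).
Proof.
apply: (@perf_retract k U _ sd_free) (perf_free k _ _).
exists (dmap tsect), (dmap tretr); rewrite -deq_map_comp; apply: dmap_ceq => n G x.
exact: tretr_tsect.
Qed.

End FreeTensor.

Section PerfTensor.
Variables (k : fieldType) (k_char0 : [pchar k] =i pred0) (U : finGroupType -> Prop) (U_down : downward_closed U).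

(** Induction on each factor, the symmetry moving the second to the front, down to products of free
    complexes. *)
Lemma perf_tensor (X Y : cplx k U) : perf X -> perf Y -> perf (tensor X Y).
Proof.
have clT W := tensor_tclosed W (@perf_tclosed k U).
have free1 (I : finType) (deg : I -> int) (grp : I -> Uob U) (Z : cplx k U) :
    perf Z -> perf (tensor Z (ffree k deg grp (fun=> false))).
  move: Z; apply: (perf_ind_tclosed (clT _)) => J dg gr; exact: perf_free_tensor.
move=> pX pY; apply/(cl_qiso (@perf_tclosed k U) (tswap_qiso Y X)).
move: Y pY; apply: (perf_ind_tclosed (clT X)) => I deg grp.
by apply/(cl_qiso (@perf_tclosed k U) (tswap_qiso X _)); exact: free1.
Qed.

Lemma compact_tensor (X Y : cplx k U) : compact X -> compact Y -> compact (tensor X Y).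
Proof. by rewrite !compact_perf; exact: perf_tensor. Qed.

End PerfTensor.

(** * Representables, the unit and constant complexes *)

Section FiniteSurjections.
Variable U : finGroupType -> Prop.
Implicit Types G H K : Uob U.

(** A finite type in bijection with [surj G H], over which averages can be formed. *)
Definition surjT G H := {t : {ffun Ugrp G -> Ugrp H} | `[< exists s : surj G H, forall x, s x = t x >]}.

Definition surjT_val G H (t : surjT G H) : surj G H :=
  projT1 (boolp.cid (asboolP _ (svalP t))).

Lemma surjT_mk_subproof G H (s : surj G H) : `[< exists s' : surj G H, forall x, s' x = [ffun x => s x] x >].
Proof. by apply/asboolP; exists s => x; rewrite ffunE. Qed.

Definition surjT_mk G H (s : surj G H) : surjT G H := exist _ [ffun x => s x] (surjT_mk_subproof s).

Lemma surjT_mkK G H (s : surj G H) : surjT_val (surjT_mk s) = s.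
Proof.
apply: surj_eq => x; rewrite /surjT_val; case: boolp.cid => s' /= ->.
by rewrite ffunE.
Qed.

Lemma surjT_valK G H (t : surjT G H) : surjT_mk (surjT_val t) = t.
Proof.
apply: val_inj; apply/ffunP => x /=; rewrite ffunE /surjT_val.
by case: boolp.cid => s' /= ->.
Qed.

Lemma surjT_reindex K G H (a : surj K G) : injective (fun t : surjT G H => surjT_mk (scomp (surjT_val t) a)).
Proof.
move=> t t' /(congr1 (@surjT_val K H)); rewrite !surjT_mkK => e.
rewrite -(surjT_valK t) -(surjT_valK t'); congr surjT_mk; apply: surj_eq => y.
have [x <-] := surjP a y; exact: (congr1 (fun s : surj K H => s x) e).
Qed.

Lemma surj_auto G H (f : surj G H) : (#|G| <= #|H|)%N ->
  exists g : surj H G, cancel f g /\ cancel g f.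
Proof.
move=> le; have /dep_choice[g fg] := surjP f.
have gi : injective g := can_inj fg.
have gf : cancel f g.
  have [|h hK Kh] := @inj_card_bij _ _ g gi; first exact: le.
  by move=> x; rewrite -{1}(Kh x) fg Kh.
have gM : {morph g : x y / (x * y)%g}.
  by move=> x y; rewrite -{1}(fg x) -{1}(fg y) -gmulfM gf.
have gS : surjective g by move=> x; exists (f x).
by exists (@Surj U H G (mkmult gM) gS).
Qed.

Lemma surj_iso_isog G H (f : surj G H) (g : surj H G) : cancel f g -> Uiso G H.
Proof.
move=> fK; have fM : {in [set: Ugrp G]%SET &, {morph f : x y / (x * y)%g}} by move=> x y _ _; exact: gmulfM.
apply/isogP; exists (Morphism fM); first by apply/injmP => x y _ _; exact: (can_inj fK).
by apply/setP => y; rewrite inE; apply/imsetP; have [x <-] := surjP f y; exists x; rewrite ?inE.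
Qed.

Lemma Uiso_giso G H : Uiso G H -> giso G H.
Proof.
move=> /isogP[f /injmP fi fS].
have fM : {morph f : x y / (x * y)%g} by move=> x y; rewrite morphM ?inE.
have fs : surjective f.
  move=> y; have : y \in (f @* [set: Ugrp G])%g by rewrite fS inE.
  by case/morphimP => x _ _ ->; exists x.
have [|g [fg gf]] := surj_auto (@Surj U G H (mkmult fM) fs); last by exists (@Surj U G H (mkmult fM) fs), g.
by apply: (leq_card f) => x y; apply: fi; rewrite inE.
Qed.

End FiniteSurjections.

Section Cells.
Variables (k : fieldType) (U : finGroupType -> Prop).
Implicit Types (X Y : cplx k U) (G H K : Uob U).

(** In degree [m], this is [e_G] for [s = false] and [f_G] for [s = true]. *)
Definition cell (m : int) (s : bool) G : cplx k U := @ffree k U unit (fun=> m) (fun=> G) (fun=> s).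

Definition cg m s G n K (e : m = n) (f : surj K G) : cell m s G n K :=
  @fg k U unit (fun=> m) (fun=> G) (fun=> s) n K tt e f.

Lemma cell_lin_ext m s G n K (M : lmodType k) (f g : {linear cell m s G n K -> M}) :
  (forall (e : m = n) (u : surj K G), f (cg s e u) = g (cg s e u)) -> f =1 g.
Proof. by move=> h; apply: plin_ext => -[[] e u]; exact: h. Qed.

Lemma cg_twist m s G n K (e : m = n) (f g : surj K G) : stwist s f g -> cg s e f = cg s e g.
Proof. exact: fg_twist. Qed.

Lemma cg_res m s G n K H (u : {multiplicative Ugrp H -> Ugrp K}) (hu : surjective u) (e : m = n) (f : surj K G) :
  res (cell m s G n) hu (cg s e f) = cg s e (scomp f (Surj hu)).
Proof. exact: (fres_fg k _ (Surj hu)). Qed.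

Lemma cell_acyclic_at m s G K : (surj K G -> False) -> acyclic_at K (cell m s G).
Proof.
move=> h n z _; exists 0; rewrite linear0; symmetry; move: z.
by apply: (cell_lin_ext (f := idfun) (g := \0)) => e u; case: (h u).
Qed.

Lemma ccoef_compat m s G n K : @fcompat k U unit (fun=> m) (fun=> G) (fun=> s) n K k^o (fun=> 1).
Proof. by []. Qed.

Definition ccoef m s G n K : {linear cell m s G n K -> k^o} := plift (@ccoef_compat m s G n K).

Lemma ccoef_cg m s G n K e (f : surj K G) : ccoef m s G n K (cg s e f) = 1.
Proof. exact: plift_gen. Qed.

Lemma cellE m s G K (f : surj K G) (a : cell m s G m K) : (forall g : surj K G, stwist s g f) ->
  a = ccoef m s G m K a *: cg s erefl f.
Proof.
move=> h.
have lin : linear (fun a : cell m s G m K => ccoef m s G m K a *: (cg s erefl f : cell m s G m K)).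
  by move=> c x y; rewrite linearP scalerDl scalerA.
move: a; apply: (cell_lin_ext (f := idfun) (g := mklin lin)) => e g.
rewrite -[RHS]/(ccoef m s G m K (cg s e g) *: cg s erefl f) ccoef_cg scale1r (eq_irrelevance e erefl).
exact: cg_twist.
Qed.

Lemma cell0 m s G n K (a : cell m s G n K) : m != n -> a = 0.
Proof.
move=> ne; move: a; apply: (cell_lin_ext (f := idfun) (g := \0)) => e f.
by rewrite e eqxx in ne.
Qed.

Lemma cell_not_acyclic s G : ~ acyclic_at G (cell 0 s G).
Proof.
(* Degree 0 is reached as [-1 + 1]. The sum of coefficients is 1 on the generator, while 0 is the
   only boundary. *)
move=> /(_ (-1) (cg s (erefl (0 : int)) (sid G)) erefl)[w] /(congr1 (ccoef 0 s G (-1 + 1) G)).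
rewrite ccoef_cg linear0 => /eqP; rewrite eq_sym; apply/negP; exact: oner_neq0.
Qed.

Definition cell_up m s G : chmap (cell m s G) (shift (cell (m + 1) s G)).
Proof.
apply: (@fchain k U unit (fun=> m) (fun=> G) (fun=> s) (shift (cell (m + 1) s G)) (fun=> cg s erefl (sid G))).
- by move=> _ K f g h; rewrite /sres !cg_res; apply: cg_twist; exact: h.
- by move=> _; rewrite /= oppr0.
Defined.

Lemma cell_upE m s G n K (e : m = n) (f : surj K G) : cell_up m s G n K (cg s e f) = cg s (congr1 (+%R^~ 1) e) f.
Proof.
destruct e; rewrite [LHS]fchainE ccast_id /sres cg_res.
by rewrite (eq_irrelevance (congr1 _ _) erefl); congr cg; exact: surj_eq.
Qed.

Lemma cell_up_qiso m s G : qiso (cell_up m s G).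
Proof.
pose d n K (a : @fgen U unit (fun=> m + 1) (fun=> G) (n + 1) K) : cell m s G n K := cg s (addIr _ (fdeg a)) (fsurj a).
have dc n K : @fcompat k U unit (fun=> m + 1) (fun=> G) (fun=> s) (n + 1) K (cell m s G n K) (@d n K).
  by move=> i e f g h; exact: cg_twist.
pose D n K : {linear cell (m + 1) s G (n + 1) K -> cell m s G n K} := plift (@dc n K).
have DE n K (e : m + 1 = n + 1) f : D n K (cg s e f) = cg s (addIr _ e) f by exact: plift_gen.
apply: bij_qiso => [n K x e|n K y].
  suff h : D n K (cell_up m s G n K x) = x by rewrite -h e linear0.
  move: x {e}; apply: (cell_lin_ext (f := D n K \o cell_up m s G n K) (g := idfun)) => e f.
  rewrite /= cell_upE DE; congr cg; exact: eq_irrelevance.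
exists (D n K y); move: y.
apply: (cell_lin_ext (f := cell_up m s G n K \o D n K) (g := idfun)) => e f.
rewrite /= DE cell_upE; congr cg; exact: eq_irrelevance.
Qed.

Lemma cell_degree (P : cplx k U -> Prop) m s G : tclosed P -> P (cell m s G) <-> P (cell 0 s G).
Proof.
move=> cP; have step n : P (cell n s G) <-> P (cell (n + 1) s G).
  by rewrite (cl_qiso cP (cell_up_qiso n s G)) -cl_shift.
elim/int_ind: m => [//|n IH|n IH].
  by rewrite intS addrC -step.
have -> : - n.+1%:Z = - n%:Z - 1 by rewrite intS opprD addrC.
by rewrite -IH step subrK.
Qed.

Lemma cell_perf m G : perf (cell m false G).
Proof. exact: (perf_free k (I := unit)). Qed.

End Cells.

Section Unit.
Variables (k : fieldType) (U : finGroupType -> Prop) (T0 : Uob U) (T0_triv : forall x : T0, x = 1%g).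
Implicit Types (X : cplx k U) (G H K : Uob U).

(** Each group has exactly one surjection to [T0], so this is constant with value [k]. The group
    [T0] is a parameter because [U] may be empty. *)
Definition uobj := cell k 0 false T0.

Lemma tsurj_mul G : {morph (fun _ : G => 1%g : T0) : x y / (x * y)%g}.
Proof. by move=> x y; rewrite mulg1. Qed.
Lemma tsurj_surj G : surjective (fun _ : G => 1%g : T0).
Proof. by move=> y; exists 1%g; rewrite [RHS]T0_triv. Qed.
Definition tsurj G : surj G T0 := @Surj U G T0 (mkmult (@tsurj_mul G)) (@tsurj_surj G).

Lemma tsurj_uniq G (f g : surj G T0) : f = g.
Proof. by apply: surj_eq => x; rewrite [LHS]T0_triv [RHS]T0_triv. Qed.

Definition uone G : uobj 0 G := cg k false erefl (tsurj G).

Lemma uobjE G (a : uobj 0 G) : a = ccoef k 0 false T0 0 G a *: uone G.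
Proof. by apply: cellE => g; left; exists 1%g => x; rewrite [LHS]T0_triv [RHS]T0_triv. Qed.

Lemma add0n_eq (n : int) : 0 + n == n. Proof. by rewrite add0r. Qed.

Section UnitMap.
Variable X : cplx k U.

Definition unitor_r n : rhom (X n) (tensor uobj X n).
Proof.
apply: (@mkrhom k U (X n) (tensor uobj X n) (fun G x => tp (add0n_eq n) (uone G) x)).
- by move=> G; exact: tp_linr.
- move=> G H u hu x; rewrite tp_res; congr tp.
  by rewrite [RHS]cg_res; congr cg; exact: tsurj_uniq.
Defined.

Lemma unitor_comm n G x : unitor_r (n + 1) G (cd X n G x) = cd (tensor uobj X) n G (unitor_r n G x).
Proof.
rewrite -[LHS]/(tp _ _ _) -[unitor_r n G x]/(tp (add0n_eq n) (uone G) x).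
rewrite (td_tp _ (eqS1 (add0n_eq n)) (eqS2 (add0n_eq n))) tp0l add0r expr0z scale1r.
exact: pure_irr.
Qed.

Definition unitor : chmap X (tensor uobj X) := @ChMap k U _ _ unitor_r unitor_comm.

Lemma unitorE n G x : unitor n G x = tp (add0n_eq n) (uone G) x. Proof. by []. Qed.

Lemma unitor_qiso : qiso unitor.
Proof.
pose t n G i j (e : i + j == n) (a : uobj i G) (x : X j G) : X n G :=
  if @eqP _ j n is ReflectT e' then ccoef k 0 false T0 i G a *: ccast X e' G x else 0.
have tl n G i j (e : i + j == n) x : linear (fun a => t n G i j e a x).
  by move=> c a b; rewrite /t; case: eqP => e'; rewrite ?linearP ?scalerDl ?scalerA // scaler0 addr0.
have tr n G i j (e : i + j == n) a : linear (t n G i j e a).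
  move=> c x y; rewrite /t; case: eqP => e'; last by rewrite scaler0 addr0.
  by rewrite linearP scalerDr !scalerA mulrC.
pose T n G : {linear tensor uobj X n G -> X n G} := tlin (tl n G) (tr n G).
apply: bij_qiso => [n G x e|n G y].
  rewrite -[x](_ : T n G (unitor n G x) = x); first by rewrite e linear0.
  rewrite unitorE [LHS]tlinE /t; case: eqP => // e'.
  by rewrite ccast_id ccoef_cg scale1r.
exists (T n G y); move: y; apply: (tensor_lin_ext (f := unitor n G \o T n G) (g := idfun)) => i j e a x.
rewrite -[LHS]/(unitor n G (T n G _)) [T n G _]tlinE /t; case: eqP => [e'|ne].
  have i0 : i = 0 by apply/(addIr j); rewrite (eqP e) add0r.
  destruct e'; subst i.
  rewrite ccast_id unitorE tpZr -tpZl -uobjE; exact: pure_irr.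
rewrite linear0 [a]cell0 ?tp0l //.
by apply/eqP => i0; case: ne; rewrite -(eqP e) -i0 add0r.
Qed.
End UnitMap.
End Unit.

Section Constant.
Variables (k : fieldType) (U : finGroupType -> Prop) (G : Uob U).
Implicit Types (X Y : cplx k U) (H K : Uob U).

Definition constr (V : rep k U) : rep k U :=
  @Rep k U (fun=> V G) (fun _ _ _ _ => idfun) (fun _ _ _ _ _ _ _ _ => erefl) (fun _ _ _ _ _ => erefl)
    (fun _ _ _ _ _ _ _ _ _ _ _ => erefl).

Definition constrm (V W : rep k U) (f : rhom V W) : rhom (constr V) (constr W) :=
  @RHom k U (constr V) (constr W) (fun=> f G) (fun _ _ _ _ _ => erefl).

Definition constc X : cplx k U :=
  @Cplx k U (fun n => constr (X n)) (fun n => constrm (cd X n)) (fun n _ x => cdd x).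

Definition constm X Y (f : chmap X Y) : chmap (constc X) (constc Y) :=
  @ChMap k U (constc X) (constc Y) (fun n => constrm (f n)) (fun n _ x => ccomm f x).

Lemma constm_qiso X Y (f : chmap X Y) : qiso f -> qiso (constm f).
Proof. by move=> q n H; exact: (q n G). Qed.

Definition efun_const : efun k U :=
  @EFun k U constc constm (fun X Y f g h n _ => h n G) (fun X n _ x => erefl)
    (fun X Y Z g f n _ x => erefl) (fun X Y f g n _ x => erefl) constm_qiso.

Lemma constc_acyclic X : acyclic (constc X) <-> acyclic_at G X.
Proof. by split=> h; [exact: (h G)|move=> H; exact: h]. Qed.

Definition constc_cone X Y (f : chmap X Y) : chmap (constc (cone f)) (cone (constm f)) :=
  @ChMap k U (constc (cone f)) (cone (constm f))
    (fun n => @RHom k U (constc (cone f) n) (cone (constm f) n) (fun=> idfun) (fun _ _ _ _ '(x, y) => erefl))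
    (fun _ _ _ => erefl).

Lemma constc_cone_qiso X Y (f : chmap X Y) : qiso (constc_cone f).
Proof. by apply: bij_qiso => [n H x|n H y]; [|exists y]. Qed.

Lemma constc_tclosed (P : cplx k U -> Prop) : tclosed P -> tclosed (fun X => P (constc X)).
Proof.
move=> c; split.
- by move=> X Y f hX hY; apply/(cl_qiso c (constc_cone_qiso f)); exact: cl_cone.
- by move=> X Y f hY /(cl_qiso c (constc_cone_qiso f)) hC; exact: (cl_fib c (f := constm f)).
- by move=> X Y /(fD_retract efun_const); exact: cl_retract.
Qed.

(** A retract in D(U) need not be one of complexes, so vanishing of the identity is first turned
    into a null-homotopy on a resolution. *)
Lemma acyclic_retract X Y : retract X Y -> acyclic Y -> acyclic X.
Proof.
move=> [i [r e]] aY; have [Q [q [kQ qq]]] := kproj_resolution X.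
have idX : deq (did X) (dzero X X).
  by rewrite -e -(deq_id_comp i) (acyclic_id0 aY) dzero_l dzero_r.
have /(kproj_faithful0 kQ)[h hh] : deq (dmap (Defs.cid Q)) (dzero Q Q).
  apply: (qiso_mono qq); rewrite deq_comp_id dzero_r -(deq_id_comp (dmap q)) idX; exact: dzero_l.
have aQ : acyclic Q.
  by move=> H n z hz; exists (h n H z); rewrite [RHS]hh hz linear0 addr0.
move=> H n z hz; have [_ sq] := qq n H; have [x hx [w hw]] := sq z hz.
have [v hv] := aQ H n x hx.
by exists (w + q n H v); rewrite linearD hw -ccomm hv subrK.
Qed.

(** For retracts, evaluation at [G] is made a functor on D(U) by passing to constant complexes. *)
Lemma acyclic_at_tclosed : tclosed (@acyclic_at k U G).
Proof.
split=> [X Y f aX aY n|X Y f aY aC|X Y r aY].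
- apply: cone_acyclic_at => [z hz _|y hy]; first exact: aX.
  by exists 0; rewrite linear0 // subr0; exact: aY.
- apply: int_succ_ind => n z hz; have [|w hw] := aY (n + 1) (f _ _ z); first by rewrite -ccomm hz linear0.
  have [|[v v'] /= hv] := aC n (z, - w).
    by rewrite cone_dE hz linearN hw subrr oppr0.
  by exists (- v); rewrite linearN; case: hv.
- apply/constc_acyclic; apply: acyclic_retract (fD_retract efun_const r) _.
  exact/constc_acyclic.
Qed.

End Constant.

Section ConstantPerfect.
Variables (k : fieldType) (k_char0 : [pchar k] =i pred0) (U : finGroupType -> Prop).
Variables (T0 : Uob U) (T0_triv : forall x : T0, x = 1%g) (G : Uob U).

Section Cells.
Variables (I : finType) (deg : I -> int) (grp : I -> Uob U).
Local Notation F := (ffree k deg grp (fun=> false)).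

(** One copy of the unit per surjection, while [F(G)] is spanned by conjugacy classes of them:
    averaging over conjugation makes the constant complex a retract. *)
Definition kidx := {i : I & surjT G (grp i)}.
Definition kdeg (t : kidx) : int := deg (projT1 t).
Local Notation F' := (ffree k kdeg (fun=> T0) (fun=> false)).

Definition kcoord n K i (e : deg i = n) (s : surj G (grp i)) : F' n K :=
  @fg k U kidx kdeg (fun=> T0) (fun=> false) n K (existT _ i (surjT_mk s)) e (tsurj T0_triv K).

Definition ksect_val n K (a : fgen deg grp n G) : F' n K :=
  average (fun h : Ugrp (grp (fidx a)) => kcoord K (fdeg a) (conjs (fsurj a) h)).

Lemma ksect_compat n K : @fcompat k U I deg grp (fun=> false) n G (F' n K) (@ksect_val n K).
Proof.
move=> i e f g [[h eh]|[]//]; rewrite /ksect_val /=.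
rewrite -(average_reindex (p := fun t => (h * t)%g)); last exact: mulgI.
congr average; apply/funext => t; congr kcoord.
by apply: surj_eq => z; rewrite /= eh conjgM.
Qed.

Definition ksect_map n K : {linear F n G -> F' n K} := plift (@ksect_compat n K).

Lemma ksect_nat n H K (u : {multiplicative Ugrp H -> Ugrp K}) (hu : surjective u) x :
  ksect_map n H x = res (F' n) hu (ksect_map n K x).
Proof.
move: x; apply: (plin_ext (f := ksect_map n H) (g := res (F' n) hu \o ksect_map n K)) => a.
rewrite /= [ksect_map n H _]plift_gen [ksect_map n K _]plift_gen average_linear.
congr average; apply/funext => t; rewrite [RHS](fres_fg k _ (Surj hu)).
by congr fg; exact: tsurj_uniq.
Qed.

Definition ksect_r n : rhom (constc G F n) (F' n) :=
  @RHom k U (constc G F n) (F' n) (ksect_map n) (@ksect_nat n).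

Lemma ksect_comm n K x : ksect_r (n + 1) K (cd (constc G F) n K x) = cd F' n K (ksect_r n K x).
Proof. exact: linear0. Qed.

Definition ksect : chmap (constc G F) F' := @ChMap k U _ _ ksect_r ksect_comm.

Definition kretr : chmap F' (constc G F).
Proof.
apply: (@fchain k U kidx kdeg (fun=> T0) (fun=> false) (constc G F)
  (fun t => fg k (fun=> false) erefl (surjT_val (projT2 t)) : constc G F (kdeg t) T0)) => //.
Defined.

Lemma kretr_ksect n K x : kretr n K (ksect n K x) = x.
Proof.
move: x; apply: (plin_ext (f := kretr n K \o ksect_map n K) (g := idfun)) => -[i e f].
rewrite -[LHS]/(kretr n K (ksect_map n K (fg k (fun=> false) e f))) [ksect_map n K _]plift_gen average_linear.
apply: (average_const k_char0); first by apply/card_gt0P; exists 1%g.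
move=> t; rewrite [LHS]fchainE; destruct e; rewrite ccast_id -[LHS]/(fg _ _ _ _) /= surjT_mkK.
by symmetry; apply: (fg_twist k erefl); exact: conjs_twist.
Qed.

Lemma perf_const_free : perf (constc G F).
Proof.
apply: (@perf_retract k U _ F') (perf_free k _ _).
exists (dmap ksect), (dmap kretr); rewrite -deq_map_comp; apply: dmap_ceq => n K x.
exact: kretr_ksect.
Qed.
End Cells.

Lemma perf_const (Y : cplx k U) : perf Y -> perf (constc G Y).
Proof.
move: Y; apply: (perf_ind_tclosed (constc_tclosed G (@perf_tclosed k U))) => I deg grp.
exact: perf_const_free.
Qed.

(** A class [z] that is not a boundary gives a map from a shifted unit; the functional detecting [z]
    gives the retraction. *)
Lemma const_unit_retract (Y : cplx k U) : ~ acyclic_at G Y ->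
  exists m, retract (cell k m false T0) (constc G Y).
Proof.
move=> /existsNP[n] /existsNP[z] /not_implyP[hz nz].
have [f [fz fd f0]] := cofunctional nz.
pose m := n + 1.
have [i ie] : exists i : chmap (cell k m false T0) (constc G Y), forall K (s : surj K T0), i m K (cg k false erefl s) = z.
  unshelve eexists.
    by apply: (@fchain k U unit (fun=> m) (fun=> T0) (fun=> false) (constc G Y) (fun=> z)).
  by move=> K s; rewrite [LHS]fchainE ccast_id.
pose one a K : cell k m false T0 a K := if @eqP _ m a is ReflectT e then cg k false e (tsurj T0_triv K) else 0.
have one_nat a H K (u : {multiplicative Ugrp H -> Ugrp K}) (hu : surjective u) : res (cell k m false T0 a) hu (one a K) = one a H.
  rewrite /one; case: eqP => e; last exact: linear0.
  by rewrite cg_res; congr cg; exact: tsurj_uniq.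
have lin a K : linear (fun y : Y a G => f a y *: one a K) by move=> c x y; rewrite linearP scalerDl scalerA.
have nat a H K (u : {multiplicative Ugrp H -> Ugrp K}) (hu : surjective u) (y : constc G Y a K) :
    mklin (lin a H) (res (constc G Y a) hu y) = res (cell k m false T0 a) hu (mklin (lin a K) y).
  rewrite -[LHS]/(f a y *: one a H) -[mklin (lin a K) y]/(f a y *: one a K).
  by rewrite (linearZ_LR (res (cell k m false T0 a) hu)) one_nat.
pose r_ a : rhom (constc G Y a) (cell k m false T0 a) := @RHom k U (constc G Y a) (cell k m false T0 a) (fun K => mklin (lin a K)) (@nat a).
have rc a K x : r_ (a + 1) K (cd (constc G Y) a K x) = cd (cell k m false T0) a K (r_ a K x).
  by rewrite -[LHS]/(f (a + 1) (cd Y a G x) *: one (a + 1) K) fd scale0r.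
pose r : chmap (constc G Y) (cell k m false T0) := ChMap rc.
exists m, (dmap i), (dmap r); rewrite -deq_map_comp; apply: dmap_ceq => a K.
apply: (cell_lin_ext (f := r a K \o i a K) (g := idfun)) => e s; destruct e.
rewrite /= ie -[LHS]/(f m z *: one m K) fz scale1r /one; case: eqP => // e.
by rewrite (eq_irrelevance e erefl); congr cg; exact: tsurj_uniq.
Qed.

End ConstantPerfect.

(* On [e_G (x) Y] restriction along the surjection labelling a generator of [e_G]
   turns the constant complex at [Y(G)] into [Y]; this is invertible at [G]. *)
Section Evaluation.
Variables (k : fieldType) (U : finGroupType -> Prop) (G : Uob U) (Y : cplx k U).
Implicit Types (H K : Uob U).
Local Notation E := (cell k 0 false G).
Local Notation C := (constc G Y).

Section Bilinear.
Variables (n i j : int) (e : i + j == n) (K : Uob U).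

Definition ev_gen (y : Y j G) (a : @fgen U unit (fun=> 0) (fun=> G) i K) : tensor E Y n K :=
  tp e (cg k false (fdeg a) (fsurj a) : E i K) (sres (Y j) (fsurj a) y).

Lemma ev_compat y : @fcompat k U unit (fun=> 0) (fun=> G) (fun=> false) i K _ (ev_gen y).
Proof.
move=> l d f g h; rewrite /ev_gen /= (sres_inner y h); congr tp.
exact: cg_twist.
Qed.

Definition ev_val (x : E i K) (y : Y j G) : tensor E Y n K := plift (@ev_compat y) x.

Lemma ev_valE d (f : surj K G) y : ev_val (cg k false d f) y = tp e (cg k false d f : E i K) (sres (Y j) f y).
Proof. exact: plift_gen. Qed.

Lemma ev_linl y : linear (ev_val ^~ y).
Proof. by move=> a u v; exact: linearP. Qed.

Lemma ev_linr x : linear (ev_val x).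
Proof.
have EE y : ev_val x y = \sum_(c <- generic_quotient.repr x) c.1 *: ev_gen y c.2 by [].
move=> a u v; rewrite !EE scaler_sumr -big_split; apply: eq_bigr => c _.
by rewrite /ev_gen linearP tp_linr scalerDr !scalerA mulrC.
Qed.
End Bilinear.

Lemma ev_nat n i j (e : i + j == n) H K (u : {multiplicative Ugrp H -> Ugrp K}) (hu : surjective u) x y :
  ev_val e (res (E i) hu x) (res (C j) hu y) = res (tensor E Y n) hu (ev_val e x y).
Proof.
move: x; apply: (plin_ext (f := mklin (ev_linl e (y : C j H)) \o res (E i) hu)
  (g := res (tensor E Y n) hu \o mklin (ev_linl e y))) => -[[] d f].
rewrite -[LHS]/(ev_val e (res (E i) hu (cg k false d f)) (y : C j H)).
rewrite -[RHS]/(res (tensor E Y n) hu (ev_val e (cg k false d f) y)).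
by rewrite cg_res !ev_valE tp_res cg_res sres_comp.
Qed.

Definition ev_r n : rhom (tensor E C n) (tensor E Y n) :=
  @tlift k U E C n (tensor E Y n) (fun K i j e x y => ev_val e x y)
    (fun K i j e y => ev_linl e y) (fun K i j e x => ev_linr e x)
    (fun H K u hu i j e x y => ev_nat e hu x y).

Lemma ev_rE n K i j (e : i + j == n) x y : ev_r n K (tp e x y) = ev_val e x y.
Proof. exact: tliftE. Qed.

Lemma ev_comm n K z : ev_r (n + 1) K (cd (tensor E C) n K z) = cd (tensor E Y) n K (ev_r n K z).
Proof.
move: K z; apply: (tensor_ext (f := rcomp (ev_r (n + 1)) (cd (tensor E C) n))
  (g := rcomp (cd (tensor E Y) n) (ev_r n))) => K i j e x y.
rewrite -[LHS]/(ev_r _ K (cd _ n K (tp e x y))) -[RHS]/(cd _ n K (ev_r n K (tp e x y))).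
rewrite (td_tp _ (eqS1 e) (eqS2 e)) linearD (linearZ_LR (ev_r (n + 1) K)) !ev_rE.
have -> : ev_val (eqS1 e) (cd E i K x) y = 0 by exact: (linear0 (mklin (ev_linl (eqS1 e) y))).
rewrite add0r -[LHS](linearZ_LR (mklin (ev_linr (eqS2 e) x))).
move: x; apply: (cell_lin_ext (f := mklin (ev_linl (eqS2 e) ((-1) ^ i *: cd Y j G y)))
  (g := cd (tensor E Y) n K \o mklin (ev_linl e y))) => d f.
rewrite -[LHS]/(ev_val _ _ _) -[RHS]/(cd (tensor E Y) n K (ev_val e (cg k false d f) y)).
by rewrite !ev_valE (td_tp _ (eqS1 e) (eqS2 e)) tp0l add0r linearZ_LR tpZr sres_nat.
Qed.

Definition ev : chmap (tensor E C) (tensor E Y) := @ChMap k U _ _ ev_r ev_comm.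

Lemma evE n K i j (e : i + j == n) d (f : surj K G) y :
  ev n K (tp e (cg k false d f : E i K) (y : C j K)) = tp e (cg k false d f : E i K) (sres (Y j) f y).
Proof. by rewrite [LHS]tliftE ev_valE. Qed.

Section Inverse.
Variables (n i j : int) (e : i + j == n).

(** At [G] itself every label is an automorphism, so the restriction performed by [ev] can be
    undone. *)
Definition sinv (f : surj G G) : surj G G := projT1 (boolp.cid (surj_auto f (leqnn _))).

Lemma sinvP (f : surj G G) : cancel f (sinv f) /\ cancel (sinv f) f.
Proof. by rewrite /sinv; case: boolp.cid. Qed.

Definition evi_gen (y : Y j G) (a : @fgen U unit (fun=> 0) (fun=> G) i G) : tensor E C n G :=
  tp e (cg k false (fdeg a) (fsurj a) : E i G) (sres (Y j) (sinv (fsurj a)) y : C j G).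

Lemma evi_compat y : @fcompat k U unit (fun=> 0) (fun=> G) (fun=> false) i G _ (evi_gen y).
Proof.
move=> l d f g h; rewrite /evi_gen /=; congr tp; first exact: cg_twist.
apply: (@sres_inner U k (Y j) G G _ _ y); left; case: h => [[h eh]|[]//].
have [f1 f2] := sinvP f; have [g1 g2] := sinvP g.
exists (sinv f h^-1%g) => x; apply: (can_inj f1); rewrite fin_gmulfJ !f2.
by apply: (conjg_inj h); rewrite -eh g2 conjgKV.
Qed.

Definition evi_val (x : E i G) (y : Y j G) : tensor E C n G := plift (@evi_compat y) x.

Lemma evi_valE d (f : surj G G) y :
  evi_val (cg k false d f) y = tp e (cg k false d f : E i G) (sres (Y j) (sinv f) y : C j G).
Proof. exact: plift_gen. Qed.

Lemma evi_linl y : linear (evi_val ^~ y).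
Proof. by move=> a u v; exact: linearP. Qed.

Lemma evi_linr x : linear (evi_val x).
Proof.
have EE y : evi_val x y = \sum_(c <- generic_quotient.repr x) c.1 *: evi_gen y c.2 by [].
move=> a u v; rewrite !EE scaler_sumr -big_split; apply: eq_bigr => c _.
by rewrite /evi_gen linearP (@tp_linr k U E C) scalerDr !scalerA mulrC.
Qed.
End Inverse.

Definition evi n : {linear tensor E Y n G -> tensor E C n G} :=
  @tlin k U E Y n G (tensor E C n G) (fun i j e x y => evi_val e x y)
    (fun i j e y => evi_linl e y) (fun i j e x => evi_linr e x).

Lemma eviE n i j (e : i + j == n) d (f : surj G G) y :
  evi n (tp e (cg k false d f : E i G) y) = tp e (cg k false d f : E i G) (sres (Y j) (sinv f) y : C j G).
Proof. by rewrite [LHS]tlinE evi_valE. Qed.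

Lemma ev_evi n z : ev n G (evi n z) = z.
Proof.
move: z; apply: (tensor_lin_ext (f := ev n G \o evi n) (g := idfun)) => i j e x y.
move: x; apply: (cell_lin_ext (f := (ev n G \o evi n) \o mklin (tp_linl (X := E) (Y := Y) e y))
  (g := mklin (tp_linl e y))) => d f.
rewrite -[LHS]/(ev n G (evi n (tp e (cg k false d f : E i G) y))) eviE evE.
by rewrite sresK //; case: (sinvP f).
Qed.

Lemma evi_ev n z : evi n (ev n G z) = z.
Proof.
move: z; apply: (tensor_lin_ext (f := evi n \o ev n G) (g := idfun)) => i j e x y.
move: x; apply: (cell_lin_ext (f := (evi n \o ev n G) \o mklin (tp_linl (X := E) (Y := C) e y))
  (g := mklin (tp_linl e y))) => d f.
rewrite -[LHS]/(evi n (ev n G (tp e (cg k false d f : E i G) (y : C j G)))) evE eviE.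
by rewrite sresK //; case: (sinvP f).
Qed.

Lemma bij_cone_acyclic_at (X Z : cplx k U) (f : chmap X Z) (g : forall n, {linear Z n G -> X n G}) :
  (forall n x, g n (f n G x) = x) -> (forall n z, f n G (g n z) = z) -> acyclic_at G (cone f).
Proof.
move=> gf fg n; apply: cone_acyclic_at => [z hz [w hw]|z hz].
  by exists (g _ w); rewrite -(gf _ (cd _ _ _ _)) ccomm fg hw gf.
exists (g _ z); last by exists 0; rewrite linear0 fg subrr.
by rewrite -(gf _ (cd _ _ _ _)) ccomm fg hz linear0.
Qed.

Lemma ev_cone_acyclic : acyclic_at G (cone ev).
Proof. by apply: (bij_cone_acyclic_at (g := evi)) => n z; [exact: evi_ev|exact: ev_evi]. Qed.

End Evaluation.

Section Symmetrised.
Variables (k : fieldType) (k_char0 : [pchar k] =i pred0) (U : finGroupType -> Prop) (G : Uob U).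
Local Notation e := (cell k 0 false G).
Local Notation f := (cell k 0 true G).

Definition ssect_val n K (a : @fgen U unit (fun=> 0) (fun=> G) n K) : e n K :=
  average (fun t : surjT G G => cg k false (fdeg a) (scomp (surjT_val t) (fsurj a))).

Lemma stwist_surj K (u v : surj K G) : stwist true u v -> exists a : surj G G, v = scomp a u.
Proof.
have key (a : {multiplicative Ugrp G -> Ugrp G}) : (forall x, v x = a (u x)) -> exists a : surj G G, v = scomp a u.
  move=> h; have aS : surjective a by move=> y; have [x <-] := surjP v y; exists (u x).
  by exists (Surj aS); apply: surj_eq => x; rewrite h.
move=> [[h eh]|[_ [a ea]]]; last exact: key ea.
by apply: (key (conjs (sid G) h)) => x; rewrite eh.
Qed.

Lemma ssect_compat n K : @fcompat k U unit (fun=> 0) (fun=> G) (fun=> true) n K (e n K) (@ssect_val n K).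
Proof.
move=> i d u v /stwist_surj[a ->]; rewrite /ssect_val /=.
rewrite -(average_reindex _ (@surjT_reindex U G G G a)).
congr average; apply/funext => t; rewrite surjT_mkK; congr cg; exact: surj_eq.
Qed.

Definition ssect_map n K : {linear f n K -> e n K} := plift (@ssect_compat n K).

Lemma ssect_nat n H K (u : {multiplicative Ugrp H -> Ugrp K}) (hu : surjective u) x :
  ssect_map n H (res (f n) hu x) = res (e n) hu (ssect_map n K x).
Proof.
move: x; apply: (plin_ext (f := ssect_map n H \o res (f n) hu)
  (g := res (e n) hu \o ssect_map n K)) => -[[] d v].
rewrite -[LHS]/(ssect_map n H (res (f n) hu (cg k true d v))) cg_res.
rewrite -[RHS]/(res (e n) hu (ssect_map n K (cg k true d v))).
rewrite [ssect_map n H _]plift_gen [ssect_map n K _]plift_gen average_linear.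
congr average; apply/funext => t; rewrite cg_res; congr cg; exact: surj_eq.
Qed.

Definition ssect_r n : rhom (f n) (e n) := @RHom k U (f n) (e n) (ssect_map n) (@ssect_nat n).

Definition ssect : chmap f e := @ChMap k U f e ssect_r (fun _ _ _ => linear0 _).

Definition sretr : chmap e f :=
  @fchain k U unit (fun=> 0) (fun=> G) (fun=> false) f (fun=> cg k true erefl (sid G))
   (fun t K u v => @nosym_inv k U unit (fun=> G) (fun=> false) (fun=> erefl) (f 0) t (cg k true erefl (sid G)) K u v)
   (fun=> erefl).

Lemma sretrE n K (d : 0 = n) (u : surj K G) : sretr n K (cg k false d u) = cg k true d u.
Proof.
by destruct d; rewrite [LHS]fchainE ccast_id /sres cg_res; congr cg; exact: surj_eq.
Qed.

Lemma sym_retract : retract f e.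
Proof.
exists (dmap ssect), (dmap sretr); rewrite -deq_map_comp; apply: dmap_ceq => n K.
apply: (cell_lin_ext (f := sretr n K \o ssect n K) (g := idfun)) => d u.
rewrite -[LHS]/(sretr n K (ssect_map n K (cg k true d u))) [ssect_map n K _]plift_gen average_linear.
apply: (average_const k_char0); first by apply/card_gt0P; exists (surjT_mk (sid G)).
move=> t; rewrite sretrE; symmetry; apply: cg_twist; right; split=> //.
by exists (surjT_val t).
Qed.

Lemma sym_perf : perf f.
Proof. exact: perf_retract sym_retract (cell_perf k 0 G). Qed.

Variables (T0 : Uob U) (T0_triv : forall x : T0, x = 1%g).

Definition aug : chmap f (uobj k T0).
Proof.
apply: (@fchain k U unit (fun=> 0) (fun=> G) (fun=> true) (uobj k T0) (fun=> cg k false erefl (tsurj T0_triv G))).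
- by move=> _ K u v _; rewrite /sres !cg_res; congr cg; exact: tsurj_uniq.
- by [].
Defined.

Lemma augE n K (d : 0 = n) (u : surj K G) : aug n K (cg k true d u) = cg k false d (tsurj T0_triv K).
Proof.
by destruct d; rewrite [LHS]fchainE ccast_id /sres cg_res; congr cg; exact: tsurj_uniq.
Qed.

Definition augi n : {linear uobj k T0 n G -> f n G} :=
  @plift k _ _ _ _ (ltac:(by []) : @fcompat k U unit (fun=> 0) (fun=> T0) (fun=> false) n G (f n G) (fun a => cg k true (fdeg a) (sid G))).

(** Automorphisms act transitively on the surjections [G -> G], so [f_G(G)] is one-dimensional and
    maps isomorphically to [k]. *)
Lemma aug_cone_acyclic : acyclic_at G (cone aug).
Proof.
apply: (bij_cone_acyclic_at (g := augi)) => n.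
  apply: (cell_lin_ext (f := augi n \o aug n G) (g := idfun)) => d u.
  rewrite /= augE [LHS]plift_gen; apply: cg_twist; right; split=> //; exact: (ex_intro _ (u : {multiplicative _ -> _})).
apply: (cell_lin_ext (f := aug n G \o augi n) (g := idfun)) => d u.
rewrite /= [augi _ _]plift_gen augE; congr cg; exact: tsurj_uniq.
Qed.

End Symmetrised.

Lemma etri_deq (k : fieldType) (U : finGroupType -> Prop) (A X X' : cplx k U) (a : dmor A X) (s s' : dmor X X')
    (d : dmor X' (shift A)) : deq s s' -> etri a s d -> etri a s' d.
Proof.
move=> e [h0 h1 h2]; split=> [|W u|W u]; first by rewrite -e.
  by rewrite -e; exact: h1.
by move=> /h2[v hv]; exists v; rewrite -e.
Qed.

(** * The prime ideals at the groups of U *)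

Section Tower.
Variables (k : fieldType) (U : finGroupType -> Prop) (T0 : Uob U) (T0_triv : forall x : T0, x = 1%g).
Variables (E Z : cplx k U) (eps : chmap E (uobj k T0)).
Implicit Types (W : cplx k U) (K : Uob U).
Local Notation Q := (cone eps).

(** The map from [W = 1 (x) W] to [Q (x) W], with fibre [E (x) W]. *)
Definition tstep W : chmap W (tensor Q W) := ccomp (tens1 W (cinj eps)) (unitor T0_triv W).

Lemma tstep_etri W : exists (a : dmor (tensor E W) W) (d : dmor (tensor Q W) (shift (tensor E W))),
  etri a (dmap (tstep W)) d.
Proof.
have qu := unitor_qiso T0_triv W; have qt := tconem_qiso W eps.
have t := etri_iso (deq_map_inv qu) (deq_inv_map qu) (deq_map_inv qt) (deq_inv_map qt) (etri_cone (tens1 W eps)).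
eexists; eexists; apply: etri_deq t; apply: (qiso_mono qt).
rewrite deq_compA deq_map_inv deq_id_comp -!deq_map_comp; apply: dmap_ceq => n K x.
rewrite -[RHS]/(tcone _ _ n K (tens1 W (cinj eps) n K (unitor T0_triv W n K x))) unitorE tens1E tconeE.
rewrite -[LHS]/(0, unitor T0_triv W n K x) unitorE; congr pair.
by rewrite [RHS]tp0l.
Qed.

(** In the cone, [(x, 0)] of degree -1 bounds the unit element; hence [(x, 0) (x) z] bounds the
    image of [z]. *)
Lemma tstep_bdry W K n (z : W (n + 1) K) (x : E 0 K) : cd E 0 K x = 0 -> eps 0 K x = uone k T0_triv K ->
  cd W (n + 1) K z = 0 -> bdry (tstep W (n + 1) K z).
Proof.
move=> dx ex dz.
have e : -1 + (n + 1) == n by rewrite addrC addrK.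
pose u : Q (-1) K := (x, 0).
exists (tp e u z : tensor Q W n K).
rewrite (td_tp _ (eqS1 e) (eqS2 e)) dz tp0r scaler0 addr0.
have -> : cd Q (-1) K u = (0, uone k T0_triv K) :> Q (-1 + 1) K.
  by rewrite cone_dE dx oppr0 linear0 addr0 -ex.
rewrite -[RHS]/(tens1 W (cinj eps) (n + 1) K (unitor T0_triv W (n + 1) K z)) unitorE tens1E.
exact: (@pure_irr k U Q W (n + 1) K 0 (n + 1) _ _ (0, uone k T0_triv K) z).
Qed.

Fixpoint tower i : cplx k U := if i is j.+1 then tensor Q (tower j) else Z.

Lemma tower_acyclic K i : acyclic_at K Z -> acyclic_at K (tower i).
Proof.
move=> aZ; elim: i => [//|i IH]; apply/(cl_qiso (@acyclic_at_tclosed k U K) (tswap_qiso _ _)).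
exact: tensor_acyclic_at.
Qed.

Hypothesis cover : forall K, acyclic_at K Z \/ exists2 x : E 0 K, cd E 0 K x = 0 & eps 0 K x = uone k T0_triv K.

Lemma tower_ghost i : ghost (tstep (tower i)).
Proof.
move=> n K z hz; case: (cover K) => [aZ|[x dx ex]]; last exact: tstep_bdry dx ex hz.
have [w hw] := tower_acyclic aZ hz.
by exists (tstep (tower i) n K w); rewrite -ccomm hw.
Qed.

Hypotheses (k_char0 : [pchar k] =i pred0) (U_down : downward_closed U).
Variable P : cplx k U -> Prop.
Hypotheses (clP : tclosed P) (PE : forall W, perf W -> P (tensor E W)) (perfE : perf E) (perfZ : perf Z).

Lemma tower_perf i : perf (tower i).
Proof.
elim: i => [//|i IH]; apply: perf_tensor => //.
by apply: perf_cone => //; exact: perf_free.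
Qed.

(* Tensoring with the cone of [E -> 1] is a ghost map on the tower starting at [Z],
   so finitely many steps annihilate the compact object [Z]. *)
Lemma tower_mem : P Z.
Proof.
have [n hn] := perf_ghostnil perfZ.
have /dep_choice[a /dep_choice[d ht]] := fun i => tstep_etri (tower i).
have PA i : P (tensor E (tower i)) by exact/PE/tower_perf.
have [|B [c [b [PB e]]]] := factor_tower (K := Z) clP ht (fun i => approx_self Z (PA i)) (ex_intro _ _ (PA 0%N)) (n := n) (x := did Z).
  by apply: (hn tower (fun i => tstep (tower i))); exact: tower_ghost.
by apply: (cl_retract clP) PB; exists b, c; rewrite -e.
Qed.
End Tower.

(** * Quotients of finite p-groups *)

Section Groups.
Variables (p : nat) (p_prime : prime p) (U : finGroupType -> Prop) (U_down : downward_closed U).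
Hypothesis U_pgroup : forall G : finGroupType, U G -> (p.-group [set: G])%g.
Implicit Types G H K : Uob U.

Lemma trivial_exists G : exists T0 : Uob U, forall x : T0, x = 1%g.
Proof.
pose S := subg_of (1%G : {group Ugrp G}).
have S1 (x : S) : x = 1%g by apply/val_inj/set1P; exact: (valP x).
have fM : {morph (fun _ : G => 1%g : S) : x y / (x * y)%g} by move=> x y; rewrite mulg1.
have fS : surjective (fun _ : G => 1%g : S) by move=> y; exists 1%g; rewrite [RHS]S1.
by exists (exist U S (U_down (f := mkmult fM) (svalP G) fS)).
Qed.

Lemma quotient_exists G K : (#|G| < #|K|)%N -> exists2 H : Uob U, #|H| = (p * #|G|)%N & exists s : surj K H, True.
Proof.
have cardp H : exists a, #|H| = (p ^ a)%N.
  by have /p_natP[a] := U_pgroup (svalP H); rewrite cardsT; exists a.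
have [a ea] := cardp G; have [b eb] := cardp K.
rewrite ea eb ltn_exp2l ?prime_gt1 // => ab.
have pK := U_pgroup (svalP K).
(* A [p]-group has normal subgroups of every order dividing its own; order [p ^ (b - a.+1)] leaves a
   quotient of order [p ^ a.+1], which is [p * #|G|]. *)
have [|N [_ nN cN]] := @normal_pgroup p (Ugrp K) (b - a.+1)%N [group of [set: Ugrp K]%SET] [group of [set: Ugrp K]%SET] pK (normal_refl _).
  by rewrite /= cardsT eb pfactorK // leq_subr.
have NK x : x \in 'N(N)%g by have /andP[_ /subsetP] := nN; apply; rewrite inE.
have fM : {morph coset N : x y / (x * y)%g} by move=> x y; rewrite morphM.
have fS : surjective (coset N : Ugrp K -> coset_of N).
  by move=> y; have [x _ ->] := cosetP y; exists x.
exists (exist U (coset_of N) (U_down (f := mkmult fM) (svalP K) fS)); last first.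
  by exists (@Surj U K (exist U (coset_of N) _) (mkmult fM) fS).
have -> : #|{: coset_of N}| = #|([set: Ugrp K] / N)%g|.
  rewrite -cardsT; congr #|pred_of_set _|; apply/setP => y; rewrite inE; symmetry.
  have [x _ ->] := cosetP y; by rewrite mem_quotient ?inE.
apply/eqP; rewrite card_quotient ?normal_norm // -(eqn_pmul2l (cardG_gt0 N)) Lagrange ?normal_sub //.
by rewrite cardsT eb cN -expnS -expnD subnK.
Qed.

End Groups.

Section BigCells.
Variables (k : fieldType) (U : finGroupType -> Prop) (N : nat).
Implicit Types G H K : Uob U.

(** Multiplication tables of size [N] form a finite type, which keeps the sum perfect. Isomorphic
    groups may recur; this only repeats summands. *)
Definition bidx := {c : {ffun 'I_N * 'I_N -> 'I_N} |
  `[< exists H : Uob U, codes (existT _ N c) (Ugrp H) >]}.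
Definition bgrp (j : bidx) : Uob U := projT1 (boolp.cid (asboolP _ (svalP j))).

Lemma bgrpP j : codes (existT (fun m => {ffun 'I_m * 'I_m -> 'I_m}) N (sval j)) (bgrp j).
Proof. by rewrite /bgrp; case: boolp.cid. Qed.

Lemma bgrp_card j : #|bgrp j| = N.
Proof. by have [f /bij_eq_card -> _] := bgrpP j; rewrite card_ord. Qed.

Lemma bgrp_exists H : #|H| = N -> exists j, giso H (bgrp j).
Proof.
move=> eN; have [[m c] hc /= em] := code_exists (Ugrp H); rewrite {}eN in em; subst m.
pose j : bidx := exist _ c (asboolT (ex_intro _ H hc)).
exists j; exact: codes_giso hc (bgrpP j).
Qed.

Definition bcell := ffree k (fun _ : bidx => 0) bgrp (fun=> false).

Lemma bcell_acyclic G : (#|G| < N)%N -> acyclic_at G bcell.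
Proof.
move=> lt n z _; exists 0; rewrite linear0; symmetry; move: z.
apply: (plin_ext (f := idfun) (g := \0)) => -[j e s].
have /dep_choice[g sg] := surjP s.
by have := leq_card g (can_inj sg); rewrite bgrp_card leqNgt lt.
Qed.

Variables (T0 : Uob U) (T0_triv : forall x : T0, x = 1%g).

Definition baug : chmap bcell (uobj k T0).
Proof.
apply: (@fchain k U bidx (fun=> 0) bgrp (fun=> false) (uobj k T0) (fun j => uone k T0_triv (bgrp j))).
- by move=> j K f g _; rewrite /sres /uone -/(cg k false _ _) !cg_res; congr cg; exact: tsurj_uniq.
- by [].
Defined.

Lemma baug_onto K : (exists2 H : Uob U, #|H| = N & exists s : surj K H, True) ->
  exists2 x : bcell 0 K, cd bcell 0 K x = 0 & baug 0 K x = uone k T0_triv K.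
Proof.
move=> [H /bgrp_exists[j [a _]] [s _]].
exists (@fg k U bidx (fun=> 0) bgrp (fun=> false) 0 K j erefl (scomp a s)) => //.
rewrite [LHS]fchainE ccast_id /sres /uone -/(cg k false _ _) cg_res; congr cg; exact: tsurj_uniq.
Qed.

End BigCells.

Section Spectrum.
Variables (p : nat) (p_prime : prime p) (k : fieldType) (k_char0 : [pchar k] =i pred0).
Variables (U : finGroupType -> Prop) (U_down : downward_closed U).
Hypothesis U_pgroup : forall G : finGroupType, U G -> (p.-group [set: G])%g.
Implicit Types (G H K : Uob U) (X Y : cplx k U).

Lemma prime_at_tclosed G : tclosed (@prime_at k U G).
Proof.
have c := @perf_tclosed k U; have a := @acyclic_at_tclosed k U G.
split=> [X Y f [/compact_perf pX aX] [/compact_perf pY aY]|X Y f [/compact_perf pY aY] [/compact_perf pC aC]|X Y r [/compact_perf pY aY]].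
- by split; [apply/compact_perf; exact: cl_cone|exact: (cl_cone a)].
- by split; [apply/compact_perf; exact: (cl_fib c pY pC)|exact: (cl_fib a aY aC)].
- by split; [apply/compact_perf; exact: (cl_retract c r)|exact: (cl_retract a r)].
Qed.

Lemma prime_at_prime G : prime_ideal (@prime_at k U G).
Proof.
have cell_compact : compact (cell k 0 false G) by apply/compact_perf/cell_perf.
split.
- apply: tclosed_thick; [exact: prime_at_tclosed|by move=> X []|].
  exists (cone (Defs.cid (cell k 0 false G))); split; last exact: cone_id_acyclic.
  by apply/compact_perf/perf_cone; exact: cell_perf.
- move=> X Y [cX aX] cY; split; [exact: compact_tensor|exact: tensor_acyclic_at].
- by exists (cell k 0 false G) => // -[_]; exact: cell_not_acyclic.
- by move=> X Y cX cY [_ /tensor_acyclic_prime[]]; [left|right].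
Qed.

Variables (T0 : Uob U) (T0_triv : forall x : T0, x = 1%g).

(* The cone vanishes at [G]; the cells at groups of order [p |G|] map onto the unit
   at every group larger than [G], as every larger [p]-group has a quotient of that
   order. *)
Definition testobj G : cplx k U := csum (cone (aug k G T0_triv)) (bcell k U (p * #|G|)).

Lemma testobj_perf G : perf (testobj G).
Proof.
apply: (cl_csum (@perf_tclosed k U)); last exact: perf_free.
by apply: perf_cone; [exact: sym_perf|exact: perf_free].
Qed.

Lemma testobj_acyclic G : acyclic_at G (testobj G).
Proof.
apply: (cl_csum (@acyclic_at_tclosed k U G)); first exact: aug_cone_acyclic.
apply: bcell_acyclic; rewrite -[ltnLHS]mul1n ltn_pmul2r ?prime_gt1 //.
by apply/card_gt0P; exists 1%g.
Qed.

(** Either [K] has no surjection to [G] and [f_G] vanishes at [K], or the orders force [K] to be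
    isomorphic to [G] and [X] vanishes at [K]. *)
Lemma sym_tensor_vanish G K X : acyclic_at G X -> (#|K| <= #|G|)%N -> acyclic_at K (tensor (cell k 0 true G) X).
Proof.
move=> aX le; case: (pselect (exists s : surj K G, True)) => [[s _]|ns]; last first.
  by apply/tensor_acyclic_at/cell_acyclic_at => s; apply: ns; exists s.
apply/(cl_qiso (@acyclic_at_tclosed k U K) (tswap_qiso _ _))/tensor_acyclic_at => n z hz.
have [t [st ts]] := surj_auto s le; apply: (bdry_iso (a := s) (b := t) st).
by apply: aX; rewrite sres_nat hz linear0.
Qed.

Variables (P : cplx k U -> Prop) (hP : prime_ideal P) (G : Uob U) (PG : P (testobj G)).

Let clP : tclosed P := thick_tclosed (prime_thick hP).

Lemma ideal_l X Y : P X -> perf Y -> P (tensor X Y).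
Proof. by move=> PX pY; apply: (prime_tensor hP) => //; exact/compact_perf. Qed.

Lemma ideal_r X Y : perf X -> P Y -> P (tensor X Y).
Proof. by move=> pX PY; apply/(cl_qiso clP (tswap_qiso X Y)); exact: ideal_l. Qed.

Lemma unit_notin : ~ P (uobj k T0).
Proof.
move=> P1; have [X /compact_perf pX] := prime_proper hP; apply.
by apply/(cl_qiso clP (unitor_qiso T0_triv X)); exact: ideal_l.
Qed.

Lemma testobj_cone : P (cone (aug k G T0_triv)).
Proof.
apply: (cl_retract clP) PG; exists (dmap (csum_in1 _ _)), (dmap (csum_pr1 _ _)).
by rewrite -deq_map_comp; apply: dmap_ceq.
Qed.

Lemma testobj_bcell : P (bcell k U (p * #|G|)).
Proof.
apply: (cl_retract clP) PG; exists (dmap (csum_in2 _ _)), (dmap (csum_pr2 _ _)).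
by rewrite -deq_map_comp; apply: dmap_ceq.
Qed.

Lemma sym_notin : ~ P (cell k 0 true G).
Proof. by move=> Pf; apply: unit_notin; exact: cl_mid Pf testobj_cone. Qed.

Lemma prime_at_sub X : prime_at G X -> P X.
Proof.
move=> [/compact_perf pX aX]; have pf := sym_perf k_char0 G.
have PfX : P (tensor (cell k 0 true G) X).
  apply: (tower_mem (eps := baug k (p * #|G|) T0_triv) _ k_char0 U_down clP) => [K|W pW||].
  - have [le|lt] := leqP #|K| #|G|; first by left; exact: sym_tensor_vanish.
    by right; apply: baug_onto; exact: quotient_exists.
  - exact: ideal_l testobj_bcell pW.
  - exact: perf_free.
  - exact: perf_tensor.
apply/(cl_qiso clP (unitor_qiso T0_triv X)); apply: (cl_mid clP (f := tens1 X (aug k G T0_triv))) => //.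
by apply/(cl_qiso clP (tconem_qiso X _)); exact: ideal_l testobj_cone pX.
Qed.

Lemma prime_at_sup Y : P Y -> prime_at G Y.
Proof.
move=> PY; have cY := thick_compact (prime_thick hP) PY; split=> //.
have pY : perf Y by apply/compact_perf.
apply: contrapT => nY; have pC := perf_const k_char0 T0_triv G pY.
have pe := cell_perf k 0 G.
have PE : P (tensor (cell k 0 false G) (constc G Y)).
  (* The target of [ev] lies in the ideal [P]; its cone vanishes at [G], hence lies in [P] by the
     inclusion [prime_at_sub] already proved. *)
  apply: (cl_fib clP (f := ev G Y)); first exact: ideal_r.
  apply: prime_at_sub; split; last exact: ev_cone_acyclic.
  by apply/compact_perf/perf_cone; exact: perf_tensor.
case: (prime_prime hP _ _ PE); [exact/compact_perf|exact/compact_perf| |] => h.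
  by apply: sym_notin; apply: (cl_retract clP) h; exact: sym_retract.
have [m r] := const_unit_retract T0_triv nY.
by apply: unit_notin; apply/(cell_degree m false T0 clP); apply: cl_retract r h.
Qed.

Lemma testobj_prime_at : P = @prime_at k U G.
Proof. by apply/funext => X; apply/propext; split; [exact: prime_at_sup|exact: prime_at_sub]. Qed.

End Spectrum.

Lemma prime_at_iso (k : fieldType) (U : finGroupType -> Prop) (G H : Uob U) :
  Uiso G H -> @prime_at k U G = prime_at H.
Proof.
have sub (A B : Uob U) (X : cplx k U) : giso A B -> acyclic_at A X -> acyclic_at B X.
  move=> [a [b [ab ba]]] aX n z hz; apply: (bdry_iso (a := b) (b := a) ba).
  by apply: aX; rewrite sres_nat hz linear0.
move=> /Uiso_giso[a [b [ab ba]]]; apply/funext => X; apply/propext; split=> -[cX aX]; split=> //.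
  by apply: sub aX; exists a, b.
by apply: sub aX; exists b, a.
Qed.

(** The representable [e_A] is outside the prime at [A], hence outside the one at [B], so [B]
    surjects onto [A]. By symmetry the orders agree and surjections are isomorphisms. *)
Lemma prime_at_inj (k : fieldType) (U : finGroupType -> Prop) (G H : Uob U) :
  @prime_at k U G = prime_at H -> Uiso G H.
Proof.
have dom (A B : Uob U) : @prime_at k U A = prime_at B -> exists s : surj B A, True.
  move=> e; apply: contrapT => ns; apply: (@cell_not_acyclic k U false A).
  suff : prime_at B (cell k 0 false A) by rewrite -e => -[].
  split; first by apply/compact_perf/cell_perf.
  by apply: cell_acyclic_at => s; apply: ns; exists s.
move=> e; have [s _] := dom _ _ e; have [t _] := dom _ _ (esym e).
have le A B (u : surj A B) : (#|Ugrp B| <= #|Ugrp A|)%N.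
  by have /dep_choice[g ug] := surjP u; exact: leq_card (can_inj ug).
have [t' [tt' _]] := surj_auto t (le _ _ _ s).
exact: surj_iso_isog tt'.
Qed.

Lemma Uiso_sym (U : finGroupType -> Prop) (G H : Uob U) : Uiso G H -> Uiso H G.
Proof. by rewrite /Uiso isog_sym. Qed.

Lemma Uiso_class (U : finGroupType -> Prop) (G H : Uob U) : Uiso G H <-> Uiso G = Uiso H.
Proof.
split=> [h|->]; last exact: isog_refl.
apply/funext => K; apply/propext; split; last exact: isog_trans h.
by apply: isog_trans; exact: Uiso_sym.
Qed.

Theorem corollary6p9 (p : nat) (p_prime : prime p)
  (k : fieldType) (k_char0 : [pchar k] =i pred0)
  (U : finGroupType -> Prop) (U_down : downward_closed U)
  (U_pgroup : forall G : finGroupType, U G -> (p.-group [set: G])%g) :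
  exists phi : discrete (pi0 U) -> Spc k U,
    (forall G : Uob U, sval (phi (iso_class G)) = prime_at G) /\
    open_embedding phi.
Proof.
(* Elements of [pi0 U] are classes, so [phi] goes through chosen representatives; [phiE] shows that
   the choice is immaterial. *)
pose rp (c : pi0 U) : Uob U := projT1 (boolp.cid (proj2_sig c)).
have rpE c : c = iso_class (rp c).
  by case: c => c hc; rewrite /rp /=; case: boolp.cid => G /= e; apply: eq_exist.
have prE (P Q : tt_prime k U) : sval P = sval Q -> P = Q.
  by case: P Q => [P hP] [Q hQ] /= e; apply: eq_exist.
pose phi (c : pi0 U) : tt_prime k U := exist _ _ (prime_at_prime k_char0 U_down (rp c)).
have phiE G : sval (phi (iso_class G)) = prime_at G.
  rewrite /=; apply: prime_at_iso; apply/Uiso_sym/Uiso_class.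
  exact: (congr1 sval (rpE (iso_class G))).
exists phi; split=> //; split=> //.
- move=> c d /(congr1 sval) /prime_at_inj/Uiso_class e.
  by rewrite (rpE c) (rpE d); apply: eq_exist.
move=> A _ opn top basic.
(* Only openness of images remains, continuity being trivial on a discrete source. The image of [A]
   is a union of points, each the complement of the support of its test object. *)
pose B (c : pi0 U) (S : tt_prime k U -> Prop) := A c /\ S = (fun P => P = phi c).
have -> : (fun y => exists2 x, A x & phi x = y) = (fun y => exists2 S, (exists c, B c S) & S y).
  apply/funext => P; apply/propext; split=> [[c Ac <-]|[_ [c [Ac ->]] ->]]; last by exists c.
  by exists (fun P => P = phi c) => //; exists c.
apply: (topU top) => _ [c [Ac ->]]; apply: basic.
have [T0 T0_triv] := trivial_exists U_down (rp c).
exists (testobj p k T0_triv (rp c)); first by apply/compact_perf/testobj_perf.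
apply/funext => P; apply/propext; split=> [->|].
  by apply; split; [apply/compact_perf/testobj_perf|exact: testobj_acyclic].
(* As [supp] is a negation, membership in the complement is a double one. *)
move=> /contrapT h; apply: prE.
exact: (testobj_prime_at p_prime k_char0 U_down U_pgroup (proj2_sig P) h).
Qed.
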